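(* Let $n\ge1$ be an integer, let $0<H<1/2$, and let $A\in\mathbb{S}_n$. The limit $$\frac{W_H(\exp^*\tau_\varepsilon)}{\varepsilon^{H}}\ \underset{\varepsilon\to0^+}{\longrightarrow}\ T_H(\tau)$$ holds for all $\tau\in\mathfrak{M}^H$, in the sense of finite dimensional distributions of the random functionals, where $T_H$ is the centered Gaussian random linear functional on $\mathfrak{M}^H$ with $$\mathrm{Cov}\left(T_H(\tau),T_H(\tau')\right)=-K_2\int_{\mathbb{R}^n\times\mathbb{R}^n}\|x-x'\|^{2H}\,\tau(\mathrm{d}x)\,\tau'(\mathrm{d}x'),\qquad \tau,\tau'\in\mathfrak{M}^H .$$
   Context: $\mathbb{S}_n=\{(x_i)_{1\le i\le n+1}\in\mathbb{R}^{n+1}:\sum_i x_i^2=1\}$ is the $n$-dimensional unit sphere, $\sigma$ is its surface measure, and $d(x,y)\in[0,\pi]$ is the geodesic distance on $\mathbb{S}_n$ (the non-oriented angle between the vectors $x$ and $y$). $\mathbb{R}^+=[0,+\infty)$ and $\|\cdot\|$ is the Euclidean norm on $\mathbb{R}^n$. The kernel $K_H$. Define $\psi:[0,\pi]\times\mathbb{R}^+\to\mathbb{R}^+$ by $\psi(d(z,z'),r)=\int_{\mathbb{S}_n}\mathbf{1}_{d(x,z)<r}\,\mathbf{1}_{d(x,z')<r}\,\sigma(\mathrm{d}x)$ for $z,z'\in\mathbb{S}_n$, $r\in\mathbb{R}^+$ (the right-hand side depends on $z,z'$ only through $d(z,z')$). For $0<H<1/2$ (so $2H<n$), set $$K_H(u)=\int_{\mathbb{R}^+}\psi(u,r)\,r^{-n-1+2H}\,\mathrm{d}r,\qquad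 u\in[0,\pi],$$ which is finite. The constant $K_2\ge0$ is the one such that $K_H(u)=K_H(0)-K_2u^{2H}+o(u^{2H})$ as $u\to0^+$, i.e. $K_2=\lim_{u\to0^+}u^{-2H}(K_H(0)-K_H(u))$. The field $W_H$. $\mathcal{M}$ is the space of signed measures on $\mathbb{S}_n$ with finite total variation, and $W_H$ is the centered Gaussian random linear functional on $\mathcal{M}$ with $\mathrm{Cov}(W_H(\mu),W_H(\nu))=\int_{\mathbb{S}_n\times\mathbb{S}_n}K_H(d(z,z'))\,\mu(\mathrm{d}z)\,\nu(\mathrm{d}z')$. Dilation. Fix $1<\delta<\pi$. The tangent space of $\mathbb{S}_n$ at $A$ is identified (isometrically) with $\mathbb{R}^n$, $A$ corresponding to the null vector, and $\exp$ denotes the Riemannian exponential map at $A$, which is a diffeomorphism from $\{y\in\mathbb{R}^n:\|y\|<\delta\}$ onto the open geodesic ball $U_\delta=\{z\in\mathbb{S}_n:d(A,z)<\delta\}$; $\exp^{-1}$ is the inverse of this diffeomorphism. For a finite signed measure $\tau$ on $\mathbb{R}^n$ and $\varepsilon>0$, $\tau_\varepsilon(B)=\tau(B/\varepsilon)$ for Borel $B\subset\mathbb{R}^n$, and $\exp^*\tau_\varepsilon$ is the measure defined by $\exp^*\tau_\varepsilon(C)=\tau_\varepsilon(\exp^{-1}(C))$ for Borel $C\subset U_\delta$, considered as a measure on the whole of $\mathbb{S}_n$ by extending it by zero outside $U_\delta$. The space $\mathfrak{M}^H$ is the set of signed measures $\tau$ on $\mathbb{R}^n$ with finite total variation such that $\tau(\mathbb{R}^n)=0$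 and $\int_{\mathbb{R}^n\times\mathbb{R}^n}\|x-x'\|^{2H}\,|\tau|(\mathrm{d}x)\,|\tau|(\mathrm{d}x')<+\infty$. Convergence in the sense of finite dimensional distributions means that for all $k\ge1$ and $\tau_1,\dots,\tau_k\in\mathfrak{M}^H$ the corresponding $k$-dimensional random vectors converge in distribution. *)

(* Defs.v *)
From HB Require Import structures.
From mathcomp Require Import all_boot all_order all_algebra.
From mathcomp Require Import all_classical all_reals all_analysis.
From mathcomp Require Import measurable_realfun.

Set Implicit Arguments.
Unset Strict Implicit.
Unset Printing Implicit Defensive.

Import Order.TTheory GRing.Theory Num.Def Num.Theory.
Import numFieldNormedType.Exports.

Local Open Scope classical_set_scope.
Local Open Scope ring_scope.

(* The Borel sigma-algebra of R^n (more generally of m x n matrices). *)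
Section borel_matrix.
Context {R : realType} {m n : nat}.

Let borel : set (set 'M[R]_(m, n)) := <<s @open 'M[R]_(m, n) >>.

Let borel0 : borel set0. Proof. exact: sigma_algebra0. Qed.

Let borelC A : borel A -> borel (~` A). Proof. exact: sigma_algebraC. Qed.

Let borel_bigcup (F : (set 'M[R]_(m, n))^nat) :
  (forall i, borel (F i)) -> borel (\bigcup_i F i).
Proof. exact: sigma_algebra_bigcup. Qed.

HB.instance Definition _ := @isMeasurable.Build default_measure_display
  'M[R]_(m, n) borel borel0 borelC borel_bigcup.

End borel_matrix.

Section borel_matrix_theory.
Context {R : realType}.

Lemma measurable_mx_open m n (A : set 'M[R]_(m, n)) : open A -> measurable A.
Proof. exact: sub_sigma_algebra. Qed.

Lemma measurable_mx_coord m n i j :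
  measurable_fun [set: 'M[R]_(m, n)] (fun M => M i j).
Proof.
apply: (measurability _ (RGenOpens.measurableE R)) => _ [_ [a [b ->] <-]].
rewrite setTI; apply: measurable_mx_open.
have /continuousP := @coord_continuous R m n i j; apply; exact: interval_open.
Qed.

Definition rat_box m n (q : 'M[rat * rat]_(m, n)) : set 'M[R]_(m, n) :=
  [set M | forall i j, ratr (q i j).1 < M i j < ratr (q i j).2].

Lemma measurable_preimage_rat_box d (T : measurableType d) m n
    (f : T -> 'M[R]_(m, n)) q :
  (forall i j, measurable_fun [set: T] (fun x => f x i j)) ->
  measurable (f @^-1` rat_box q).
Proof.
move=> mf; rewrite (_ : _ @^-1` _ = \big[setI/setT]_(i < m)
    \big[setI/setT]_(j < n)
      ((fun x => f x i j) @^-1` `]ratr (q i j).1, ratr (q i j).2[)); last first.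
  apply/seteqP; split => [x fx|x].
    rewrite -bigcap_seq => i _; rewrite -bigcap_seq => j _ /=.
    by rewrite in_itv/=; exact: fx.
  rewrite -bigcap_seq => H i j.
  have := H i (mem_index_enum _); rewrite -bigcap_seq => /(_ j (mem_index_enum _)).
  by rewrite /= in_itv.
apply: bigsetI_measurable => i _; apply: bigsetI_measurable => j _.
by rewrite -[X in measurable X]setTI; apply: mf.
Qed.

Lemma mx_open_bigcup_rat m n (U : set 'M[R]_(m, n)) : open U ->
  U = \bigcup_q (if `[< rat_box q `<=` U >] then rat_box q else set0).
Proof.
move=> oU; apply/seteqP; split => [M UM|M [q _]]; last first.
  by case: asboolP => // qU; exact: qU.
have /nbhs_ballP[e /= e0 eU] : nbhs M U by apply: open_nbhs_nbhs.
have H i j : exists q : rat * rat,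
    [/\ M i j - e < ratr q.1, ratr q.1 < M i j,
        M i j < ratr q.2 & ratr q.2 < M i j + e].
  have /rat_in_itvoo[q1] : M i j - e < M i j by rewrite ltrBlDr ltrDl.
  rewrite in_itv/= => /andP[q1l q1r].
  have /rat_in_itvoo[q2] : M i j < M i j + e by rewrite ltrDl.
  by rewrite in_itv/= => /andP[q2l q2r]; exists (q1, q2).
pose q := \matrix_(i, j) sval (cid (H i j)).
have qU : rat_box q `<=` U.
  move=> N HN; apply: eU; split => // i j.
  have := HN i j; rewrite mxE; case: cid => p /= [a b c d] /andP[f g].
  rewrite /ball /= ltr_distlC; apply/andP; split; first exact: lt_trans f.
  exact: lt_trans d.
exists q => //; case: asboolP => // _ i j.
by rewrite mxE; case: cid => p /= [_ -> -> _].
Qed.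

Lemma measurable_fun_mx d (T : measurableType d) m n (f : T -> 'M[R]_(m, n)) :
  (forall i j, measurable_fun [set: T] (fun x => f x i j)) ->
  measurable_fun [set: T] f.
Proof.
move=> mf; apply: (measurability (@open 'M[R]_(m, n))) => // _ [U oU <-].
rewrite setTI (mx_open_bigcup_rat oU) preimage_bigcup.
apply: countable_bigcupT_measurable; first exact: countableP.
move=> q; case: asboolP => _; last by rewrite preimage_set0.
exact: measurable_preimage_rat_box.
Qed.

End borel_matrix_theory.

Section lebesgue_rV.
Context {R : realType}.

Definition rV_cons n (p : measurableTypeR R * 'rV[R]_n) : 'rV[R]_n.+1 :=
  \row_j (if unlift ord0 j is Some i then p.2 0 i else p.1).

Definition rV_uncons n (v : 'rV[R]_n.+1) : measurableTypeR R * 'rV[R]_n :=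
  (v 0 0, \row_j v 0 (lift ord0 j)).

Lemma rV_consK n : cancel (@rV_cons n) (@rV_uncons n).
Proof.
move=> [t v]; rewrite /rV_uncons mxE unlift_none; congr pair.
by apply/rowP => j; rewrite !mxE liftK.
Qed.

Lemma rV_unconsK n : cancel (@rV_uncons n) (@rV_cons n).
Proof.
move=> v; apply/rowP => j; rewrite !mxE.
by case: unliftP => [k ->|-> //]; rewrite mxE.
Qed.

Lemma measurable_rV_cons n : measurable_fun setT (@rV_cons n).
Proof.
apply: measurable_fun_mx => i j; rewrite /rV_cons.
under eq_fun do rewrite mxE.
case: (unlift ord0 j) => [k|]; last exact: measurable_fst.
exact: (measurableT_comp (@measurable_mx_coord R 1 n 0 k) measurable_snd).
Qed.

Lemma measurable_rV_uncons n : measurable_fun setT (@rV_uncons n).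
Proof.
apply: measurable_fun_pair; first exact: measurable_mx_coord.
apply: measurable_fun_mx => i j; under eq_fun do rewrite mxE.
exact: measurable_mx_coord.
Qed.

Section step.
Variables (n : nat) (mu : {sigma_finite_measure set 'rV[R]_n -> \bar R}).

Definition lebesgue_step : set 'rV[R]_n.+1 -> \bar R :=
  pushforward (@lebesgue_measure R \x mu)%E (@rV_cons n).

HB.instance Definition _ := Measure.copy lebesgue_step
  (measure_function_pushforward__canonical__measure_function_Measure
    (@lebesgue_measure R \x mu)%E (@measurable_rV_cons n)).

Let lebesgue_step_sigma_finite : sigma_finite setT lebesgue_step.
Proof.
have /sigma_finiteP[F [TF ndF Foo]] := sigma_finiteT (@lebesgue_measure R).
have /sigma_finiteP[G [TG ndG Goo]] := sigma_finiteT mu.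
exists (fun k => @rV_uncons n @^-1` (F k `*` G k)).
  apply/esym/seteqP; split => // v _.
  have [k _ Fk] : (\bigcup_k F k) (rV_uncons v).1 by rewrite -TF.
  have [l _ Gl] : (\bigcup_k G k) (rV_uncons v).2 by rewrite -TG.
  exists (maxn k l) => //; split => /=.
    by move: Fk; exact/subsetPset/ndF/leq_maxl.
  by move: Gl; exact/subsetPset/ndG/leq_maxr.
move=> k; have [mF Fk] := Foo k; have [mG Gk] := Goo k; split.
  rewrite -[X in measurable X]setTI; apply: measurable_rV_uncons => //.
  exact: measurableX.
rewrite /lebesgue_step /pushforward -comp_preimage.
rewrite (_ : _ \o _ = id); last by apply/funext => p; exact: rV_consK.
by rewrite preimage_id product_measure1E// lte_mul_pinfty// ge0_fin_numE.
Qed.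

HB.instance Definition _ := Measure_isSigmaFinite.Build _ _ _ lebesgue_step
  lebesgue_step_sigma_finite.

End step.

Fixpoint lebesgue_rV n : {sigma_finite_measure set 'rV[R]_n -> \bar R} :=
  if n is k.+1 then lebesgue_step (lebesgue_rV k) else \d_(0 : 'rV[R]_0).

End lebesgue_rV.

Section euclidean.
Context {R : realType}.

Definition dot n (u v : 'rV[R]_n) : R := \sum_i u 0 i * v 0 i.

(* The canonical norm of 'rV[R]_n is the sup norm. *)
Definition enorm n (u : 'rV[R]_n) : R := Num.sqrt (dot u u).

Lemma dotE n (u v : 'rV[R]_n) : dot u v = (u *m v^T) 0 0.
Proof. by rewrite mxE; apply: eq_bigr => i _; rewrite mxE. Qed.

Lemma dotC n (u v : 'rV[R]_n) : dot u v = dot v u.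
Proof. by apply: eq_bigr => i _; rewrite mulrC. Qed.

Lemma dotDl n (u v w : 'rV[R]_n) : dot (u + v) w = dot u w + dot v w.
Proof. by rewrite !dotE mulmxDl mxE. Qed.

Lemma dotDr n (u v w : 'rV[R]_n) : dot w (u + v) = dot w u + dot w v.
Proof. by rewrite !(dotC w) dotDl. Qed.

Lemma dotZl n k (u v : 'rV[R]_n) : dot (k *: u) v = k * dot u v.
Proof. by rewrite !dotE -scalemxAl mxE. Qed.

Lemma dotZr n k (u v : 'rV[R]_n) : dot u (k *: v) = k * dot u v.
Proof. by rewrite !(dotC u) dotZl. Qed.

Lemma dot_ge0 n (u : 'rV[R]_n) : 0 <= dot u u.
Proof. by apply: sumr_ge0 => i _; rewrite -expr2 sqr_ge0. Qed.

Lemma enorm_ge0 n (u : 'rV[R]_n) : 0 <= enorm u.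
Proof. exact: sqrtr_ge0. Qed.

Lemma enormE n (u : 'rV[R]_n) : enorm u ^+ 2 = dot u u.
Proof. by rewrite sqr_sqrtr// dot_ge0. Qed.

Lemma measurable_enorm n : measurable_fun setT (@enorm n).
Proof.
have -> : @enorm n = fun u => dot u u `^ 2^-1.
  by apply/funext => u; rewrite powR12_sqrt// dot_ge0.
apply: (measurableT_comp (measurable_powR _)).
by apply: measurable_sum => i; apply: measurable_funM; exact: measurable_mx_coord.
Qed.

Lemma measurable_enormV n : measurable_fun setT (fun u : 'rV[R]_n => (enorm u)^-1).
Proof.
have -> : (fun u : 'rV[R]_n => (enorm u)^-1) = fun u => enorm u `^ (-1).
  by apply/funext => u; rewrite powR_inv1// enorm_ge0.
exact: (measurableT_comp (measurable_powR _) (@measurable_enorm n)).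
Qed.

End euclidean.

Section sphere.
Context {R : realType}.

Definition sphere_pred n : pred 'rV[R]_n.+1 := fun x => dot x x == 1.

Definition sphere n := {x : 'rV[R]_n.+1 | sphere_pred x}.

HB.instance Definition _ n := Choice.on (sphere n).

Lemma dot_delta n (i j : 'I_n) :
  dot (delta_mx 0 i) (delta_mx 0 j) = (i == j)%:R :> R.
Proof.
rewrite /dot (bigD1 i)//= big1 => [|k ki]; rewrite !mxE ?eqxx/= ?mul1r ?addr0//.
by rewrite (negbTE ki) mul0r.
Qed.

Let pole_subproof n : sphere_pred (delta_mx 0 ord0 : 'rV[R]_n.+1).
Proof. by rewrite /sphere_pred dot_delta eqxx. Qed.

Definition pole n : sphere n := Sub (delta_mx 0 ord0) (@pole_subproof n).

HB.instance Definition _ n := isPointed.Build (sphere n) (@pole n).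

(* Borel sets of the sphere: traces of the Borel sets of R^(n+1). *)
HB.instance Definition _ n := @isMeasurable.Build default_measure_display
  (sphere n) (g_sigma_algebra_preimage (val : sphere n -> 'rV[R]_n.+1))
  (@measurable0 _ (g_sigma_algebra_preimageType
    (val : sphere n -> 'rV[R]_n.+1)))
  (@measurableC _ (g_sigma_algebra_preimageType
    (val : sphere n -> 'rV[R]_n.+1)))
  (@bigcupT_measurable _ (g_sigma_algebra_preimageType
    (val : sphere n -> 'rV[R]_n.+1))).

Lemma measurable_sphere_val n :
  measurable_fun setT (val : sphere n -> 'rV[R]_n.+1).
Proof. by move=> _ B mB; exists B. Qed.

Lemma measurable_fun_sphere d (T : measurableType d) n (f : T -> sphere n) :
  measurable_fun setT (val \o f) -> measurable_fun setT f.
Proof.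
move=> mf _ _ [B mB <-]; rewrite !setTI.
by have := mf measurableT B mB; rewrite setTI.
Qed.

(* Geodesic distance: the angle between x and y. *)
Definition gdist n (x y : sphere n) : R := acos (dot (val x) (val y)).

Definition radial n (y : 'rV[R]_n.+1) : sphere n :=
  insubd (pole n) ((enorm y)^-1 *: y).

Lemma measurable_radial n : measurable_fun setT (@radial n).
Proof.
apply: measurable_fun_sphere.
rewrite (_ : _ \o _ = fun y : 'rV[R]_n.+1 =>
    if dot ((enorm y)^-1 *: y) ((enorm y)^-1 *: y) == 1
    then (enorm y)^-1 *: y else val (pole n)); last first.
  by apply/funext => y; rewrite /= val_insubd.
have mcoord i : measurable_fun setT
    (fun y : 'rV[R]_n.+1 => ((enorm y)^-1 *: y) 0 i).
  under eq_fun do rewrite mxE.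
  by apply: measurable_funM; [exact: measurable_enormV|exact: measurable_mx_coord].
apply: measurable_fun_ifT.
- apply: measurable_fun_eqr; last exact: measurable_cst.
  by apply: measurable_sum => i; exact: measurable_funM.
- by apply: measurable_fun_mx => i j; rewrite ord1; exact: mcoord.
- exact: measurable_cst.
Qed.

Definition punctured_ball n : set 'rV[R]_n := [set y | 0 < enorm y <= 1].

Lemma measurable_punctured_ball n : measurable (@punctured_ball n).
Proof.
rewrite (_ : @punctured_ball n = @enorm R n @^-1` `]0, 1]); last first.
  by apply/seteqP; split => y /=; rewrite in_itv.
by rewrite -[X in measurable X]setTI; apply: measurable_enorm.
Qed.

(* Surface measure: the measure of C is n+1 times the Lebesgue measure of the
   cone {t x | 0 < t <= 1, x in C}. *)
Definition surface_measure n : {measure set (sphere n) -> \bar R} :=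
  mscale (n.+1%:R)%:nng
    (measure_function_pushforward__canonical__measure_function_Measure
      (mrestr (@lebesgue_rV R n.+1) (@measurable_punctured_ball n.+1))
      (@measurable_radial n)).

Definition meridian n (u : R) : sphere n :=
  insubd (pole n) (cos u *: delta_mx 0 ord0 + sin u *: delta_mx 0 ord_max).

Lemma gdist_pole_meridian n (u : R) : (0 < n)%N -> 0 <= u <= pi ->
  gdist (pole n) (meridian n u) = u.
Proof.
move=> n0 u0pi; have n0max : (ord0 : 'I_n.+1) != ord_max.
  by rewrite -val_eqE/= ltn_eqF.
have nmax0 : (ord_max : 'I_n.+1) != ord0 by rewrite eq_sym.
rewrite /gdist /meridian val_insubd /sphere_pred.
rewrite !(dotDl, dotDr, dotZl, dotZr, dot_delta) !eqxx (negbTE n0max).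
rewrite (negbTE nmax0) !mulr0 !mulr1 addr0 add0r -!expr2 cos2Dsin2 eqxx.
rewrite !(dotDr, dotZr, dot_delta) eqxx (negbTE n0max) mulr1 mulr0 addr0.
by rewrite cosK// in_itv.
Qed.

End sphere.

Section kernel.
Context {R : realType}.
Variables (n : nat) (H : R).

(* For z, z' at distance u, sigma {x | d(x, z) < r, d(x, z') < r} depends on u
   only; it is evaluated at z = pole, z' = meridian u (gdist_pole_meridian). *)
Definition psi (u r : R) : R :=
  \int[@surface_measure R n]_(x in setT)
    (\1_[set y | gdist y (pole n) < r] x *
     \1_[set y | gdist y (meridian n u) < r] x).

Definition KH (u : R) : R :=
  \int[@lebesgue_measure R]_(r in `[0, +oo[)
    (psi u r * r `^ (- n%:R - 1 + 2 * H)).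

Definition K2 : R :=
  lim ((u `^ (- (2 * H)) * (KH 0 - KH u)) @[u --> 0^'+]).

End kernel.

Section signed_measures.
Context {R : realType}.

Section jordan.
Context d (T : measurableType d).
Variable mu : {charge set T -> \bar R}.

Let hahn_pos := cid (Hahn_decomposition mu).
Let hahn_neg := cid (svalP hahn_pos).

Definition charge_pos : {finite_measure set T -> \bar R} :=
  jordan_pos (svalP hahn_neg).

Definition charge_neg : {finite_measure set T -> \bar R} :=
  jordan_neg (svalP hahn_neg).

Definition charge_var : set T -> \bar R := charge_variation (svalP hahn_neg).

HB.instance Definition _ := Measure.on charge_var.

Let charge_var_fin : fin_num_fun charge_var.
Proof. by move=> A mA; rewrite fin_num_measure. Qed.

HB.instance Definition _ := @Measure_isFinite.Build _ _ _
  charge_var charge_var_fin.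

End jordan.

(* The integral of f with respect to the signed measure mu (x) nu, expanded
   along the Jordan decompositions of mu and nu. *)
Definition charge_integral2 d1 d2 (T1 : measurableType d1)
    (T2 : measurableType d2) (mu : {charge set T1 -> \bar R})
    (nu : {charge set T2 -> \bar R}) (f : T1 * T2 -> R) : R :=
  \int[(charge_pos mu \x charge_pos nu)%E]_(x in setT) f x
  - \int[(charge_pos mu \x charge_neg nu)%E]_(x in setT) f x
  - \int[(charge_neg mu \x charge_pos nu)%E]_(x in setT) f x
  + \int[(charge_neg mu \x charge_neg nu)%E]_(x in setT) f x.

Definition in_MH n (H : R) (tau : {charge set 'rV[R]_n -> \bar R}) : Prop :=
  tau setT = 0%E /\
  (\int[charge_var tau \x charge_var tau]_x
     (enorm (x.1 - x.2) `^ (2 * H))%:E < +oo)%E.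

Lemma measurable_scale n (e : R) :
  measurable_fun setT (fun x : 'rV[R]_n => e *: x).
Proof.
apply: measurable_fun_mx => i j; under eq_fun do rewrite mxE.
by apply: measurable_funM => //; exact: measurable_mx_coord.
Qed.

Definition dilate n (tau : {charge set 'rV[R]_n -> \bar R}) (e : R) :
    {charge set 'rV[R]_n -> \bar R} :=
  measure_function_pushforward__canonical__charge_Charge tau
    (@measurable_scale n e).

End signed_measures.

Section exponential.
Context {R : realType}.

(* A linear isometry y |-> y *m J of R^n onto the tangent space of the sphere
   at A. *)
Record tangent_frame n (A : sphere n) := TangentFrame {
  frame_mx :> 'M[R]_(n, n.+1) ;
  frame_orthonormal : frame_mx *m frame_mx^T = 1%:M ;
  frame_tangent : frame_mx *m (val A)^T = 0
}.

Variables (n : nat) (A : sphere n) (J : tangent_frame A).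

Let exp_mx (y : 'rV[R]_n) : 'rV[R]_n.+1 :=
  cos (enorm y) *: val A + (sin (enorm y) / enorm y) *: (y *m J).

Let exp_mx_sphere y : sphere_pred (exp_mx y).
Proof.
have AA : dot (val A) (val A) = 1 by exact/eqP/(valP A).
have JA : dot (y *m J) (val A) = 0.
  by rewrite dotE -mulmxA frame_tangent mulmx0 mxE.
have AJ : dot (val A) (y *m J) = 0 by rewrite dotC.
have JJ : dot (y *m J) (y *m J) = enorm y ^+ 2.
  rewrite dotE trmx_mul -mulmxA [X in _ *m X]mulmxA frame_orthonormal mul1mx.
  by rewrite -dotE enormE.
rewrite /sphere_pred /exp_mx !(dotDl, dotDr, dotZl, dotZr) AA JA AJ JJ.
rewrite !mulr0 mulr1 addr0 add0r mulrA -!expr2; apply/eqP.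
have [y0|y0] := eqVneq (enorm y) 0.
  by rewrite y0 expr0n/= mulr0 addr0 cos0 expr1n.
by rewrite -exprMn divfK// cos2Dsin2.
Qed.

(* The Riemannian exponential map of the sphere at A: geodesics are the great
   circles parametrized by arc length. *)
Definition sphere_exp (y : 'rV[R]_n) : sphere n := Sub _ (exp_mx_sphere y).

Lemma measurable_sphere_exp : measurable_fun setT sphere_exp.
Proof.
apply: measurable_fun_sphere; apply: measurable_fun_mx => i j.
rewrite (_ : (fun _ => _) = fun y => cos (enorm y) * val A i j +
    sin (enorm y) * (enorm y)^-1 * \sum_k y i k * J k j); last first.
  by apply/funext => y; rewrite /= /exp_mx !mxE.
apply: measurable_funD.
  apply: measurable_funM => //.
  apply: (@measurableT_comp _ _ _ _ _ _ cos); last exact: measurable_enorm.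
  by apply: continuous_measurable_fun; exact: continuous_cos.
apply: measurable_funM.
  apply: measurable_funM; last exact: measurable_enormV.
  apply: (@measurableT_comp _ _ _ _ _ _ sin); last exact: measurable_enorm.
  by apply: continuous_measurable_fun; exact: continuous_sin.
apply: measurable_sum => k; apply: measurable_funM => //.
exact: measurable_mx_coord.
Qed.

Lemma measurable_eball (delta : R) :
  measurable [set y : 'rV[R]_n | enorm y < delta].
Proof.
rewrite (_ : [set y | _] = @enorm R n @^-1` `]-oo, delta[); last first.
  by apply/seteqP; split => y /=; rewrite in_itv.
by rewrite -[X in measurable X]setTI; apply: measurable_enorm.
Qed.

(* C |-> tau {y | enorm y < delta, sphere_exp y \in C}: as sphere_exp is
   injective on the ball of radius delta <= pi, this is tau (exp^-1 C) extended
   by zero outside the geodesic ball of radius delta around A. *)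
Definition exp_pushforward (delta : R)
    (tau : {charge set 'rV[R]_n -> \bar R}) :
    {charge set (sphere n) -> \bar R} :=
  measure_function_pushforward__canonical__charge_Charge
    (crestr tau (measurable_eball delta)) measurable_sphere_exp.

End exponential.

Section random.
Context {R : realType}.

(* The case s = 0 is the Dirac mass, which normal_prob 0 0 is not. *)
Definition centered_gaussian d (T : measurableType d) (P : probability T R)
    (X : T -> R) : Prop :=
  exists s : R, forall B : set R, measurable B ->
    P (X @^-1` B) = if s == 0 then \d_(0 : R) B else normal_prob 0 s B.

(* The values of X outside the space S of signed measures are irrelevant. *)
Record gaussian_functional d (T : measurableType d) (P : probability T R)
    d' (E : measurableType d') (S : {charge set E -> \bar R} -> Prop)
    (X : {charge set E -> \bar R} -> {RV P >-> R})
    (C : {charge set E -> \bar R} -> {charge set E -> \bar R} -> R) : Prop := {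
  gaussian_functional_linear : forall (a b : R) mu nu, S mu -> S nu ->
    {ae P, forall w,
      X (cadd (cscale a mu) (cscale b nu)) w = a * X mu w + b * X nu w} ;
  gaussian_functional_gaussian :
    forall k (c : 'I_k -> R) (mu : 'I_k -> {charge set E -> \bar R}),
    (forall i, S (mu i)) ->
    centered_gaussian P (fun w => \sum_(i < k) c i * X (mu i) w) ;
  gaussian_functional_covariance : forall mu nu, S mu -> S nu ->
    covariance P (X mu) (X nu) = (C mu nu)%:E
}.

Definition WH_cov n (H : R) (mu nu : {charge set (sphere n) -> \bar R}) : R :=
  charge_integral2 mu nu (fun z => KH n H (gdist z.1 z.2)).

Definition TH_cov n (H : R) (tau tau' : {charge set 'rV[R]_n -> \bar R}) : R :=
  - K2 n H *
  charge_integral2 tau tau' (fun x => enorm (x.1 - x.2) `^ (2 * H)).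

Definition cvg_in_distribution I (F : set_system I) k
    d (T : measurableType d) (P : probability T R) (X : I -> T -> 'rV[R]_k)
    d' (T' : measurableType d') (P' : probability T' R) (Y : T' -> 'rV[R]_k)
    : Prop :=
  forall f : 'rV[R]_k -> R, continuous f ->
    (exists M : R, forall x, `|f x| <= M) ->
    ('E_P[f \o X i] @[i --> F] --> 'E_P' [f \o Y])%E.

End random.

(* Main.v *)
(* Write a = n - 2H.  In polar coordinates, K_H(u) = (n+1)/a times the integral
   over the unit ball of R^(n+1) of m_u(y)^-a, where m_u(y) is the larger of the
   geodesic distances of y/|y| to two points at distance u.  Shrinking the n
   tangential coordinates by u turns u^(-2H) (K_H(0) - K_H(u)) into an integral
   whose integrand converges as u -> 0 and is dominated: the limit K_2 exists and
   |K_H(0) - K_H(u)| <= C u^(2H).  The covariance of W_H(exp^* tau_eps) / eps^H is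
   then the sum of a term in K_H(0), which is O(eps^(2H)) because tau has mass zero
   and a moment of order 2H, and of integrals of eps^(-2H) (K_H(0) - K_H(d)), to
   which dominated convergence applies since d(exp eps x, exp eps x') / eps tends
   to |x - x'| and is at most |x| + |x'|.  So the covariances converge.  For the
   laws, bounded continuous functions are approximated, up to eta (1 + |x|^2), by
   trigonometric polynomials: Bernstein polynomials in the variables
   (1 + sin (x_i / M)) / 2.  The mean of a trigonometric polynomial of a Gaussian
   vector is a continuous function of its covariance matrix. *)
From HB Require Import structures.
Require Import Defs.
From mathcomp Require Import all_boot all_order all_algebra.
From mathcomp Require Import all_classical all_reals all_analysis.
From mathcomp Require Import measurable_realfun ring lra.

Set Implicit Arguments.
Unset Strict Implicit.
Unset Printing Implicit Defensive.

Import Order.TTheory GRing.Theory Num.Theory.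
Import numFieldNormedType.Exports.

Local Open Scope classical_set_scope.
Local Open Scope ring_scope.

(** * Centered Gaussian variables *)

(** The range of H enters as n - 1 < a < n. As a < n, |v|^-a is integrable near the origin of R^n,
    which makes K_H finite; as a + 1 > n, the difference of two such powers at radii at most one
    apart, of order |v|^-(a+1), is integrable at infinity. The coordinate along the pole is not
    shrunk and stays in [-1, 1], so only the n tangential dimensions matter. On the probabilistic
    side, a quadratic error in the trigonometric approximation does the work of tightness:
    integrating it takes only second moments, which are the very data known to converge. Every
    centered Gaussian law is written as that of s Z with Z standard normal and s a function of the
    variance, so that degenerate laws, which the covariances do not exclude, need no separate
    treatment. *)

Section lebesgue_scale.
Context {R : realType}.
Local Notation leb := (@lebesgue_measure R).

Lemma measurable_mulrl (c : R) :
  measurable_fun setT ( *%R c : measurableTypeR R -> measurableTypeR R).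
Proof. exact: mulrl_measurable. Qed.

Lemma lebesgue_measure_scale (c : R) (A : set R) : 0 < c -> measurable A ->
  (leb A = c%:E * leb ( *%R c @^-1` A))%E.
Proof.
move=> c0 mA.
pose m := mscale (NngNum (ltW c0))
  (measure_function_pushforward__canonical__measure_function_Measure leb (measurable_mulrl c)).
suff -> : leb A = m A by [].
apply: (lebesgue_measure_unique (mu := m)) => // _ [[a b] _ <-].
rewrite [RHS](_ : _ = (c%:E * leb `](a / c)%R, (b / c)%R]%classic)%E); last first.
  change (c%:E * leb ( *%R c @^-1` `]a, b]) = c%:E * leb `](a / c)%R, (b / c)%R])%E.
  congr (_ * leb _)%E; apply/seteqP; split => x; rewrite /= !in_itv/=;
  by rewrite ltr_pdivrMr// ler_pdivlMr// (mulrC x).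
rewrite !lebesgue_measure_itv/= !lte_fin ltr_pM2r ?invr_gt0//.
case: ifP => _; last by rewrite mule0.
by rewrite -!EFinB -EFinM -mulrBl mulrCA divff ?mulr1 ?gt_eqF.
Qed.

Lemma ge0_integral_scale (c : R) (f : R -> \bar R) : 0 < c ->
  measurable_fun setT f -> (forall x, 0 <= f x)%E ->
  (\int[leb]_x f x = c%:E * \int[leb]_x f (c * x)%R)%E.
Proof.
move=> c0 mf f0.
pose m := mscale (NngNum (ltW c0))
  (measure_function_pushforward__canonical__measure_function_Measure leb (measurable_mulrl c)).
rewrite (eq_measure_integral m); last first.
  by move=> A mA _; (exact: lebesgue_measure_scale || exact/esym/lebesgue_measure_scale).
by rewrite ge0_integral_mscale// ge0_integral_pushforward.
Qed.

End lebesgue_scale.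

Section gaussian_law.
Context {R : realType}.
Local Notation leb := (@lebesgue_measure R).
Local Notation gamma := (@normal_prob R 0 1).

Lemma lebesgue_measure_opp (A : set R) : measurable A ->
  leb A = leb (-%R @^-1` A).
Proof.
move=> mA.
have mN : measurable_fun setT (-%R : measurableTypeR R -> measurableTypeR R).
  exact: oppr_measurable.
pose m := measure_function_pushforward__canonical__measure_function_Measure leb mN.
apply: (lebesgue_measure_unique (mu := m)) => // _ [[a b] _ <-].
rewrite [RHS](_ : _ = leb `[(- b)%R, (- a)%R[%classic); last first.
  congr (leb _); apply/seteqP; split => x; rewrite /= !in_itv/=;
  by rewrite ltrNr lerNl andbC.
by rewrite !lebesgue_measure_itv/= !lte_fin ltrN2 opprK addrC.
Qed.

Lemma ge0_integral_opp (f : R -> \bar R) :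
  measurable_fun setT f -> (forall x, 0 <= f x)%E ->
  (\int[leb]_x f x = \int[leb]_x f (- x)%R)%E.
Proof.
move=> mf f0.
have mN : measurable_fun setT (-%R : measurableTypeR R -> measurableTypeR R).
  exact: oppr_measurable.
rewrite (eq_measure_integral (measure_function_pushforward__canonical__measure_function_Measure leb mN)); last first.
  by move=> A mA _; exact: lebesgue_measure_opp.
by rewrite ge0_integral_pushforward.
Qed.

Lemma measurable_patch_normal_pdf (s : R) (B : set R) : measurable B ->
  measurable_fun setT ((fun x => (normal_pdf 0 s x)%:E) \_ B).
Proof.
move=> mB; apply/(measurable_restrictT _ mB).
apply: measurable_funTS. apply/measurable_EFinP.
exact: measurable_normal_pdf.
Qed.

Lemma normal_prob_opp (B : set R) : measurable B ->
  gamma (-%R @^-1` B) = gamma B.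
Proof.
move=> mB; rewrite /normal_prob [LHS]integral_mkcond [RHS]integral_mkcond.
rewrite [RHS]ge0_integral_opp.
- apply: eq_integral => x _; rewrite !patchE.
  have -> : (- x \in B) = (x \in -%R @^-1` B) by [].
  by case: ifP => //; rewrite !normal_pdfE ?oner_neq0// /normal_fun !subr0 sqrrN.
- exact: measurable_patch_normal_pdf.
- by move=> x; rewrite patchE; case: ifP => // _; rewrite lee_fin normal_pdf_ge0.
Qed.

(** Change of variable x = s z: the Jacobian s cancels the factor 1 / s in the peak of the
    density. *)
Lemma normal_prob_scale (s : R) (B : set R) : 0 < s -> measurable B ->
  normal_prob 0 s B = gamma ( *%R s @^-1` B).
Proof.
move=> s0 mB; rewrite /normal_prob [LHS]integral_mkcond [RHS]integral_mkcond.
have ms : measurable_fun setT ((fun x => (normal_pdf 0 s x)%:E) \_ B).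
  exact: measurable_patch_normal_pdf.
rewrite [LHS](@ge0_integral_scale _ s)//; last first.
  by move=> x; rewrite patchE; case: ifP => // _; rewrite lee_fin normal_pdf_ge0.
rewrite -ge0_integralZl//; first last.
- by rewrite lee_fin ltW.
- by move=> x _; rewrite patchE; case: ifP => // _; rewrite lee_fin normal_pdf_ge0.
- exact: (measurableT_comp ms (measurable_mulrl s)).
apply: eq_integral => x _; rewrite !patchE.
have -> : (s * x \in B) = (x \in *%R s @^-1` B) by [].
case: ifP => // _; last by rewrite mule0.
rewrite -EFinM !normal_pdfE ?oner_neq0 ?gt_eqF//.
rewrite /normal_peak /normal_fun !subr0 expr1n mul1r mulrA; congr (_ * expR _)%:E.
  rewrite -mulrnAr sqrtrM ?sqr_ge0// sqrtr_sqr gtr0_norm// invfM mulrA.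
  by rewrite divff ?mul1r// gt_eqF.
by rewrite -mulr_natr -(mulr_natr 1) mul1r exprMn; field; rewrite gt_eqF.
Qed.

End gaussian_law.

Local Notation pushm :=
  measure_function_pushforward__canonical__measure_function_Measure.

Section gaussian_variable.
Context {R : realType}.
Local Notation gamma := (@normal_prob R 0 1).

(** Its value 1 is never computed. Being nonzero is enough, and even finiteness is not proved:
    [fine] sends +oo to 0, which gives the right scale in that case too. *)
Definition gauss_m2 : \bar R := (\int[gamma]_z (z ^+ 2)%:E)%E.

Lemma gauss_m2_ge0 : (0 <= gauss_m2)%E.
Proof. by apply: integral_ge0 => z _; rewrite lee_fin sqr_ge0. Qed.

(** Otherwise z would vanish almost surely, whereas the normal law is absolutely continuous and
    gives mass zero to the point 0. *)
Lemma gauss_m2_neq0 : gauss_m2 != 0%E.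
Proof.
apply/negP => /eqP m0.
have m2 : measurable_fun [set: R] (fun z : R => (z ^+ 2)%:E).
  by apply/measurable_EFinP; exact: measurable_funX.
have /(ae_eq_integral_abs gamma measurableT m2) : (\int[gamma]_z `|(z ^+ 2)%:E| = 0)%E.
  by rewrite -[RHS]m0; apply: eq_integral => z _; rewrite /= ger0_norm ?sqr_ge0.
move=> [N [mN N0 subN]].
have g0 : gamma [set~ 0] = 0%E.
  apply: (subset_measure0 _ mN _ N0); first exact: measurableC.
  move=> z z0; apply: subN => /= /(_ Logic.I) [] /eqP.
  by rewrite sqrf_eq0 => /eqP.
have g1 : gamma [set 0] = 0%E.
  have /null_content_dominatesP := @normal_prob_dominates R 0 1.
  by apply => //; exact: lebesgue_measure_set1.
have : gamma setT = 0%E.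
  have mC : measurable [set~ (0 : R)] by exact: measurableC.
  have := measureU gamma (measurable_set1 (0 : R)) mC (setICr _).
  by rewrite setUv => ->; rewrite [X in (X + _)%E]g1 [X in (_ + X)%E]g0 adde0.
by rewrite probability_setT => -[] /eqP; rewrite oner_eq0.
Qed.

Context d (T : measurableType d) (P : probability T R) (X : T -> R).
Hypothesis mX : measurable_fun setT X.
Hypothesis gX : centered_gaussian P X.

Lemma centered_gaussian_scale : exists2 s : R, 0 <= s &
  forall B, measurable B -> P (X @^-1` B) = gamma ( *%R s @^-1` B).
Proof.
have [s Ps] := gX.
have [s0|s0] := eqVneq s 0.
  exists 0 => // B mB; rewrite Ps// s0 eqxx diracE.
  have [B0|B0] := pselect (B 0).
    rewrite mem_set// (_ : _ @^-1` _ = setT) ?probability_setT//.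
    by apply/seteqP; split => // x _; rewrite /= mul0r.
  rewrite memNset// (_ : _ @^-1` _ = set0) ?measure0//.
  by apply/seteqP; split => // x; rewrite /= mul0r.
(* The normal density depends on s through s^2 only, so s may be replaced by its absolute value. *)
exists `|s|; first exact: normr_ge0.
move=> B mB; rewrite Ps// (negbTE s0) -(@normal_prob_scale _ `|s| B) ?normr_gt0//.
apply: eq_integral => x _; congr EFin.
by rewrite !normal_pdfE ?normr_eq0// /normal_peak /normal_fun real_normK ?num_real.
Qed.

(** Both integrals are differences of the integrals of positive and negative parts, so equality
    holds for every measurable f, integrable or not. *)
Lemma centered_gaussian_integral s :
  (forall B, measurable B -> P (X @^-1` B) = gamma ( *%R s @^-1` B)) ->
  forall f : R -> \bar R, measurable_fun setT f ->
  (\int[P]_w f (X w) = \int[gamma]_z f (s * z)%R)%E.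
Proof.
move=> Ps.
have ms : measurable_fun setT ( *%R s : measurableTypeR R -> measurableTypeR R).
  exact: measurable_mulrl.
have mX' : measurable_fun setT (X : T -> measurableTypeR R) by exact: mX.
have ge0E f : measurable_fun setT f -> (forall x, 0 <= f x)%E ->
    (\int[P]_w f (X w) = \int[gamma]_z f (s * z)%R)%E.
  move=> mf f0.
  rewrite -[LHS](@ge0_integral_pushforward _ _ _ _ _ _ mX' P setT f)//.
  rewrite -[RHS](@ge0_integral_pushforward _ _ _ _ _ _ ms gamma setT f)//.
  exact: (@eq_measure_integral _ _ _ setT (pushm gamma ms) (pushm P mX')
    f (fun A mA _ => Ps A mA)).
move=> f mf; rewrite integralE [RHS]integralE; congr (_ - _)%E.
  under eq_integral do rewrite (funepos_comp f X).
  under [RHS]eq_integral do rewrite (funepos_comp f ( *%R s)).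
  by rewrite /= ge0E//; exact: measurable_funepos.
under eq_integral do rewrite (funeneg_comp f X).
under [RHS]eq_integral do rewrite (funeneg_comp f ( *%R s)).
by rewrite /= ge0E//; exact: measurable_funeneg.
Qed.

(** By symmetry of the normal law the positive and negative parts have the same integral B. If B is
    infinite, B - B is still sent to 0 by [fine]; this form is the one in which the mean occurs in a
    covariance. *)
Lemma centered_gaussian_mean : fine 'E_P[X] = 0.
Proof.
have [s _ /centered_gaussian_integral sP] := centered_gaussian_scale.
rewrite unlock (sP EFin)// integralE.
set A := (\int[_]_x _ x)%E; set B := (\int[_]_x _ x)%E.
suff -> : A = B by case: B => [r||]//=; rewrite subrr.
have mN : measurable_fun setT (-%R : measurableTypeR R -> measurableTypeR R).
  exact: oppr_measurable.
have ms : measurable_fun setT (fun z : R => (s * z)%:E).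
  by apply/measurable_EFinP; exact: measurable_mulrl.
transitivity (\int[pushm gamma mN]_z ((fun z : R => (s * z)%:E)^\+)%E z)%E.
  by apply: (eq_measure_integral (pushm gamma mN)) => C mC _;
    exact/esym/normal_prob_opp.
rewrite ge0_integral_pushforward//; last exact: measurable_funepos.
apply: eq_integral => x _; rewrite /= funeposE funenegE /= mulrN.
by rewrite EFinN.
Qed.

(** The second moment is s^2 times that of Z, which determines s >= 0. The law thus becomes an
    explicit function of v. *)
Lemma centered_gaussian_var (v : R) : 'E_P[X * X]%E = v%:E -> forall f : R -> \bar R,
  measurable_fun setT f ->
  (\int[P]_w f (X w) = \int[gamma]_z f (Num.sqrt (v / fine gauss_m2) * z)%R)%E.
Proof.
move=> Xv f mf; have [s s0 /centered_gaussian_integral sP] := centered_gaussian_scale.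
suff -> : Num.sqrt (v / fine gauss_m2) = s by exact: sP.
have : v%:E = ((s ^+ 2)%:E * gauss_m2)%E.
  rewrite -Xv unlock.
  rewrite (sP (fun x => (x * x)%:E)); last first.
    by apply/measurable_EFinP; exact: measurable_funM.
  rewrite -ge0_integralZl//; last 3 first.
  - by apply/measurable_EFinP; exact: measurable_funX.
  - by move=> x _; rewrite lee_fin sqr_ge0.
  - by rewrite lee_fin sqr_ge0.
  by apply: eq_integral => z _; rewrite -EFinM -expr2 exprMn.
move: gauss_m2_neq0 gauss_m2_ge0; case: gauss_m2 => [m|_ _|//]/=; last first.
  (* Were the second moment of Z infinite, the finite value v would force s = 0, in agreement with
     division by [fine +oo], that is by 0. *)
  rewrite invr0 mulr0 sqrtr0.
  have [->|s1] := eqVneq s 0; first by [].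
  by rewrite gt0_muley// lte_fin exprn_gt0// lt_neqAle eq_sym s1.
rewrite eqe lee_fin => m0 _ [->].
by rewrite mulfK// sqrtr_sqr ger0_norm.
Qed.

End gaussian_variable.

(** * Approximation by trigonometric polynomials *)

Section sine.
Context {R : realType}.
Implicit Types a b m : R.

(** With midpoint c and half-length d >= m, sin b - sin a = 2 cos c sin d, and |c| + d <= pi / 2
    gives cos c >= sin d. This makes the injectivity of the sine quantitative up to the ends of the
    interval, where its derivative vanishes. *)
Lemma sin_gap a b m : 0 <= m -> - (pi / 2) <= a -> b <= pi / 2 ->
  a + m *+ 2 <= b -> 2 * sin m ^+ 2 <= sin b - sin a.
Proof.
move=> m0 a1 b1 ab.
have le_sin x y : - (pi / 2) <= x -> x <= y -> y <= pi / 2 -> @sin R x <= sin y.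
  move=> x1 xy y1.
  have h : {in `[(- (pi/2)), pi/2] &, {mono @sin R : x y / x <= y}}.
    by apply: le_mono_in => u v ui vi; rewrite ltr_sin.
  by rewrite h// in_itv/= ?x1 ?y1 ?(le_trans xy y1) ?(le_trans x1 xy).
have pi0 : 0 < pi :> R by exact: pi_gt0.
pose c := (a + b) / 2; pose d := (b - a) / 2.
have [md dpi] : m <= d /\ d <= pi / 2 by rewrite /d; split; lra.
have sm : sin m <= sin d by apply: le_sin => //; lra.
have sm0 : 0 <= sin m by apply: sin_ge0_pi; apply/andP; split; lra.
have cd : sin d <= cos c.
  have [c0|c0] := leP 0 c.
    rewrite -cosN -sinDpihalf; apply: le_sin => //; rewrite /c /d in c0 *; lra.
  rewrite -sinDpihalf; apply: le_sin => //; rewrite /c /d in c0 *; lra.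
have -> : sin b - sin a = 2 * (cos c * sin d).
  have -> : b = c + d by rewrite /c /d; lra.
  have -> : a = c - d by rewrite /c /d; lra.
  by rewrite sinD sinB; ring.
rewrite ler_pM2l// expr2; apply: (le_trans (ler_wpM2l sm0 sm)).
apply: ler_wpM2r; first exact: le_trans sm.
exact: le_trans cd.
Qed.

Lemma sin_dist_ge a b m : 0 <= m -> `|a| <= pi / 2 -> `|b| <= pi / 2 ->
  m *+ 2 <= `|a - b| -> 2 * sin m ^+ 2 <= `|sin a - sin b|.
Proof.
move=> m0; rewrite !ler_norml => /andP[a1 a2] /andP[b1 b2].
wlog ab : a b a1 a2 b1 b2 / a <= b.
  move=> h; have [ab|ba] := leP a b; first exact: h.
  by rewrite distrC (distrC (sin a)); apply: h => //; exact: ltW.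
rewrite distrC ger0_norm ?subr_ge0// => mab.
rewrite distrC; apply: le_trans (ler_norm _); apply: sin_gap => //; lra.
Qed.

End sine.

Section bernstein.
Context {R : realType}.
Implicit Types (s : R) (N : nat).

Definition bernstein N (j : nat) s : R := 'C(N, j)%:R * (s ^+ j * (1 - s) ^+ (N - j)).

Lemma bernstein_ge0 N j s : 0 <= s <= 1 -> 0 <= bernstein N j s.
Proof.
by move=> /andP[s0 s1]; rewrite /bernstein !mulr_ge0 ?exprn_ge0// subr_ge0.
Qed.

Lemma sum_bernstein N s : \sum_(j < N.+1) bernstein N j s = 1.
Proof.
rewrite -[RHS](expr1n R N) -(subrK s 1) exprDn; apply: eq_bigr => j _.
by rewrite /bernstein mulr_natl [s ^+ j * _]mulrC.
Qed.

(** The identity j C(N, j) = N C(N - 1, j - 1) lowers the degree by one. It gives this mean and then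
    the second factorial moment, easier to reach than the second moment. *)
Lemma sum_bernstein1 N s : \sum_(j < N.+1) j%:R * bernstein N j s = N%:R * s.
Proof.
case: N => [|N]; first by rewrite big_ord1 !mul0r.
rewrite big_ord_recl mul0r add0r -[RHS]mulr1 -[X in _ = _ * X](sum_bernstein N s) mulr_sumr.
apply: eq_bigr => j _; rewrite /bernstein /= /bump/= add1n subSS exprS.
have /(congr1 (fun n => n%:R : R)) := mul_bin_diag N.+1 j; rewrite !natrM/= => E.
transitivity (j.+1%:R * 'C(N.+1, j.+1)%:R * (s * s ^+ j * (1 - s) ^+ (N - j)) : R).
  by ring.
by rewrite -E; ring.
Qed.

Lemma sum_bernstein2 N s :
  \sum_(j < N.+1) j%:R * (j%:R - 1) * bernstein N j s = N%:R * (N%:R - 1) * s ^+ 2.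
Proof.
case: N => [|N]; first by rewrite big_ord1 !mul0r.
rewrite big_ord_recl !mul0r add0r.
have -> : N.+1%:R * (N.+1%:R - 1) * s ^+ 2 = N.+1%:R * s * (N%:R * s) :> R.
  by rewrite -natr1; ring.
rewrite -(sum_bernstein1 N s) mulr_sumr.
apply: eq_bigr => j _; rewrite /bernstein /= /bump/= add1n subSS exprS.
have /(congr1 (fun n => n%:R : R)) := mul_bin_diag N.+1 j; rewrite !natrM/= => E.
have -> : j.+1%:R - 1 = j%:R :> R by rewrite -natr1 addrK.
transitivity (j.+1%:R * 'C(N.+1, j.+1)%:R * j%:R * (s * s ^+ j * (1 - s) ^+ (N - j)) : R).
  by ring.
by rewrite -E; ring.
Qed.

(* Variance of the empirical frequency of N + 1 Bernoulli(s) trials. *)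
Lemma bernstein_variance N s : 0 <= s <= 1 ->
  \sum_(j < N.+2) bernstein N.+1 j s * (s - j%:R / N.+1%:R) ^+ 2 <= N.+1%:R^-1.
Proof.
move=> /andP[s0 s1]; set n := N.+1.
have n0 : n%:R != 0 :> R by rewrite pnatr_eq0.
rewrite (eq_bigr (fun j : 'I_n.+1 => s ^+ 2 * bernstein n j s
   + (n%:R ^- 2 - 2 * s / n%:R) * (j%:R * bernstein n j s)
   + n%:R ^- 2 * (j%:R * (j%:R - 1) * bernstein n j s))); last first.
  by move=> j _; field.
rewrite !big_split/= -!mulr_sumr sum_bernstein sum_bernstein1 sum_bernstein2.
rewrite [leLHS](_ : _ = s * (1 - s) / n%:R); last by field.
rewrite -[leRHS]mul1r ler_wpM2r// ?invr_ge0//.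
by rewrite mulr_ile1 ?subr_ge0// gerBl.
Qed.

End bernstein.

Section trig_poly.
Context {R : realType} {k : nat}.

(* The phase makes the class closed under products. *)
Inductive trig_poly : ('rV[R]_k -> R) -> Prop :=
| trig_cos c b : trig_poly (fun x => cos (dot c x + b))
| trig_add p q : trig_poly p -> trig_poly q -> trig_poly (fun x => p x + q x)
| trig_scale a p : trig_poly p -> trig_poly (fun x => a * p x).

Lemma trig_cst (a : R) : trig_poly (fun=> a).
Proof.
have := trig_scale a (trig_cos 0 0); congr trig_poly; apply/funext => x.
by rewrite dotE mul0mx mxE addr0 cos0 mulr1.
Qed.

Lemma trig_mul p q : trig_poly p -> trig_poly q -> trig_poly (fun x => p x * q x).
Proof.
move=> tp; elim: tp q => [c b|p1 p2 _ h1 _ h2|a p1 _ h1] q tq; last 2 first.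
- have := trig_add (h1 _ tq) (h2 _ tq); congr trig_poly; apply/funext => x.
  by rewrite mulrDl.
- have := trig_scale a (h1 _ tq); congr trig_poly; apply/funext => x.
  by rewrite mulrA.
elim: tq => [c' b'|p1 p2 _ h1 _ h2|a p1 _ h1].
- have := trig_add (trig_scale 2^-1 (trig_cos (c + c') (b + b')))
    (trig_scale 2^-1 (trig_cos (c - c') (b - b'))).
  congr trig_poly; apply/funext => x.
  have -> : dot (c + c') x + (b + b') = (dot c x + b) + (dot c' x + b').
    by rewrite dotDl; ring.
  have -> : dot (c - c') x + (b - b') = (dot c x + b) - (dot c' x + b').
    by rewrite dotDl -scaleN1r dotZl; ring.
  by rewrite cosD cosB; field.
- have := trig_add h1 h2; congr trig_poly; apply/funext => x.
  by rewrite mulrDr.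
- have := trig_scale a h1; congr trig_poly; apply/funext => x.
  by rewrite mulrCA.
Qed.

Lemma trig_sum (I : Type) (r : seq I) (p : I -> 'rV[R]_k -> R) :
  (forall i, trig_poly (p i)) -> trig_poly (fun x => \sum_(i <- r) p i x).
Proof.
move=> tp; elim: r => [|i r ih].
  by have := trig_cst 0; congr trig_poly; apply/funext => x; rewrite big_nil.
have := trig_add (tp i) ih; congr trig_poly; apply/funext => x.
by rewrite big_cons.
Qed.

Lemma trig_prod (I : Type) (r : seq I) (p : I -> 'rV[R]_k -> R) :
  (forall i, trig_poly (p i)) -> trig_poly (fun x => \prod_(i <- r) p i x).
Proof.
move=> tp; elim: r => [|i r ih].
  by have := trig_cst 1; congr trig_poly; apply/funext => x; rewrite big_nil.
have := trig_mul (tp i) ih; congr trig_poly; apply/funext => x.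
by rewrite big_cons.
Qed.

Lemma trig_exp p m : trig_poly p -> trig_poly (fun x => p x ^+ m).
Proof.
move=> tp; elim: m => [|m ih].
  by have := trig_cst 1; congr trig_poly.
by have := trig_mul tp ih; congr trig_poly; apply/funext => x; rewrite exprS.
Qed.

(* Injective on [-pi M / 2, pi M / 2]. *)
Definition squash (M : R) (t : R) : R := (1 + sin (t / M)) / 2.

Lemma trig_squash M (i : 'I_k) : trig_poly (fun x => squash M (x 0 i)).
Proof.
have := trig_add (trig_cst 2^-1)
  (trig_scale 2^-1 (trig_cos (M^-1 *: delta_mx 0 i) (- (pi / 2)))).
congr trig_poly; apply/funext => x; rewrite dotZl cosBpihalf.
have -> : dot (delta_mx 0 i) x = x 0 i.
  rewrite /dot (bigD1 i)//= big1 => [|j ji]; rewrite !mxE ?eqxx ?mul1r ?addr0//.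
  by rewrite (negbTE ji) mul0r.
by rewrite /squash (mulrC _ M^-1); field.
Qed.

Lemma trig_bernstein N j M (i : 'I_k) :
  trig_poly (fun x => bernstein N j (squash M (x 0 i))).
Proof.
apply: trig_mul; first exact: trig_cst.
apply: trig_mul; first exact/trig_exp/trig_squash.
apply/trig_exp/trig_add; first exact: trig_cst.
have := trig_scale (-1) (trig_squash M i); congr trig_poly; apply/funext => x.
by rewrite mulN1r.
Qed.

Lemma squash01 M t : 0 <= squash M t <= 1.
Proof.
have := sin_geN1 (t / M); have := sin_le1 (t / M); rewrite /squash => ? ?.
by apply/andP; split; lra.
Qed.

(** The preimage under [squash M], coordinate by coordinate, of the grid point j / (N + 1). *)
Definition node (M : R) (N : nat) (j : {ffun 'I_k -> 'I_N.+2}) : 'rV[R]_k :=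
  \row_i (M * asin ((j i)%:R / N.+1%:R * 2 - 1)).

Definition bernstein_weight N (s : 'I_k -> R) (j : {ffun 'I_k -> 'I_N.+2}) : R :=
  \prod_i bernstein N.+1 (j i) (s i).

Lemma sum_bernstein_weight N (s : 'I_k -> R) :
  \sum_(j : {ffun 'I_k -> 'I_N.+2}) bernstein_weight s j = 1.
Proof.
rewrite /bernstein_weight -(bigA_distr_bigA (fun i (j : 'I_N.+2) => bernstein N.+1 j (s i))).
by rewrite big1// => i _; exact: sum_bernstein.
Qed.

(** The sum over multi-indices factors by distributivity. Every coordinate other than i contributes
    a total weight 1, which leaves the one-dimensional variance. *)
Lemma bernstein_weight_variance N (s : 'I_k -> R) (i : 'I_k) :
  (forall i, 0 <= s i <= 1) ->
  \sum_(j : {ffun 'I_k -> 'I_N.+2})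
    bernstein_weight s j * (s i - (j i)%:R / N.+1%:R) ^+ 2 <= N.+1%:R^-1.
Proof.
move=> s01; apply: le_trans (bernstein_variance N (s01 i)).
pose F i' (j : 'I_N.+2) := bernstein N.+1 j (s i') *
  (if i' == i then (s i' - j%:R / N.+1%:R) ^+ 2 else 1).
rewrite (eq_bigr (fun j : {ffun 'I_k -> 'I_N.+2} => \prod_i' F i' (j i'))).
  rewrite -(bigA_distr_bigA F) (bigD1 i)//= [X in _ * X]big1 ?mulr1.
    rewrite le_eqVlt; apply/orP; left; apply/eqP.
    by apply: eq_bigr => j _; rewrite /F eqxx.
  move=> i' i'i; rewrite /F (negbTE i'i).
  by under eq_bigr do rewrite mulr1; exact: sum_bernstein.
move=> j _; rewrite big_split/=; congr (_ * _).
rewrite (bigD1 i)//= eqxx [X in _ = _ * X]big1 ?mulr1// => i' i'i.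
by rewrite (negbTE i'i).
Qed.

End trig_poly.

Section trig_approx.
Context {R : realType} {k : nat}.
Implicit Types (f : 'rV[R]_k -> R) (x y : 'rV[R]_k).

(** Compactness of the cube turns the pointwise moduli of continuity into a single one. Only x is
    confined to the cube. *)
Lemma continuous_cube_unif f (L eta : R) : continuous f -> 0 < eta ->
  exists2 d : R, 0 < d & forall x y, (forall i, `|x 0 i| <= L) ->
    (forall i, `|x 0 i - y 0 i| < d) -> `|f x - f y| <= eta.
Proof.
move=> cf eta0.
pose K := [set x : 'rV[R]_k | forall i, `[(- L), L]%classic (x 0 i)].
have : compact K.
  by apply: (@rV_compact R k (fun=> `[(- L), L]%classic)) => i; exact: segment_compact.
move/compact_near_coveringP => nc.
pose Q (d : R) x := forall y, (forall i, `|x 0 i - y 0 i| < d) -> `|f x - f y| <= eta.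
have : \forall d \near 0^'+, K `<=` Q d.
  apply: nc => x _.
  have eta2 : 0 < eta / 2 by rewrite divr_gt0.
  have /cvgrPdist_lt/(_ _ eta2)/nbhs_ballP[r /= r0 xr] := cf x.
  have r2 : 0 < r / 2 by rewrite divr_gt0.
  exists (ball x (r / 2), [set d | d < r / 2]).
    split => /=; first exact: nbhsx_ballx.
    exact: nbhs_right_lt.
  move=> [x' d] [/= [_ xx'] dr] y x'y.
  have e1 : `|f x - f x'| < eta / 2.
    apply: xr; split => // i j; apply: le_ball (xx' i j).
    by rewrite ler_pdivrMr// ler_pMr// ler1n.
  have e2 : `|f x - f y| < eta / 2.
    apply: xr; split => // i j; rewrite !ord1 /ball/=.
    have := xx' 0 j; rewrite /ball/= => xx'j.
    rewrite [r]splitr -(subrK (x' 0 j) (x 0 j)) -addrA.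
    apply: (le_lt_trans (ler_normD _ _)); apply: ltrD => //.
    exact: lt_trans (x'y j) dr.
  rewrite -(subrK (f x) (f x')) -addrA (le_trans (ler_normD _ _))//.
  by rewrite [eta]splitr distrC lerD// ltW.
move=> [r /= r0 h]; exists (r / 2); first by rewrite divr_gt0.
move=> x y xL xy; apply: (h (r / 2)) => //.
- rewrite /ball/= sub0r normrN ger0_norm ?divr_ge0 ?ltW//.
  by rewrite ltr_pdivrMr// ltr_pMr// ltr1n.
- by rewrite divr_gt0.
- by move=> i /=; rewrite in_itv/= -ler_norml.
Qed.

(** Inside the cube |x_i| <= L the binomial weights concentrate on nodes near x, and Chebyshev's
    inequality bounds the rest. Outside, periodicity makes the approximation meaningless, but the
    quadratic term of the bound exceeds 2 B there. *)
Lemma trig_approx f (B eta : R) : continuous f -> (forall x, `|f x| <= B) ->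
  0 < eta -> exists2 p, trig_poly p &
    forall x, `|f x - p x| <= eta * (1 + \sum_i x 0 i ^+ 2).
Proof.
move=> cf fB eta0.
have B0 : 0 <= B by exact: le_trans (normr_ge0 _) (fB 0).
(* M is 1 + c with c = 2 B / eta, and (1 + c)^2 >= c. *)
have [M M0 MB] : exists2 M : R, 0 < M & 2 * B <= eta * M ^+ 2.
  exists (1 + 2 * B / eta).
    by rewrite ltr_wpDr// divr_ge0 ?mulr_ge0// ltW.
  set c := 2 * B / eta; have -> : 2 * B = eta * c by rewrite /c; field; rewrite gt_eqF.
  have c0 : 0 <= c by rewrite /c divr_ge0 ?mulr_ge0// ltW.
  by rewrite ler_pM2l//; nra.
have pi0 : 0 < pi :> R by exact: pi_gt0.
pose L := M * (pi / 2).
have [d d0 fd] := continuous_cube_unif L cf (divr_gt0 eta0 (ltr0Sn R 1)).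
have dM : 0 < d / M by rewrite divr_gt0.
(* The first bound makes a gap d between coordinates a gap of at least 2 m between angles; the
   second keeps sin m positive. *)
pose m := Num.min (d / M / 2) (pi / 4).
have m0 : 0 < m by rewrite lt_min !divr_gt0.
have mpi : m < pi by rewrite gt_min; apply/orP; right; lra.
have [kap kap0 kapE] : exists2 kap, 0 < kap & kap = sin m ^+ 2.
  by exists (sin m ^+ 2) => //; rewrite exprn_gt0// sin_gt0_pi// m0.
(* Chebyshev's constant: the error 2 B per distant node, the squared gap [kap ^+ 2] between squashed
   coordinates, and one variance for each of the k coordinates. *)
pose C := 2 * B / kap ^+ 2 * k%:R.
have [N CN] : exists N, C / N.+1%:R <= eta / 2.
  exists (Num.truncn (C / (eta / 2))).
  rewrite ler_pdivrMr// -ler_pdivrMl ?divr_gt0// mulrC; apply: ltW; exact: truncnS_gt.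
pose s x i := squash M ((x : 'rV[R]_k) 0 i).
pose p x := \sum_(j : {ffun 'I_k -> 'I_N.+2}) f (node M j) * bernstein_weight (s x) j.
exists p.
  apply: trig_sum => j; apply: trig_mul; [exact: trig_cst|].
  by apply: trig_prod => i; exact: trig_bernstein.
move=> x.
have s01 i : 0 <= s x i <= 1 by exact: squash01.
have w0 j : 0 <= @bernstein_weight R k N (s x) j.
  by apply: prodr_ge0 => i _; exact: bernstein_ge0.
have fp : `|f x - p x| <= \sum_(j : {ffun 'I_k -> 'I_N.+2})
    `|f x - f (node M j)| * bernstein_weight (s x) j.
  have -> : f x - p x = \sum_(j : {ffun 'I_k -> 'I_N.+2})
      (f x - f (node M j)) * bernstein_weight (s x) j.
    under eq_bigr do rewrite mulrBl.
    by rewrite sumrB -mulr_sumr sum_bernstein_weight mulr1.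
  apply: (le_trans (ler_norm_sum _ _ _)); apply: ler_sum => j _.
  by rewrite normrM (ger0_norm (w0 j)).
have BB y z : `|f y - f z| <= 2 * B.
  by apply: (le_trans (ler_normB _ _)); rewrite mulr2n mulrDl mul1r lerD.
apply: (le_trans fp).
(* If some |x_i| > L, then |x_i| >= M because pi / 2 >= 1, and the trivial error 2 B is at most eta
   x_i^2. *)
have [xL|] := pselect (forall i, `|x 0 i| <= L); last first.
  move/existsNP => [i /negP]; rewrite -ltNge => Lx.
  apply: (@le_trans _ _ (2 * B)).
    rewrite [leRHS](_ : _ = \sum_(j : {ffun 'I_k -> 'I_N.+2})
      2 * B * bernstein_weight (s x) j); last first.
      by rewrite -mulr_sumr sum_bernstein_weight mulr1.
    by apply: ler_sum => j _; rewrite ler_wpM2r.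
  apply: (le_trans MB); rewrite ler_pM2l//.
  apply: (@le_trans _ _ (x 0 i ^+ 2)).
    rewrite -(real_normK (num_real (x 0 i))) lerXn2r ?nnegrE ?(ltW M0)//.
    apply: le_trans (ltW Lx); rewrite /L ler_pMr// ler_pdivlMr// mul1r.
    exact: pi_ge2.
  rewrite (bigD1 i)//= addrCA ler_wpDr// addr_ge0//.
  by apply: sumr_ge0 => ? _; exact: sqr_ge0.
apply: (@le_trans _ _ eta); last first.
  rewrite ler_peMr ?(ltW eta0)// lerDl.
  by apply: sumr_ge0 => ? _; exact: sqr_ge0.
pose e (j : {ffun 'I_k -> 'I_N.+2}) i := (s x i - (j i)%:R / N.+1%:R) ^+ 2.
have key j : `|f x - f (node M j)| <= eta / 2 + 2 * B / kap ^+ 2 * \sum_i e j i.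
  have e0 i : 0 <= e j i by exact: sqr_ge0.
  have [xd|] := pselect (forall i, `|x 0 i - node M j 0 i| < d).
    apply: (le_trans (fd _ _ xL xd)); rewrite lerDl mulr_ge0//.
      by rewrite divr_ge0 ?mulr_ge0 ?exprn_ge0 ?(ltW kap0).
    by apply: sumr_ge0.
  (* For a node d-far from x in coordinate i, [sin_dist_ge] separates the squashed coordinates by at
     least [kap], so that [e j i] >= [kap ^+ 2]. *)
  move/existsNP => [i /negP]; rewrite -leNgt => di.
  apply: (le_trans (BB _ _)); rewrite ler_wpDl ?divr_ge0 ?(ltW eta0)//.
  rewrite -[leLHS]mulr1 -(mulrA (2 * B)) ler_wpM2l ?mulr_ge0// ler_pdivlMl ?exprn_gt0// mulr1.
  apply: (@le_trans _ _ (e j i)); last first.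
    by rewrite (bigD1 i)//= lerDl sumr_ge0.
  rewrite /e -(real_normK (num_real (s x i - _))) lerXn2r ?nnegrE ?(ltW kap0)//.
  set t := (j i)%:R / N.+1%:R.
  have t01 : 0 <= t <= 1.
    rewrite /t divr_ge0//= ler_pdivrMr// mul1r ler_nat.
    by rewrite -ltnS.
  have t11 : -1 <= t * 2 - 1 <= 1 by move: t01 => /andP[? ?]; apply/andP; split; lra.
  have aM : `|x 0 i / M| <= pi / 2.
    by rewrite normrM normfV (gtr0_norm M0) ler_pdivrMr// mulrC.
  have bM : `|asin (t * 2 - 1)| <= pi / 2.
    by rewrite ler_norml asin_geNpi2// asin_lepi2.
  have := sin_dist_ge (ltW m0) aM bM.
  rewrite asinK ?in_itv//= => h.
  have {h} : 2 * sin m ^+ 2 <= `|sin (x 0 i / M) - (t * 2 - 1)|.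
    apply: h; move: di; rewrite mxE -/t => di.
    apply: (@le_trans _ _ (d / M)).
      by rewrite -mulr_natr -ler_pdivlMr// ge_min lexx.
    rewrite ler_pdivrMr// (le_trans di)//.
    rewrite -[X in _ <= _ * X](gtr0_norm M0) -normrM mulrBl divfK ?gt_eqF//.
    by rewrite [_ * M]mulrC.
  rewrite -kapE /s /squash.
  have -> : sin (x 0 i / M) - (t * 2 - 1) = 2 * ((1 + sin (x 0 i / M)) / 2 - t) by field.
  by rewrite normrM ger0_norm// ler_pM2l.
apply: (@le_trans _ _ (\sum_(j : {ffun 'I_k -> 'I_N.+2})
   (eta / 2 + 2 * B / kap ^+ 2 * \sum_i e j i) * bernstein_weight (s x) j)).
  by apply: ler_sum => j _; rewrite ler_wpM2r.
under eq_bigr do rewrite mulrDl.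
rewrite big_split/= -mulr_sumr sum_bernstein_weight mulr1 [leRHS]splitr lerD2l.
apply: le_trans CN.
under eq_bigr do rewrite -(mulrA (2 * B / kap ^+ 2)).
rewrite -mulr_sumr /C -(mulrA (2 * B / kap ^+ 2)).
rewrite ler_wpM2l ?divr_ge0 ?mulr_ge0 ?exprn_ge0 ?(ltW kap0)//.
under eq_bigr do rewrite mulr_suml.
rewrite exchange_big/=.
apply: (@le_trans _ _ (\sum_(i < k) N.+1%:R^-1)).
  apply: ler_sum => i _; apply: le_trans (bernstein_weight_variance N i s01).
  by rewrite le_eqVlt; apply/orP; left; apply/eqP/eq_bigr => j _; rewrite mulrC.
by rewrite sumr_const card_ord -[leLHS]mulr_natl.
Qed.

End trig_approx.

(** * Convergence of Gaussian vectors *)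

Section trig_measurable.
Context {R : realType} {k : nat}.

Lemma measurable_trig_poly (p : 'rV[R]_k -> R) : trig_poly p ->
  measurable_fun setT p.
Proof.
elim=> {p} [c b|p q _ mp _ mq|a p _ mp].
- apply: (@measurableT_comp _ _ _ _ _ _ (@cos R)).
    by apply: continuous_measurable_fun; exact: continuous_cos.
  apply: measurable_funD => //; apply: measurable_sum => i.
  by apply: measurable_funM => //; exact: measurable_mx_coord.
- exact: measurable_funD.
- exact: measurable_funM.
Qed.

Lemma trig_poly_bounded (p : 'rV[R]_k -> R) : trig_poly p ->
  exists B, forall x, `|p x| <= B.
Proof.
elim=> {p} [c b|p q _ [B pB] _ [C qC]|a p _ [B pB]].
- by exists 1 => x; rewrite ler_norml cos_geN1 cos_le1.
- by exists (B + C) => x; rewrite (le_trans (ler_normD _ _))// lerD.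
- by exists (`|a| * B) => x; rewrite normrM ler_wpM2l.
Qed.

End trig_measurable.

Section second_moments.
Context {R : realType} d (T : measurableType d) (P : probability T R).

Lemma bounded_fun_integrable (h : T -> R) (B : R) : measurable_fun setT h ->
  (forall w, `|h w| <= B) -> P.-integrable setT (EFin \o h).
Proof.
move=> mh hB; apply: measurable_bounded_integrable => //.
  by rewrite ltey_eq fin_num_measure.
by exists B; split; [exact: num_real|move=> M BM w _ /=; exact: le_trans (hB w) (ltW BM)].
Qed.

Variables (k : nat) (X : 'I_k -> T -> R) (S : 'I_k -> 'I_k -> R).
Hypothesis mX : forall i, measurable_fun setT (X i).
Hypothesis XS : forall i j, 'E_P[X i * X j]%E = (S i j)%:E.

(** The squares are integrable because their expectations are real numbers, and |x y| <= x^2 +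
    y^2. *)
Lemma second_moment_integrable i j : P.-integrable setT (EFin \o (X i * X j)).
Proof.
have sq l : P.-integrable setT (EFin \o (X l * X l)).
  apply/integrableP; split; first by apply/measurable_EFinP; exact: measurable_funM.
  under eq_integral => w _ do rewrite /= ger0_norm -?expr2 ?sqr_ge0//.
  by have := XS l l; rewrite unlock /= => ->; rewrite ltry.
apply: (le_integrable measurableT _ _ (integrableD measurableT (sq i) (sq j))).
  by apply/measurable_EFinP; exact: measurable_funM.
move=> w _; rewrite /= !fctE lee_fin -!expr2 [leRHS]ger0_norm ?addr_ge0 ?sqr_ge0//.
rewrite normrM -(real_normK (num_real (X i w))) -(real_normK (num_real (X j w))).
have := sqr_ge0 (`|X i w| - `|X j w|).
have := normr_ge0 (X i w); have := normr_ge0 (X j w); nra.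
Qed.

Lemma second_moment_sum (c : 'I_k -> R) :
  let Y w := \sum_i c i * X i w in 'E_P[Y * Y]%E =
  (\sum_i \sum_j c i * c j * S i j)%:E.
Proof.
rewrite /= unlock.
transitivity (\int[P]_w (\sum_i \sum_j (c i * c j)%:E * (X i w * X j w)%:E))%E.
  apply: eq_integral => w _.
  rewrite fctE /= mulr_suml -sumEFin; apply: eq_bigr => i _.
  rewrite mulr_sumr -sumEFin; apply: eq_bigr => j _.
  by rewrite -EFinM; congr EFin; ring.
have intg i j : P.-integrable setT (fun w => (c i * c j)%:E * (X i w * X j w)%:E)%E.
  by apply: integrableZl => //; exact: second_moment_integrable.
rewrite integral_sum//; last first.
  by move=> i; apply: integrable_sum => // j _; exact: intg.
rewrite -sumEFin; apply: eq_bigr => i _.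
rewrite integral_sum// -sumEFin; apply: eq_bigr => j _.
rewrite integralZl//; last exact: second_moment_integrable.
by rewrite [RHS]EFinM; congr (_ * _)%E; have := XS i j; rewrite unlock.
Qed.

End second_moments.

Section gaussian_convergence.
Context {R : realType}.
Local Notation gamma := (@normal_prob R 0 1).

Lemma cvg_sumr I (F : set_system I) {FF : Filter F} (J : Type) (r : seq J)
    (u : J -> I -> R) (l : J -> R) : (forall j, u j e @[e --> F] --> l j) ->
  \sum_(j <- r) u j e @[e --> F] --> \sum_(j <- r) l j.
Proof.
move=> ul; elim: r => [|j r ih].
  by rewrite big_nil; under eq_fun do rewrite big_nil; exact: cvg_cst.
rewrite big_cons; under eq_fun do rewrite big_cons.
by apply: (@cvgD _ R^o); [exact: ul|exact: ih].
Qed.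

(** The variance v sits inside the integrand and the measure is fixed, so continuity in v is
    continuity under the integral sign, including at v = 0. *)
Definition gauss_mean (g : R -> R) (v : R) : R :=
  \int[gamma]_z g (Num.sqrt (v / fine (@gauss_m2 R)) * z).

Lemma gauss_mean_continuous (g : R -> R) (B : R) : continuous g ->
  (forall x, `|g x| <= B) -> continuous (gauss_mean g).
Proof.
move=> cg gB v.
have mg (s : R) : measurable_fun setT (fun z => g (s * z)).
  apply: (measurableT_comp (continuous_measurable_fun cg)).
  exact: measurable_mulrl.
have cgz (z : R) : continuous (fun v : R => g (Num.sqrt (v / fine (@gauss_m2 R)) * z)).
  move=> x; apply: (@cvg_comp _ _ _ (fun v : R => Num.sqrt (v / fine (@gauss_m2 R)) * z) g); last exact: cg.
  apply: cvgM; last exact: cvg_cst.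
  apply: (@cvg_comp _ _ _ (fun v : R => v / fine (@gauss_m2 R)) Num.sqrt).
    by apply: cvgM; [exact: cvg_id|exact: cvg_cst].
  exact: sqrt_continuous.
apply: (@continuity_under_integral R _ _ gamma
  (fun v z => g (Num.sqrt (v / fine (@gauss_m2 R)) * z)) setT measurableT
  (v - 1) (v + 1) _ _ (cst B) _ _ v).
- by move=> x _; apply: (@bounded_fun_integrable R _ _ gamma _ B) => [|w]; [exact: mg|exact: gB].
- by apply: (@aeW _ _ _ gamma) => z _ x _; exact: cgz.
- apply: (@bounded_fun_integrable R _ _ gamma _ `|B|) => //.
- by move=> x _; apply: (@aeW _ _ _ gamma) => z _; exact: gB.
- by rewrite inE /= in_itv/= ltrBlDr ltrDl ltr01.
Qed.

Lemma centered_gaussian_Rmean d (T : measurableType d) (P : probability T R)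
    (X : T -> R) (v : R) (g : R -> R) : measurable_fun setT X ->
  centered_gaussian P X -> 'E_P[X * X]%E = v%:E -> measurable_fun setT g ->
  \int[P]_w g (X w) = gauss_mean g v.
Proof.
move=> mX gX Xv mg; congr fine.
apply: (centered_gaussian_var mX gX Xv (f := EFin \o g)).
exact/measurable_EFinP.
Qed.

(** Gaussianity is required of linear combinations rather than through a density, so S may be
    singular. Second moments stand for covariances because the means vanish. *)
Definition gaussian_vector d (T : measurableType d) (P : probability T R) k
    (X : 'I_k -> T -> R) (S : 'I_k -> 'I_k -> R) :=
  [/\ forall i, measurable_fun setT (X i),
      forall c : 'I_k -> R, centered_gaussian P (fun w => \sum_i c i * X i w) &
      forall i j, 'E_P[X i * X j]%E = (S i j)%:E].

Lemma gaussian_vector_trig d (T : measurableType d) (P : probability T R) k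
    (X : 'I_k -> T -> R) S (c : 'rV[R]_k) (b : R) : gaussian_vector P X S ->
  \int[P]_w cos (dot c (\row_i X i w) + b) =
  gauss_mean (fun t => cos (t + b)) (\sum_i \sum_j c 0 i * c 0 j * S i j).
Proof.
move=> [mX gX XS].
rewrite -(@centered_gaussian_Rmean _ _ P (fun w => \sum_i c 0 i * X i w)).
- apply: eq_Rintegral => w _; congr (cos (_ + _)).
  by apply: eq_bigr => i _; rewrite mxE.
- by apply: measurable_sum => i; exact: measurable_funM.
- exact: gX.
- exact: (second_moment_sum mX XS).
- apply: (@measurableT_comp _ _ _ _ _ _ (@cos R)).
    by apply: continuous_measurable_fun; exact: continuous_cos.
  exact: measurable_funD.
Qed.

Lemma measurable_row d (T : measurableType d) k (X : 'I_k -> T -> R) :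
  (forall i, measurable_fun setT (X i)) ->
  measurable_fun setT (fun w => \row_i X i w).
Proof.
by move=> mX; apply: measurable_fun_mx => i j; under eq_fun do rewrite mxE; exact: mX.
Qed.

Lemma gaussian_vector_trig_cvg I (F : set_system I) {FF : ProperFilter F} k
    d (T : measurableType d) (P : probability T R)
    (X : I -> 'I_k -> T -> R) (S : I -> 'I_k -> 'I_k -> R)
    d' (T' : measurableType d') (P' : probability T' R)
    (Y : 'I_k -> T' -> R) (S' : 'I_k -> 'I_k -> R) (p : 'rV[R]_k -> R) :
  (\forall e \near F, gaussian_vector P (X e) (S e)) -> gaussian_vector P' Y S' ->
  (forall i j, S e i j @[e --> F] --> S' i j) -> trig_poly p ->
  \int[P]_w p (\row_i X e i w) @[e --> F] --> \int[P']_w p (\row_i Y i w).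
Proof.
move=> gX gY SS'; elim=> {p} [c b|p q tp hp tq hq|a p tp hp].
- rewrite (gaussian_vector_trig _ _ gY).
  have cc : continuous (fun t : R => cos (t + b)).
    move=> t; apply: (@cvg_comp _ _ _ (fun t : R => t + b) cos).
      by apply: (@cvgD _ R^o); [exact: cvg_id|exact: cvg_cst].
    exact: continuous_cos.
  have cB t : `|cos (t + b)| <= 1 by rewrite ler_norml cos_geN1 cos_le1.
  apply: (@cvg_trans _ (gauss_mean (fun t => cos (t + b))
      (\sum_i \sum_j c 0 i * c 0 j * S e i j) @[e --> F])).
    apply: near_eq_cvg; near=> e; apply/esym/gaussian_vector_trig.
    by near: e.
  apply: continuous_cvg; first exact: (gauss_mean_continuous cc cB).
  apply: cvg_sumr => i; apply: cvg_sumr => j.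
  by apply: cvgM; [exact: cvg_cst|exact: SS'].
- have ip d0 (T0 : measurableType d0) (P0 : probability T0 R) Z S0 r : trig_poly r ->
      gaussian_vector P0 Z S0 ->
      P0.-integrable setT (EFin \o (fun w => r (\row_(i < k) Z i w))).
    move=> tr [mZ _ _]; have [B rB] := trig_poly_bounded tr.
    apply: (@bounded_fun_integrable _ _ _ _ _ B) => //.
    exact: measurableT_comp (measurable_trig_poly tr) (measurable_row mZ).
  rewrite RintegralD//; [|exact: ip gY|exact: ip gY].
  apply: cvg_trans (cvgD hp hq).
  apply: near_eq_cvg; near=> e.
  have gXe : gaussian_vector P (X e) (S e) by near: e.
  by rewrite /= RintegralD//; exact: ip gXe.
- have ip d0 (T0 : measurableType d0) (P0 : probability T0 R) Z S0 r : trig_poly r ->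
      gaussian_vector P0 Z S0 ->
      P0.-integrable setT (EFin \o (fun w => r (\row_(i < k) Z i w))).
    move=> tr [mZ _ _]; have [B rB] := trig_poly_bounded tr.
    apply: (@bounded_fun_integrable _ _ _ _ _ B) => //.
    exact: measurableT_comp (measurable_trig_poly tr) (measurable_row mZ).
  rewrite RintegralZl//; last exact: ip gY.
  apply: cvg_trans (cvgM (cvg_cst a) hp).
  apply: near_eq_cvg; near=> e.
  have gXe : gaussian_vector P (X e) (S e) by near: e.
  by rewrite /= RintegralZl//; exact: ip gXe.
Unshelve. all: by end_near. Qed.

End gaussian_convergence.

Section gaussian_vector_cvg.
Context {R : realType}.

(** The expectation of the quadratic error bound is read off the diagonal of S, hence is uniform
    over laws with bounded variances. *)
Lemma gaussian_vector_approx d (T : measurableType d) (P : probability T R) k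
    (X : 'I_k -> T -> R) S (f p : 'rV[R]_k -> R) (B eta : R) :
  gaussian_vector P X S -> measurable_fun setT f -> (forall x, `|f x| <= B) ->
  trig_poly p -> (forall x, `|f x - p x| <= eta * (1 + \sum_i x 0 i ^+ 2)) ->
  `|\int[P]_w f (\row_i X i w) - \int[P]_w p (\row_i X i w)| <=
  eta * (1 + \sum_i S i i).
Proof.
move=> [mX _ XS] mf fB tp fp.
have mr := measurable_row mX; have [C pC] := trig_poly_bounded tp.
have mp := measurable_trig_poly tp.
have if_ : P.-integrable setT (EFin \o (fun w => f (\row_i X i w))).
  by apply: (@bounded_fun_integrable _ _ _ _ _ B) => //; exact: measurableT_comp mf mr.
have ip : P.-integrable setT (EFin \o (fun w => p (\row_i X i w))).
  by apply: (@bounded_fun_integrable _ _ _ _ _ C) => //; exact: measurableT_comp mp mr.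
rewrite -RintegralB//.
have iX i : P.-integrable setT (EFin \o (X i * X i)) by exact: (second_moment_integrable mX XS).
have iS : P.-integrable setT (fun w => \sum_i (X i w * X i w)%:E)%E.
  by apply: integrable_sum => // i _; exact: iX.
have i1 : P.-integrable setT (cst 1%E).
  by apply: (@bounded_fun_integrable _ _ _ _ (cst 1) 1) => // w; rewrite /= normr1.
have i1S : P.-integrable setT (fun w => 1 + \sum_i (X i w * X i w)%:E)%E.
  exact: integrableD.
have E w : ((eta * (1 + \sum_i (X i w * X i w)))%:E = eta%:E * (1 + \sum_i (X i w * X i w)%:E))%E.
  by rewrite EFinM EFinD -sumEFin.
have ie : P.-integrable setT (EFin \o (fun w => eta * (1 + \sum_i (X i w * X i w)))).
  by rewrite /comp; under eq_fun do rewrite E; exact: integrableZl.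
apply: (le_trans (le_normr_Rintegral _ _)) => //.
  by rewrite /comp; under eq_fun do rewrite EFinB; exact: integrableB.
apply: (@le_trans _ _ (\int[P]_w (eta * (1 + \sum_i (X i w * X i w))))).
  apply: le_Rintegral => //.
    apply: integrable_norm.
    by rewrite /comp; under eq_fun do rewrite EFinB; exact: integrableB.
  move=> w _; apply: (le_trans (fp _)).
  rewrite le_eqVlt; apply/orP; left; apply/eqP; congr (_ * (_ + _)).
  by apply: eq_bigr => i _; rewrite mxE expr2.
rewrite /Rintegral; under eq_integral do rewrite E.
rewrite integralZl// integralD// integral_sum// integral_cst// mul1e.
rewrite [X in (_ * (X + _))%E]probability_setT.
rewrite (eq_bigr (fun i => (S i i)%:E)); last first.
  by move=> i _; have := XS i i; rewrite unlock.
by rewrite sumEFin -EFinD -EFinM.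
Qed.

Theorem gaussian_vector_cvg I (F : set_system I) {FF : ProperFilter F} k
    d (T : measurableType d) (P : probability T R)
    (X : I -> 'I_k -> T -> R) (S : I -> 'I_k -> 'I_k -> R)
    d' (T' : measurableType d') (P' : probability T' R)
    (Y : 'I_k -> T' -> R) (S' : 'I_k -> 'I_k -> R) :
  (\forall e \near F, gaussian_vector P (X e) (S e)) -> gaussian_vector P' Y S' ->
  (forall i j, S e i j @[e --> F] --> S' i j) ->
  cvg_in_distribution F P (fun e w => \row_i X e i w) P' (fun w => \row_i Y i w).
Proof.
move=> gX gY SS' f cf [B fB].
have mf : measurable_fun setT f.
  apply: (measurability _ (RGenOpens.measurableE R)) => _ [_ [a [b ->] <-]].
  rewrite setTI; apply: measurable_mx_open.
  by move/continuousP : cf; apply; exact: interval_open.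
have E d0 (T0 : measurableType d0) (P0 : probability T0 R) Z S0 :
    gaussian_vector P0 Z S0 ->
    'E_P0 [f \o (fun w => \row_i Z i w)]%E = (\int[P0]_w f (\row_i Z i w))%:E.
  move=> [mZ _ _]; rewrite unlock /Rintegral fineK//.
  apply: integrable_fin_num => //.
  apply: (@bounded_fun_integrable _ _ _ _ _ B) => //.
  exact: measurableT_comp mf (measurable_row mZ).
rewrite (E _ _ _ _ _ gY).
apply: (@cvg_trans _ ((\int[P]_w f (\row_i X e i w))%:E @[e --> F])).
  by apply: near_eq_cvg; near=> e; apply/esym; apply: (E _ _ _ _ (S e)); near: e.
apply: cvg_EFin; first exact: nearW.
apply/cvgrPdist_le => eps eps0.
pose Q := \sum_i S' i i.
(* The trace of [S e] is eventually at most |Q| + 1, so 1 plus the trace is at most 2 + |Q|. Each of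
   the three errors is then at most eps / 3. *)
have Q0 : 0 < 3 * (2 + `|Q|) by rewrite mulr_gt0// ltr_pwDl.
have [p tp fp] := trig_approx cf fB (divr_gt0 eps0 Q0).
have QQ : \sum_i S e i i @[e --> F] --> Q by apply: cvg_sumr => i; exact: SS'.
have pp := gaussian_vector_trig_cvg (FF := FF) gX gY SS' tp.
have eps3 : 0 < eps / 3 by rewrite divr_gt0.
near=> e.
have gXe : gaussian_vector P (X e) (S e) by near: e.
have h1 := gaussian_vector_approx gXe mf fB tp fp.
have h2 := gaussian_vector_approx gY mf fB tp fp.
have h3 : `|\int[P']_w p (\row_i Y i w) - \int[P]_w p (\row_i X e i w)| <= eps / 3.
  by near: e; move/cvgrPdist_le : pp; exact.
have h4 : `|Q - \sum_i S e i i| <= 1.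
  by near: e; move/cvgrPdist_le : QQ; apply.
set c := eps / _ in h1 h2.
have c0 : 0 < c by rewrite divr_gt0.
have cE : c * (2 + `|Q|) = eps / 3.
  by rewrite /c; field; rewrite gt_eqF// ltr_pwDl.
have {}h1 := le_trans h1 (_ : _ <= eps / 3).
have {}h2 := le_trans h2 (_ : _ <= eps / 3).
have {}h1 : `|\int[P]_w f (\row_i X e i w) - \int[P]_w p (\row_i X e i w)| <= eps / 3.
  apply: h1; rewrite -cE ler_pM2l//.
  move: h4; rewrite ler_norml => /andP[h4 _].
  have := ler_norm Q; lra.
have {}h2 : `|\int[P']_w f (\row_i Y i w) - \int[P']_w p (\row_i Y i w)| <= eps / 3.
  apply: h2; rewrite -cE ler_pM2l// -/Q.
  have := ler_norm Q; lra.
move: h1 h2 h3; rewrite !ler_norml => /andP[? ?] /andP[? ?] /andP[? ?].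
by apply/andP; split => /=; lra.
Unshelve. all: by end_near. Qed.

End gaussian_vector_cvg.

(** * Geodesic distance *)

Section euclidean_norm.
Context {R : realType}.
Implicit Types n : nat.

Lemma dot_sqr_le n (u v : 'rV[R]_n) : dot u v ^+ 2 <= dot u u * dot v v.
Proof.
have [v0|v0] := eqVneq (dot v v) 0.
  have vi i : v 0 i = 0.
    have := eqxx (dot v v); rewrite [X in _ == X]v0 psumr_eq0; last first.
      by move=> j _; rewrite -expr2 sqr_ge0.
    by move=> /allP/(_ i (mem_index_enum _))/=; rewrite -expr2 sqrf_eq0 => /eqP.
  by rewrite v0 mulr0 /dot big1 ?expr0n// => i _; rewrite vi mulr0.
have vpos : 0 < dot v v by rewrite lt_neqAle eq_sym v0 dot_ge0.
(* Cauchy-Schwarz from the squared length of v.v times the part of u orthogonal to v. *)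
have := dot_ge0 (dot v v *: u - dot u v *: v).
rewrite -scaleNr !(dotDl, dotDr, dotZl, dotZr) (dotC v u).
rewrite [X in 0 <= X](_ : _ = dot v v * (dot u u * dot v v - dot u v ^+ 2)); last by ring.
by rewrite pmulr_rge0// subr_ge0.
Qed.

Lemma dot_le n (u v : 'rV[R]_n) : `|dot u v| <= enorm u * enorm v.
Proof.
rewrite -(@ler_pXn2r _ 2)// ?nnegrE ?mulr_ge0 ?enorm_ge0//.
by rewrite exprMn !enormE real_normK ?num_real// dot_sqr_le.
Qed.

Lemma enormZ n (a : R) (u : 'rV[R]_n) : enorm (a *: u) = `|a| * enorm u.
Proof. by rewrite /enorm dotZl dotZr mulrA -expr2 sqrtrM ?sqr_ge0// sqrtr_sqr. Qed.

Lemma enormN n (u : 'rV[R]_n) : enorm (- u) = enorm u.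
Proof. by rewrite -scaleN1r enormZ normrN1 mul1r. Qed.

Lemma enorm0 n : enorm (0 : 'rV[R]_n) = 0.
Proof. by rewrite -(scale0r 0) enormZ normr0 mul0r. Qed.

Lemma enorm_eq0 n (u : 'rV[R]_n) : (enorm u == 0) = (u == 0).
Proof.
apply/eqP/eqP => [u0|->]; last exact: enorm0.
have : dot u u == 0 by rewrite -enormE u0 expr0n.
rewrite psumr_eq0 => [/allP h|i _]; last by rewrite -expr2 sqr_ge0.
apply/rowP => i; rewrite mxE; have := h i (mem_index_enum _).
by rewrite /= -expr2 sqrf_eq0 => /eqP.
Qed.

Lemma enorm_gt0 n (u : 'rV[R]_n) : (0 < enorm u) = (u != 0).
Proof. by rewrite lt_neqAle enorm_ge0 andbT eq_sym enorm_eq0. Qed.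

Lemma ler_enormD n (u v : 'rV[R]_n) : enorm (u + v) <= enorm u + enorm v.
Proof.
rewrite -(@ler_pXn2r _ 2)// ?nnegrE ?addr_ge0 ?enorm_ge0//.
rewrite enormE dotDl !dotDr (dotC v u) sqrrD !enormE.
have := le_trans (ler_norm _) (dot_le u v) => h.
by rewrite -!addrA lerD2l !addrA lerD2r -mulr2n ler_wMn2r.
Qed.

Lemma coord_le_enorm n (u : 'rV[R]_n) i : `|u 0 i| <= enorm u.
Proof.
rewrite -(@ler_pXn2r _ 2)// ?nnegrE ?enorm_ge0// enormE real_normK ?num_real//.
rewrite /dot (bigD1 i)//= -expr2 lerDl sumr_ge0// => j _.
by rewrite -expr2 sqr_ge0.
Qed.

Lemma dot_rV_cons n (t s : R) (u v : 'rV[R]_n) :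
  dot (rV_cons (t, u)) (rV_cons (s, v)) = t * s + dot u v.
Proof.
rewrite /dot big_ord_recl !mxE unlift_none/=; congr (_ + _).
by apply: eq_bigr => i _; rewrite !mxE liftK.
Qed.

Lemma cvg_enorm I (F : set_system I) {FF : Filter F} n (f : I -> 'rV[R]_n) (w : 'rV[R]_n) :
  (forall j, f i 0 j @[i --> F] --> w 0 j) -> enorm (f i) @[i --> F] --> enorm w.
Proof.
move=> fw; rewrite /enorm; apply: continuous_cvg; first exact: sqrt_continuous.
apply: cvg_big => [|j _]; first exact: add_continuous.
by apply: cvgM; exact: fw.
Qed.

End euclidean_norm.

Section geodesic_distance.
Context {R : realType} {n : nat}.
Implicit Types x y z : @sphere R n.

Lemma sphere_dot x : dot (val x) (val x) = 1.
Proof. exact/eqP/(valP x). Qed.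

Lemma sphere_enorm x : enorm (val x) = 1.
Proof. by rewrite /enorm sphere_dot sqrtr1. Qed.

Lemma sphere_dot_itv x y : -1 <= dot (val x) (val y) <= 1.
Proof. by rewrite -ler_norml (le_trans (dot_le _ _))// !sphere_enorm mulr1. Qed.

Lemma cos_gdist x y : cos (gdist x y) = dot (val x) (val y).
Proof. by rewrite acosK// in_itv/= sphere_dot_itv. Qed.

Lemma gdist_ge0 x y : 0 <= gdist x y.
Proof. by rewrite acos_ge0// sphere_dot_itv. Qed.

Lemma gdist_le_pi x y : gdist x y <= pi.
Proof. by rewrite acos_lepi// sphere_dot_itv. Qed.

Lemma gdistC x y : gdist x y = gdist y x.
Proof. by rewrite /gdist dotC. Qed.

Lemma gdistxx x : gdist x x = 0.
Proof. by rewrite /gdist sphere_dot acos1. Qed.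

Lemma sin_gdist_ge0 x y : 0 <= sin (gdist x y).
Proof. by apply: sin_ge0_pi; rewrite gdist_ge0 gdist_le_pi. Qed.

Lemma le_sin_id (t : R) : 0 <= t -> sin t <= t.
Proof.
rewrite le_eqVlt => /orP[/eqP <-|t0]; first by rewrite sin0.
have [|c _] := @MVT R sin cos 0 t t0 (fun s _ => is_derive_sin s).
  by apply: continuous_subspaceT; exact: continuous_sin.
rewrite sin0 !subr0 => ->; rewrite -[leRHS]mul1r ler_wpM2r ?cos_le1//.
exact: ltW.
Qed.

(** The components of x and z orthogonal to y have lengths sin a and sin b. Cauchy-Schwarz for them
    gives cos d(x, z) >= cos a cos b - sin a sin b = cos (a + b). *)
Lemma gdist_triangle x y z : gdist x z <= gdist x y + gdist y z.
Proof.
set a := gdist x y; set b := gdist y z.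
have [ab|ab] := leP pi (a + b); first exact: le_trans (gdist_le_pi _ _) ab.
have ab0 : 0 <= a + b by rewrite addr_ge0 ?gdist_ge0.
rewrite leNgt; apply/negP => h.
have : cos (gdist x z) < cos (a + b).
  by rewrite ltr_cos ?in_itv/= ?gdist_ge0 ?gdist_le_pi ?ab0 ?ltW.
rewrite cosD !cos_gdist ltNge => /negP; apply.
pose u := val x - dot (val x) (val y) *: val y.
pose v := val z - dot (val y) (val z) *: val y.
have uu : dot u u = sin a ^+ 2.
  rewrite sin2cos2 cos_gdist /u -scaleNr !(dotDl, dotDr, dotZl, dotZr) !sphere_dot.
  by rewrite (dotC (val y) (val x)); ring.
have vv : dot v v = sin b ^+ 2.
  rewrite sin2cos2 cos_gdist /v -scaleNr !(dotDl, dotDr, dotZl, dotZr) !sphere_dot.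
  by rewrite (dotC (val z) (val y)); ring.
have uv : dot u v = dot (val x) (val z) - dot (val x) (val y) * dot (val y) (val z).
  rewrite /u /v -!(scaleNr _ (val y)) !(dotDl, dotDr, dotZl, dotZr) !sphere_dot.
  by ring.
have := dot_le u v.
rewrite /enorm uu vv !sqrtr_sqr (ger0_norm (sin_gdist_ge0 x y)) (ger0_norm (sin_gdist_ge0 y z))
  ler_norml uv => /andP[h1 _].
lra.
Qed.

Lemma enorm_chord x y : enorm (val x - val y) = 2 * sin (gdist x y / 2).
Proof.
have s0 : 0 <= sin (gdist x y / 2).
  apply: sin_ge0_pi; have := gdist_ge0 x y; have := gdist_le_pi x y => ? ?.
  by apply/andP; split; lra.
apply/eqP; rewrite -(@eqrXn2 _ 2)// ?enorm_ge0 ?mulr_ge0//; apply/eqP.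
rewrite enormE -scaleN1r !(dotDl, dotDr, dotZl, dotZr) !sphere_dot (dotC (val y) (val x)).
rewrite -cos_gdist exprMn sin2cos2.
have -> : gdist x y = gdist x y / 2 + gdist x y / 2 by field.
rewrite [in LHS]cosD -!expr2 sin2cos2.
have -> : (gdist x y / 2 + gdist x y / 2) / 2 = gdist x y / 2 by field.
ring.
Qed.

Lemma chord_le_gdist x y : enorm (val x - val y) <= gdist x y.
Proof.
rewrite enorm_chord mulrC -ler_pdivlMr// le_sin_id//.
by rewrite divr_ge0 ?gdist_ge0.
Qed.

(** Small distances are where [acos] is not differentiable; the arcsine of the half chord is smooth
    there and serves for the limits. *)
Lemma gdist_asin x y : gdist x y = 2 * asin (enorm (val x - val y) / 2).
Proof.
rewrite enorm_chord mulrAC divff ?pnatr_eq0// mul1r sinK; first by field.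
have := gdist_ge0 x y; have := gdist_le_pi x y => ? ?; rewrite in_itv/=.
by apply/andP; split; have := pi_gt0 R; lra.
Qed.

Lemma measurable_gdist : measurable_fun setT (fun p : @sphere R n * @sphere R n => gdist p.1 p.2).
Proof.
(* Clipping to [-1, 1] makes [acos] nonincreasing on the whole line, hence measurable, and changes
   nothing on scalar products of unit vectors. *)
pose clip (t : R) := Num.max (-1) (Num.min 1 t).
have clipI t : -1 <= clip t <= 1.
  have h : -1 <= 1 :> R by lra.
  by rewrite /clip le_max lexx/= ge_max h ge_min lexx.
have macos : measurable_fun setT (fun t : R => acos (clip t)).
  apply: nonincreasing_measurable => // a b ab.
  rewrite leNgt; apply/negP => h.
  have : cos (acos (clip b)) < cos (acos (clip a)).
    by rewrite ltr_cos ?in_itv/= ?acos_ge0 ?acos_lepi.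
  rewrite !acosK ?in_itv ?clipI// ltNge => /negP; apply.
  by rewrite /clip; apply: le_max2 => //; apply: le_min2.
rewrite [X in measurable_fun _ X](_ : _ = (fun t : R => acos (clip t)) \o
    (fun p : @sphere R n * @sphere R n => dot (val p.1) (val p.2))); last first.
  apply/funext => p /=; congr acos; rewrite /clip.
  have /andP[? ?] := sphere_dot_itv p.1 p.2.
  by rewrite min_r// max_r.
apply: measurableT_comp macos _.
apply: measurable_sum => i; apply: measurable_funM.
  exact: (measurableT_comp (@measurable_mx_coord R 1 n.+1 0 i) (measurableT_comp (@measurable_sphere_val R n) measurable_fst)).
exact: (measurableT_comp (@measurable_mx_coord R 1 n.+1 0 i) (measurableT_comp (@measurable_sphere_val R n) measurable_snd)).
Qed.

End geodesic_distance.

Section geodesic_distance_cvg.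
Context {R : realType}.

(* Continuous at 0, where asin h / h is a junk value. *)
Definition asin_ratio (h : R) : R := if h == 0 then 1 else asin h / h.

Lemma asin_eq0 : asin (0 : R) = 0.
Proof.
rewrite -[in LHS](@sin0 R) sinK// in_itv/=; have := pi_gt0 R => ?.
by apply/andP; split; lra.
Qed.

Lemma asin_ratioE (h : R) : asin h = h * asin_ratio h.
Proof.
rewrite /asin_ratio; have [->|h0] := eqVneq h 0; first by rewrite asin_eq0 mul0r.
by rewrite mulrC divfK.
Qed.

Lemma cvg_asin_ratio : asin_ratio h @[h --> 0] --> (1 : R).
Proof.
have -> : (1 : R) = asin_ratio 0 by rewrite /asin_ratio eqxx.
apply/continuous_withinNx; rewrite [asin_ratio 0]/asin_ratio eqxx.
have [dasin vasin] : is_derive (0 : R) 1 (@asin R) 1.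
  have := @is_derive1_asin R 0; rewrite expr0n subr0 sqrtr1 invr1; apply.
  by rewrite ltrN10 ltr01.
rewrite -vasin; apply: cvg_trans dasin; apply: near_eq_cvg; near=> h.
have h0 : h != 0 by near: h; exact: nbhs_dnbhs_neq.
by rewrite /asin_ratio (negbTE h0) asin_eq0 subr0 /= addr0 [_%:A]mulr1 [LHS]mulrC.
Unshelve. all: by end_near. Qed.

(** The chord divided by e_i tends to |w|, and the ratio of arc to chord tends to 1 as both points
    merge. *)
Lemma gdist_cvg I (F : set_system I) {FF : Filter F} n (x y : I -> @sphere R n)
    (e : I -> R) (w : 'rV[R]_n.+1) : (\forall i \near F, 0 < e i) ->
  e i @[i --> F] --> 0 ->
  (forall j, (val (x i) 0 j - val (y i) 0 j) / e i @[i --> F] --> w 0 j) ->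
  gdist (x i) (y i) / e i @[i --> F] --> enorm w.
Proof.
move=> e0 ecvg xyw.
pose c i := enorm ((e i)^-1 *: (val (x i) - val (y i))).
have cw : c i @[i --> F] --> enorm w.
  apply: cvg_enorm => j; apply: cvg_trans (xyw j); apply: near_eq_cvg.
  by near=> i; rewrite !mxE mulrC.
have h0 : c i * e i / 2 @[i --> F] --> 0.
  rewrite -(mul0r (2^-1)) -(mulr0 (enorm w)).
  by apply: cvgM; [exact: cvgM|exact: cvg_cst].
have r1 : asin_ratio (c i * e i / 2) @[i --> F] --> (1 : R).
  exact: cvg_comp h0 cvg_asin_ratio.
rewrite -[enorm w]mulr1; apply: cvg_trans (cvgM cw r1); apply: near_eq_cvg.
near=> i; have ei : 0 < e i by near: i.
rewrite gdist_asin asin_ratioE /= /c.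
rewrite enormZ (gtr0_norm (_ : 0 < (e i)^-1)) ?invr_gt0//.
rewrite -[sval (x i)]/(val (x i)) -[sval (y i)]/(val (y i)).
rewrite [_^-1 * _]mulrC divfK ?gt_eqF//.
by field; rewrite gt_eqF.
Unshelve. all: by end_near. Qed.

End geodesic_distance_cvg.

(** * Integrals over R^n *)

Section lebesgue_rV_integral.
Context {R : realType}.
Local Notation leb := (@lebesgue_measure R).

Lemma ge0_integral_rVS n (f : 'rV[R]_n.+1 -> \bar R) : measurable_fun setT f ->
  (forall x, 0 <= f x)%E ->
  (\int[@lebesgue_rV R n.+1]_y f y =
   \int[leb]_t \int[@lebesgue_rV R n]_v f (rV_cons (t, v)))%E.
Proof.
move=> mf f0.
have mfc : measurable_fun setT (f \o @rV_cons R n).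
  exact: measurableT_comp mf (@measurable_rV_cons R n).
rewrite -(fubini_tonelli1 (m1 := leb) (m2 := lebesgue_rV n) _ mfc)//; last first.
  by move=> x; exact: f0.
by rewrite -[RHS](@ge0_integral_pushforward _ _ _ _ _ _ (@measurable_rV_cons R n)
  (leb \x lebesgue_rV n)%E setT f).
Qed.

Lemma measurable_ge0_integral_rV n (f : 'rV[R]_n.+1 -> \bar R) :
  measurable_fun setT f -> (forall x, 0 <= f x)%E ->
  measurable_fun setT (fun t : measurableTypeR R =>
    \int[@lebesgue_rV R n]_v f (rV_cons (t, v)))%E.
Proof.
move=> mf f0.
apply: (measurable_fun_fubini_tonelli_F (m2 := lebesgue_rV n) (f \o @rV_cons R n)).
  exact: measurableT_comp mf (@measurable_rV_cons R n).
by move=> x; exact: f0.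
Qed.

Lemma rV_consZ n (a t : R) (v : 'rV[R]_n) :
  a *: rV_cons (t, v) = rV_cons (a * t, a *: v).
Proof. by apply/rowP => j; rewrite !mxE; case: unlift => [k|//]; rewrite mxE. Qed.

Lemma ge0_integral_rV_scale n (u : R) (f : 'rV[R]_n -> \bar R) : 0 < u ->
  measurable_fun setT f -> (forall x, 0 <= f x)%E ->
  (\int[@lebesgue_rV R n]_y f y = (u ^+ n)%:E * \int[@lebesgue_rV R n]_y f (u *: y)%R)%E.
Proof.
move=> u0; elim: n f => [|n ih] f mf f0.
  rewrite mul1e; apply: eq_integral => y _.
  by rewrite [y]thinmx0 scaler0.
have msf : measurable_fun setT (fun y : 'rV[R]_n.+1 => f (u *: y)).
  exact: measurableT_comp mf (measurable_scale _).
rewrite !ge0_integral_rVS//.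
have sc := @ge0_integral_scale R u _ u0 (measurable_ge0_integral_rV mf f0)
  (fun t => integral_ge0 _ (fun v _ => f0 _)).
rewrite {}sc.
rewrite exprS EFinM -muleA; congr (_ * _)%E.
rewrite -ge0_integralZl//; last 3 first.
- exact: (measurable_ge0_integral_rV msf).
- by move=> t _; exact: integral_ge0.
- by rewrite lee_fin exprn_ge0 ?ltW.
apply: eq_integral => t _; rewrite ih//; last first.
  apply: (measurableT_comp mf); exact: (measurableT_comp (@measurable_rV_cons R n) (measurable_pair1 _)).
by congr (_ * _)%E; apply: eq_integral => v _; rewrite rV_consZ.
Qed.

(** Reduces integrability on R^n to one dimension for functions dominated by a product, with no
    recourse to polar coordinates. *)
Lemma ge0_integral_rV_prod n (g : R -> R) : measurable_fun setT g ->
  (forall x, 0 <= g x) -> (\int[leb]_x (g x)%:E < +oo)%E ->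
  (\int[@lebesgue_rV R n]_v (\prod_i g (v 0 i))%:E < +oo)%E.
Proof.
move=> mg g0 gy; elim: n => [|n ih].
  rewrite /lebesgue_rV/= integral_dirac// ?diracT.
    by rewrite mul1e ltry.
  apply/measurable_EFinP; rewrite (_ : (fun _ => _) = cst 1)//.
  by apply/funext => v; rewrite big_ord0.
have mp m : measurable_fun setT (fun v : 'rV[R]_m => (\prod_i g (v 0 i))%:E).
  apply/measurable_EFinP; apply: measurable_prod => i _.
  exact: (measurableT_comp mg (@measurable_mx_coord R 1 m 0 i)).
have p0 m (v : 'rV[R]_m) : (0 <= (\prod_i g (v 0 i))%:E)%E.
  by rewrite lee_fin prodr_ge0.
rewrite ge0_integral_rVS//.
rewrite (eq_integral (fun t : measurableTypeR R => (g t)%:E * \int[@lebesgue_rV R n]_v (\prod_i g (v 0 i))%:E)%E); last first.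
  move=> t _; rewrite -ge0_integralZl//; [|exact: mp|by rewrite lee_fin].
  apply: eq_integral => v _; rewrite -EFinM big_ord_recl mxE unlift_none/=.
  congr (_ * _)%:E; apply: eq_bigr => i _; by rewrite mxE liftK.
rewrite ge0_integralZr//.
- rewrite lte_mul_pinfty ?integral_ge0//.
    by move=> x _; rewrite lee_fin.
  by rewrite ge0_fin_numE ?integral_ge0// => x _; rewrite lee_fin.
- by apply/measurable_EFinP.
- by move=> x _; rewrite lee_fin.
- exact: integral_ge0.
Qed.

Lemma ge0_integral_mrestr d (T : measurableType d) (mu : {measure set T -> \bar R})
    (D : set T) (mD : measurable D) (f : T -> \bar R) : measurable_fun setT f ->
  (forall x, 0 <= f x)%E ->
  (\int[mrestr mu mD]_x f x = \int[mu]_(x in D) f x)%E.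
Proof.
move=> mf f0; rewrite (@ge0_negligible_integral _ _ _ _ setT (~` D))//; last 2 first.
- exact: measurableC.
- by rewrite /= /mrestr setICl measure0.
rewrite setTD setCK; apply: eq_measure_integral => A mA AD.
by rewrite /= /mrestr setIidl.
Qed.

Lemma ge0_integral_surface n (f : @sphere R n -> \bar R) : measurable_fun setT f ->
  (forall x, 0 <= f x)%E ->
  (\int[@surface_measure R n]_x f x =
   n.+1%:R%:E * \int[@lebesgue_rV R n.+1]_(y in @punctured_ball R n.+1) f (radial y))%E.
Proof.
move=> mf f0; rewrite /surface_measure ge0_integral_mscale//=; congr (_ * _)%E.
rewrite -(@ge0_integral_mrestr _ _ _ _ (@measurable_punctured_ball R n.+1) (f \o @radial R n))//.
- rewrite -[RHS](@ge0_integral_pushforward _ _ _ _ _ _ (@measurable_radial R n) _ setT f)//.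
- by apply: measurableT_comp mf (@measurable_radial R n).
- by move=> x; exact: f0.
Qed.

End lebesgue_rV_integral.

(** * Integrals of power functions *)

Section powR_integral.
Context {R : realType}.
Local Notation leb := (@lebesgue_measure R).

Lemma measurable_powR_fun (p : R) : measurable_fun setT (fun x : R => x `^ p).
Proof. exact: measurable_powR. Qed.

Lemma continuous_powR (p x : R) : 0 < x -> {for x, continuous (fun y : R => y `^ p)}.
Proof.
move=> x0; apply: differentiable_continuous; apply/derivable1_diffP.
by apply: derivable_powR; rewrite in_itv/= x0.
Qed.

Lemma is_derive_powR_div (p x : R) : p != 0 -> 0 < x ->
  is_derive x 1 (fun y : R => p^-1 * y `^ p) (x `^ (p - 1)).
Proof.
move=> p0 x0.
have : is_derive x 1 (p^-1 *: (fun y : R => y `^ p)) (p^-1 *: (p * x `^ (p - 1))).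
  by apply: is_deriveZ; exact: is_derive1_powR.
by rewrite /GRing.scale/= mulrA mulVf// mul1r.
Qed.

Lemma powR_cvgy0 (p : R) : p < 0 -> (fun x : R => x `^ p) x @[x --> +oo%R] --> 0.
Proof.
move=> p0; apply/cvgrPdist_le => e e0; near=> x.
have x1 : 0 < x by near: x; exact: nbhs_pinfty_gt.
rewrite sub0r normrN ger0_norm ?powR_ge0//.
have ex : e `^ p^-1 <= x by near: x; exact: nbhs_pinfty_ge.
have -> : e = (e `^ p^-1) `^ p by rewrite -powRrM mulVf ?lt_eqF// powRr1// ltW.
rewrite -[p]opprK !(powRN _ (- p)) lef_pV2 ?posrE ?powR_gt0//.
by rewrite ge0_ler_powR ?nnegrE ?powR_ge0 ?oppr_ge0 ?ltW.
Unshelve. all: by end_near. Qed.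

Lemma integral_powR_tail (p c : R) : p < -1 -> 0 < c ->
  (\int[leb]_(x in `[c, +oo[) (x `^ p)%:E = (- (p + 1)^-1 * c `^ (p + 1))%:E)%E.
Proof.
move=> p1 c0; have q0 : p + 1 != 0 by rewrite lt_eqF// -ltrBrDr sub0r.
have dF (x : R) : 0 < x -> is_derive x 1 (fun y : R => (p + 1)^-1 * y `^ (p + 1)) (x `^ p).
  by move=> x0; have := is_derive_powR_div q0 x0; rewrite addrK.
have cF (x : R) : 0 < x -> {for x, continuous (fun y : R => (p + 1)^-1 * y `^ (p + 1))}.
  by move=> x0; apply: cvgM; [exact: cvg_cst|exact: continuous_powR].
rewrite (@ge0_continuous_FTC2y _ _ (fun y => (p + 1)^-1 * y `^ (p + 1)) c 0).
- by rewrite -EFinB sub0r mulNr.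
- by move=> x _; exact: powR_ge0.
- apply: continuous_in_subspaceT => x; rewrite inE/= in_itv/= andbT => cx.
  by apply: continuous_powR; exact: lt_le_trans cx.
- rewrite -(mulr0 (p + 1)^-1); apply: cvgM; first exact: cvg_cst.
  by apply: powR_cvgy0; rewrite -ltrBrDr sub0r.
- by move=> x cx; have [] := dF x (lt_trans c0 cx).
- by apply: cvg_at_right_filter; exact: cF.
- move=> x; rewrite in_itv/= andbT => cx; rewrite derive1E.
  exact: (@derive_val _ _ _ _ _ _ _ (dF x (lt_trans c0 cx))).
Qed.

(** The integrand may blow up at 0, so ]0, 1] is exhausted by compact intervals, on which the
    primitive bounds the integral by 1 / (p + 1). *)
Lemma integral_powR_01 (p : R) : -1 < p ->
  (\int[leb]_(x in `]0%R, 1%R]) (x `^ p)%:E < +oo)%E.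
Proof.
move=> p1; have q0 : 0 < p + 1 by rewrite -ltrBlDr sub0r.
have dF (x : R) : 0 < x -> is_derive x 1 (fun y : R => (p + 1)^-1 * y `^ (p + 1)) (x `^ p).
  by move=> x0; have := is_derive_powR_div (lt0r_neq0 q0) x0; rewrite addrK.
have cF (x : R) : 0 < x -> {for x, continuous (fun y : R => (p + 1)^-1 * y `^ (p + 1))}.
  by move=> x0; apply: cvgM; [exact: cvg_cst|exact: continuous_powR].
(* Starting at 1 / 2 keeps every interval nondegenerate, as the fundamental theorem of calculus
   demands. *)
pose E (k : nat) : set (measurableTypeR R) := `[k.+2%:R^-1 : R, 1]%classic.
have UE : \bigcup_k E k = `]0, 1]%classic.
  apply/seteqP; split => [x [k _]|x]; rewrite /E/= !in_itv/= => /andP[x0 x1].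
    by rewrite x1 andbT; apply: lt_le_trans x0; rewrite invr_gt0.
  exists (Num.truncn x^-1) => //=; rewrite in_itv/= x1 andbT.
  rewrite -[leRHS]invrK lef_pV2 ?posrE ?invr_gt0//.
  apply: (le_trans (ltW (truncnS_gt _))); by rewrite ler_nat.
have ndE : nondecreasing_seq E.
  move=> k l kl; apply/subsetPset => x; rewrite /E/= !in_itv/= => /andP[kx ->].
  rewrite andbT; apply: le_trans kx.
  by rewrite lef_pV2 ?posrE// ler_nat !ltnS.
have Ele k : (\int[leb]_(x in E k) (x `^ p)%:E <= ((p + 1)^-1)%:E)%E.
  have k0 : 0 < k.+2%:R^-1 :> R by rewrite invr_gt0.
  rewrite (@continuous_FTC2 _ _ (fun y => (p + 1)^-1 * y `^ (p + 1))).
  - by rewrite -EFinB lee_fin powR1 mulr1 gerBl mulr_ge0 ?powR_ge0// invr_ge0 ltW.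
  - by rewrite invf_lt1// ltr1n.
  - apply: continuous_in_subspaceT => x; rewrite inE/= in_itv/= => /andP[kx _].
    by apply: continuous_powR; exact: lt_le_trans kx.
  - split.
    + move=> x; rewrite in_itv/= => /andP[kx _].
      by have [] := dF x (lt_trans k0 kx).
    + by apply: cvg_at_right_filter; exact: cF.
    + by apply: cvg_at_left_filter; exact: cF.
  - move=> x; rewrite in_itv/= => /andP[kx _]; rewrite derive1E.
    exact: (@derive_val _ _ _ _ _ _ _ (dF x (lt_trans k0 kx))).
have mE k : measurable (E k) by exact: measurable_itv.
have mf k : measurable_fun (E k) (fun x : measurableTypeR R => (x `^ p)%:E).
  by apply/measurable_funTS/measurable_EFinP; exact: measurable_powR_fun.
have f0 k (x : measurableTypeR R) : E k x -> (0 <= (x `^ p)%:E)%E by rewrite lee_fin powR_ge0.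
rewrite -UE.
have cvgE := @ge0_nondecreasing_set_cvg_integral _ _ _ E
  (fun x : measurableTypeR R => (x `^ p)%:E) leb ndE mE mf f0.
apply: (@le_lt_trans _ _ ((p + 1)^-1)%:E); last exact: ltry.
rewrite -(cvg_lim _ cvgE)//; apply: lime_le; last exact: nearW.
by apply/cvg_ex; eexists; exact: cvgE.
Qed.

End powR_integral.

Section coordinate_hyperplane.
Context {R : realType}.
Local Notation leb := (@lebesgue_measure R).

Lemma measurable_coord_eq0 n (i : 'I_n) : measurable [set v : 'rV[R]_n | v 0 i = 0].
Proof.
rewrite (_ : [set _ | _] = (fun v : 'rV[R]_n => v 0 i) @^-1` [set 0])//.
by rewrite -[X in measurable X]setTI; apply: measurable_mx_coord.
Qed.

Lemma lebesgue_rV_coord_eq0 n (i : 'I_n) :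
  @lebesgue_rV R n [set v : 'rV[R]_n | v 0 i = 0] = 0%E.
Proof.
elim: n i => [[//]|n ih i].
have H0 : @lebesgue_rV R n.+1 [set v | v 0 i = 0] =
  (leb \x @lebesgue_rV R n)%E (@rV_cons R n @^-1` [set v | v 0 i = 0]) by [].
rewrite H0; case: (unliftP ord0 i) => [j ->|->].
  transitivity ((leb \x @lebesgue_rV R n)%E
      ([set: measurableTypeR R] `*` [set v : 'rV[R]_n | v 0 j = 0])).
    congr (_ _); apply/seteqP; split => [[t v]|[t v]]; rewrite /= mxE liftK//.
    by move=> [].
  rewrite product_measure1E//; last exact: measurable_coord_eq0.
  by rewrite [X in (_ * X)%E]ih mule0.
transitivity ((leb \x @lebesgue_rV R n)%E
    ([set (0 : measurableTypeR R)] `*` [set: 'rV[R]_n])).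
  congr (_ _); apply/seteqP; split => [[t v]|[t v]]; rewrite /= mxE unlift_none//.
  by move=> [].
rewrite product_measure1E// [X in (X * _)%E](_ : _ = 0%E) ?mul0e//.
exact: lebesgue_measure_set1.
Qed.

(** Bounds by products of [dom1] may fail where a coordinate vanishes, as [dom1] is 0 at 0. These
    hyperplanes are null. *)
Lemma ae_coord_neq0 n : {ae @lebesgue_rV R n, forall v : 'rV[R]_n, forall i, v 0 i != 0}.
Proof.
apply: filter_forall => i; exists [set v : 'rV[R]_n | v 0 i = 0]; split.
- exact: measurable_coord_eq0.
- exact: lebesgue_rV_coord_eq0.
- by move=> v /negP; rewrite negbK => /eqP.
Qed.

End coordinate_hyperplane.

(** * Coordinates along and across the pole *)

Section chart.
Context {R : realType} {n : nat}.
Implicit Types (y : 'rV[R]_n.+1) (u : R).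

Definition tail y : 'rV[R]_n := \row_j y 0 (lift ord0 j).

Definition shrink u y : 'rV[R]_n.+1 := rV_cons (y 0 0, u *: tail y).

Lemma rV_cons_tail y : rV_cons (y 0 0, tail y) = y.
Proof. exact: rV_unconsK. Qed.

Lemma tail_rV_cons t (v : 'rV[R]_n) : tail (rV_cons (t, v)) = v.
Proof. by apply/rowP => j; rewrite !mxE liftK. Qed.

Lemma head_rV_cons t (v : 'rV[R]_n) : rV_cons (t, v) 0 0 = t.
Proof. by rewrite mxE unlift_none. Qed.

Lemma measurable_tail : measurable_fun setT tail.
Proof.
by apply: measurable_fun_mx => i j; under eq_fun do rewrite mxE; exact: measurable_mx_coord.
Qed.

Lemma measurable_shrink u : measurable_fun setT (shrink u).
Proof.
apply: (measurableT_comp (@measurable_rV_cons R n)).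
apply: measurable_fun_pair; first exact: measurable_mx_coord.
exact: (measurableT_comp (measurable_scale u) measurable_tail).
Qed.

Lemma ge0_integral_shrink u (f : 'rV[R]_n.+1 -> \bar R) : 0 < u ->
  measurable_fun setT f -> (forall x, 0 <= f x)%E ->
  (\int[@lebesgue_rV R n.+1]_y f y =
   (u ^+ n)%:E * \int[@lebesgue_rV R n.+1]_y f (shrink u y))%E.
Proof.
move=> u0 mf f0; have mfs := measurableT_comp mf (measurable_shrink u).
rewrite ge0_integral_rVS// (ge0_integral_rVS mfs (fun x => f0 _)).
rewrite -ge0_integralZl//; last 3 first.
- exact: (measurable_ge0_integral_rV mfs (fun x => f0 _)).
- by move=> t _; apply: integral_ge0 => v _; exact: f0.
- by rewrite lee_fin exprn_ge0 ?ltW.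
apply: eq_integral => t _; rewrite (@ge0_integral_rV_scale _ _ u)//.
  by congr (_ * _)%E; apply: eq_integral => v _ /=; rewrite /shrink head_rV_cons tail_rV_cons.
exact: (measurableT_comp mf (measurableT_comp (@measurable_rV_cons R n) (measurable_pair1 _))).
Qed.

Lemma enorm_tail_le y : enorm (tail y) <= enorm y.
Proof.
rewrite -(@ler_pXn2r _ 2) ?nnegrE ?enorm_ge0// !enormE -[in leRHS](rV_cons_tail y).
by rewrite dot_rV_cons lerDr -expr2 sqr_ge0.
Qed.

Lemma enorm_shrink u y : enorm (shrink u y) ^+ 2 = y 0 0 ^+ 2 + u ^+ 2 * enorm (tail y) ^+ 2.
Proof. by rewrite !enormE dot_rV_cons dotZl dotZr; ring. Qed.

Lemma val_radial y : y != 0 -> val (radial y) = (enorm y)^-1 *: y.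
Proof.
move=> y0; rewrite /radial val_insubd /sphere_pred dotZl dotZr -enormE.
by rewrite mulrA -expr2 -exprMn mulVf ?expr1n ?eqxx// enorm_eq0.
Qed.

Lemma val_meridian u : (0 < n)%N ->
  val (meridian n u) = cos u *: delta_mx 0 ord0 + sin u *: delta_mx 0 ord_max.
Proof.
move=> n0; have n0max : ((ord0 : 'I_n.+1) == ord_max) = false.
  by rewrite -val_eqE/= ltn_eqF.
have nmax0 : ((ord_max : 'I_n.+1) == ord0) = false by rewrite eq_sym.
rewrite val_insubd /sphere_pred !(dotDl, dotDr, dotZl, dotZr, dot_delta) !eqxx.
by rewrite n0max nmax0 !mulr0 !mulr1 addr0 add0r -!expr2 cos2Dsin2 eqxx.
Qed.

(** The arc exceeds the chord, which exceeds its tangential part |tail y| / |y|, and |y| <= 1. This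
    is the lower bound on distances behind every domination of the kernel. *)
Lemma gdist_radial_pole_ge y : @punctured_ball R n.+1 y ->
  enorm (tail y) <= gdist (radial y) (pole n).
Proof.
move=> /andP[y0 y1]; apply: le_trans (chord_le_gdist _ _).
apply: le_trans (enorm_tail_le _).
have -> : tail (val (radial y) - val (pole n)) = (enorm y)^-1 *: tail y.
  by apply/rowP => j; rewrite val_radial -?enorm_gt0// !mxE eqxx/= subr0.
rewrite enormZ ger0_norm ?invr_ge0 ?enorm_ge0// ler_peMl ?enorm_ge0//.
by rewrite invf_ge1.
Qed.

End chart.

(** * The kernel K_H near 0 *)

Section kernel_formula.
Context {R : realType}.
Variable n : nat.
Hypothesis n_gt0 : (0 < n)%N.
Local Notation leb := (@lebesgue_measure R).
Local Notation lebn := (@lebesgue_rV R n.+1).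
Let mPB := @measurable_punctured_ball R n.+1.
Local Notation PB := (@punctured_ball R n.+1).

Definition farther (u : R) (y : 'rV[R]_n.+1) : R :=
  Num.max (gdist (radial y) (pole n)) (gdist (radial y) (meridian n u)).

Lemma measurable_meridian : measurable_fun setT (@meridian R n).
Proof.
apply: measurable_fun_sphere; apply: measurable_fun_mx => i j.
rewrite (_ : (fun _ => _) = fun u : R => cos u * (delta_mx 0 ord0 : 'rV[R]_n.+1) i j +
    sin u * (delta_mx 0 ord_max : 'rV[R]_n.+1) i j); last first.
  by apply/funext => u; rewrite /= val_meridian// mxE mxE [X in _ + X]mxE.
apply: measurable_funD; apply: measurable_funM => //.
  by apply: continuous_measurable_fun; exact: continuous_cos.
by apply: continuous_measurable_fun; exact: continuous_sin.
Qed.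

Lemma measurable_gdist_fun d (T : measurableType d) (f g : T -> @sphere R n) :
  measurable_fun setT f -> measurable_fun setT g ->
  measurable_fun setT (fun x => gdist (f x) (g x)).
Proof.
move=> mf mg; exact: (measurableT_comp (@measurable_gdist R n) (measurable_fun_pair mf mg)).
Qed.

Lemma measurable_farther2 :
  measurable_fun setT (fun p : measurableTypeR R * 'rV[R]_n.+1 => farther p.1 p.2).
Proof.
apply: measurable_maxr; apply: measurable_gdist_fun.
- exact: measurableT_comp (@measurable_radial R n) measurable_snd.
- exact: measurable_cst.
- exact: measurableT_comp (@measurable_radial R n) measurable_snd.
- exact: measurableT_comp measurable_meridian measurable_fst.
Qed.

Lemma measurable_farther u : measurable_fun setT (farther u).
Proof.
apply: measurable_maxr; apply: measurable_gdist_fun;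
  [exact: measurable_radial|exact: measurable_cst|exact: measurable_radial|exact: measurable_cst].
Qed.

Lemma farther_ge0 u y : 0 <= farther u y.
Proof. by rewrite le_max gdist_ge0. Qed.

Lemma enorm_tail_le_farther u y : PB y -> enorm (tail y) <= farther u y.
Proof. by move=> /gdist_radial_pole_ge h; rewrite le_max h. Qed.

Lemma punctured_ball_lty m : (@lebesgue_rV R m (@punctured_ball R m) < +oo)%E.
Proof.
have mPBm := @measurable_punctured_ball R m.
have mg : measurable_fun setT (\1_(`[(-1)%R, 1%R]%classic) : R -> R) by exact: measurable_indic.
apply: (@le_lt_trans _ _ (\int[@lebesgue_rV R m]_v
    (\prod_i (\1_(`[(-1)%R, 1%R]%classic) (v 0 i) : R))%:E)%E); last first.
  apply: ge0_integral_rV_prod => //.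
  rewrite integral_indic//= setIT lebesgue_measure_itv/=.
  by case: ifP => _; rewrite ?ltry// -EFinB ltry.
have -> : @lebesgue_rV R m (@punctured_ball R m) =
    (\int[@lebesgue_rV R m]_v (\1_(@punctured_ball R m) v)%:E)%E.
  by rewrite integral_indic// setIT.
apply: ge0_le_integral => //.
- by apply/measurable_EFinP; exact: measurable_indic.
- apply/measurable_EFinP; apply: measurable_prod => i _.
  exact: (measurableT_comp mg (@measurable_mx_coord R 1 m 0 i)).
- move=> v _; rewrite lee_fin !indicE.
  have [vPB|vPB] := pselect (@punctured_ball R m v); last first.
    by rewrite memNset// prodr_ge0.
  rewrite mem_set// big1// => i _; rewrite indicE mem_set//= in_itv/= -ler_norml.
  by move: vPB => /andP[_]; apply: le_trans; exact: coord_le_enorm.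
Qed.

Lemma indic_bool (T : Type) (p : pred T) (x : T) :
  \1_[set y | p y] x = (p x)%:R :> R.
Proof.
rewrite indicE; case: (boolP (p x)) => px; first by rewrite mem_set.
by rewrite memNset//; exact/negP.
Qed.

Lemma measurable_farther_lt u r : measurable [set y | farther u y < r].
Proof.
rewrite (_ : [set _ | _] = farther u @^-1` `]-oo, r[); last first.
  by apply/seteqP; split => y; rewrite /= in_itv.
by rewrite -[X in measurable X]setTI; apply: measurable_farther.
Qed.

(** Lying within r of both points means that the farther of the two is at distance less than r. *)
Lemma psiE (u r : R) : ((psi n u r)%:E =
  n.+1%:R%:E * \int[lebn]_y (\1_PB y * \1_[set y | farther u y < r] y)%:E)%E.
Proof.
have mD (z : @sphere R n) : measurable [set y | gdist y z < r].
  rewrite (_ : [set _ | _] = (fun y => gdist y z) @^-1` `]-oo, r[); last first.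
    by apply/seteqP; split => y; rewrite /= in_itv.
  have mg : measurable_fun setT (fun y : @sphere R n => gdist y z).
    by apply: measurable_gdist_fun => //; exact: measurable_cst.
  by rewrite -[X in measurable X]setTI; apply: mg.
have mF := measurable_farther_lt u r.
rewrite /psi /Rintegral ge0_integral_surface//.
- have E : (\int[lebn]_(y in PB) (\1_[set y | gdist y (pole n) < r] (radial y) *
      \1_[set y0 | gdist y0 (meridian n u) < r] (radial y))%:E =
      \int[lebn]_y (\1_PB y * \1_[set y | farther u y < r] y)%:E)%E.
    rewrite integral_mkcond; apply: eq_integral => y _.
    rewrite patchE (indicE _ PB); case: ifP => yPB; last by rewrite mul0r.
    by rewrite mul1r !indic_bool -natrM mulnb -gt_max.
  rewrite E fineK// fin_numM// ge0_fin_numE; last first.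
    by apply: integral_ge0 => y _; rewrite lee_fin.
  apply: le_lt_trans (punctured_ball_lty n.+1).
  have -> : lebn PB = (\int[lebn]_y (\1_PB y)%:E)%E by rewrite integral_indic// ?setIT.
  apply: ge0_le_integral => //.
  + by apply/measurable_EFinP; apply: measurable_funM; exact: measurable_indic.
  + by apply/measurable_EFinP; exact: measurable_indic.
  + by move=> y _; rewrite lee_fin ler_piMr// indic_bool lern1 leq_b1.
- by apply/measurable_EFinP; apply: measurable_funM; exact: measurable_indic.
Qed.

Let a (H : R) := n%:R - 2 * H.

Lemma integral_indic_powR (m p : R) : p < -1 -> 0 < m ->
  (\int[leb]_(r in `[0%R, +oo[) (\1_[set r | m < r] r * r `^ p)%:E =
   (- (p + 1)^-1 * m `^ (p + 1))%:E)%E.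
Proof.
move=> p1 m0; rewrite -integral_powR_tail// -integral_itv_obnd_cbnd; last first.
  by apply/measurable_funTS/measurable_EFinP; exact: measurable_powR_fun.
rewrite integral_mkcond [RHS]integral_mkcond; apply: eq_integral => r _.
rewrite !patchE indic_bool; case: ifPn => [_|/negP r0].
  case: (boolP (m < r)) => mr; first by rewrite mem_set ?mul1r//= in_itv/= mr.
  by rewrite memNset ?mul0r//= in_itv/= (negbTE mr).
rewrite memNset//= in_itv/= andbT => mr; apply: r0; apply: mem_set.
by rewrite /= in_itv/= (ltW (lt_trans m0 mr)).
Qed.

(* The integral over r > m_u(y) of r^(-n-1+2H), with m_u = farther u. *)
Definition kernel_density (H u : R) (y : 'rV[R]_n.+1) : R :=
  \1_PB y * ((a H)^-1 * farther u y `^ (- a H)).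

Lemma kernel_density_ge0 H u y : 0 < a H -> 0 <= kernel_density H u y.
Proof. by move=> a0; rewrite mulr_ge0// mulr_ge0 ?powR_ge0// invr_ge0 ltW. Qed.

Lemma measurable_kernel_density2 H :
  measurable_fun setT (fun p : measurableTypeR R * 'rV[R]_n.+1 => kernel_density H p.1 p.2).
Proof.
apply: measurable_funM.
  exact: (measurableT_comp (measurable_indic mPB) measurable_snd).
apply: measurable_funM => //.
exact: (measurableT_comp (@measurable_powR_fun R _) measurable_farther2).
Qed.

Lemma measurable_kernel_density H u : measurable_fun setT (kernel_density H u).
Proof.
exact: (measurableT_comp (measurable_kernel_density2 H) (measurable_pair1 u)).
Qed.

(** By Tonelli the integral in r is taken first: for fixed y it runs over r > [farther u y] and is
    an explicit power. Extended reals let the identity precede any integrability. *)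
Lemma KH_density (H u : R) : 0 < a H ->
  (\int[leb]_(r in `[0%R, +oo[) (psi n u r * r `^ (- n%:R - 1 + 2 * H))%:E =
   n.+1%:R%:E * \int[lebn]_y (kernel_density H u y)%:E)%E.
Proof.
move=> a0; set p := - n%:R - 1 + 2 * H.
have p1 : p < -1 by move: a0; rewrite /a /p; lra.
have pa : p + 1 = - a H by rewrite /p /a; ring.
pose f (z : measurableTypeR R * 'rV[R]_n.+1) : \bar R :=
  (\1_(`[0%R, +oo[%classic : set (measurableTypeR R)) z.1 * (\1_PB z.2 *
   (\1_[set z : measurableTypeR R * 'rV[R]_n.+1 | farther u z.2 < z.1] z * z.1 `^ p)))%:E.
have f0 z : (0 <= f z)%E by rewrite lee_fin !mulr_ge0// powR_ge0.
have mS : measurable [set z : measurableTypeR R * 'rV[R]_n.+1 | farther u z.2 < z.1].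
  have ml : measurable_fun setT (fun z : measurableTypeR R * 'rV[R]_n.+1 => farther u z.2 < z.1).
    apply: measurable_fun_ltr; last exact: measurable_fst.
    exact: (measurableT_comp (measurable_farther u) measurable_snd).
  by have := ml measurableT [set true] I; rewrite setTI.
have mf : measurable_fun setT f.
  apply/measurable_EFinP; apply: measurable_funM.
    apply: (measurableT_comp _ measurable_fst); exact: measurable_indic.
  apply: measurable_funM; first exact: (measurableT_comp (measurable_indic mPB) measurable_snd).
  apply: measurable_funM; first exact: measurable_indic.
  exact: (measurableT_comp (@measurable_powR_fun R _) measurable_fst).
transitivity (\int[leb]_r (n.+1%:R%:E * \int[lebn]_y f (r, y)))%E.
  rewrite integral_mkcond; apply: eq_integral => r _.
  rewrite patchE; case: ifPn => [/set_mem r0|/negP r0].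
    rewrite EFinM psiE -muleA; congr (_ * _)%E.
    rewrite muleC -ge0_integralZl//.
    - apply: eq_integral => y _; rewrite /f /= [in RHS]indicE mem_set// mul1r -EFinM; congr EFin.
      by rewrite !indic_bool; ring.
    - apply/measurable_EFinP; apply: measurable_funM; first exact: measurable_indic.
      by apply: measurable_indic; exact: measurable_farther_lt.
    - by rewrite lee_fin powR_ge0.
  rewrite (eq_integral (cst 0%E)) ?integral0 ?mule0// => y _.
  by rewrite /f/= indicE memNset ?mul0r// => r0'; apply: r0; exact: mem_set.
rewrite ge0_integralZl//; last 2 first.
- exact: (measurable_fun_fubini_tonelli_F (m2 := lebn) f mf f0).
- by move=> r _; apply: integral_ge0.
congr (_ * _)%E; rewrite (fubini_tonelli f)//.
apply: ge0_ae_eq_integral => //.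
- exact: (measurable_fun_fubini_tonelli_G (m1 := leb) f mf f0).
- by apply/measurable_EFinP; exact: measurable_kernel_density.
- by move=> y _; apply: integral_ge0.
- by move=> y _; rewrite lee_fin kernel_density_ge0.
apply: filterS (@ae_coord_neq0 R n.+1) => y y0 _.
have yPBE : (\1_PB y == 0 :> R) || (\1_PB y == 1 :> R).
  by rewrite indicE; case: (_ \in _); rewrite eqxx ?orbT.
case/orP : yPBE => /eqP yPB.
  rewrite /kernel_density yPB mul0r (eq_integral (cst 0%E)) ?integral0// => r _.
  by rewrite /f/= yPB mul0r mulr0.
have far0 : 0 < farther u y.
  apply: lt_le_trans (enorm_tail_le_farther u _); last first.
    by apply: contrapT => nPB; move: yPB; rewrite indicE memNset// => /eqP; rewrite eq_sym oner_eq0.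
  rewrite enorm_gt0; apply/eqP => /rowP/(_ (Ordinal n_gt0)).
  by rewrite !mxE; apply/eqP; exact: y0.
rewrite /kernel_density yPB mul1r -pa.
have -> : (a H)^-1 = - (p + 1)^-1 by rewrite pa invrN opprK.
rewrite -integral_indic_powR// [RHS]integral_mkcond; apply: eq_integral => r _.
rewrite patchE /f/= yPB indicE; case: ifPn => _; last by rewrite mul0r.
by rewrite !mul1r !indic_bool.
Qed.

End kernel_formula.

(** * Integrable dominating functions *)

Section dominating_function.
Context {R : realType}.
Local Notation leb := (@lebesgue_measure R).
Variables alpha beta : R.

Definition half_dom (x : R) : R :=
  \1_(`]0%R, 1%R]%classic) x * x `^ (- alpha) +
  \1_(`]1%R, +oo[%classic) x * x `^ (- beta).

Definition dom1 (x : R) : R := half_dom x + half_dom (- x).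

Lemma half_dom_ge0 x : 0 <= half_dom x.
Proof. by rewrite addr_ge0 ?mulr_ge0 ?powR_ge0. Qed.

Lemma dom1_ge0 x : 0 <= dom1 x.
Proof. by rewrite addr_ge0 ?half_dom_ge0. Qed.

Lemma measurable_half_dom : measurable_fun setT half_dom.
Proof.
by apply: measurable_funD; apply: measurable_funM; try exact: measurable_indic;
  exact: measurable_powR_fun.
Qed.

Lemma measurable_dom1 : measurable_fun setT dom1.
Proof.
apply: measurable_funD; first exact: measurable_half_dom.
exact: (measurableT_comp measurable_half_dom (@oppr_measurable R setT)).
Qed.

Lemma le_dom1_small x : 0 < `|x| <= 1 -> `|x| `^ (- alpha) <= dom1 x.
Proof.
wlog x0 : x / 0 <= x.
  move=> h; have [x0|x0] := leP 0 x; first exact: h.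
  rewrite -normrN => nx; rewrite /dom1 addrC -[X in _ + half_dom X]opprK.
  by apply: h => //; rewrite oppr_ge0 ltW.
rewrite ger0_norm// => xI; rewrite /dom1 ler_wpDr ?half_dom_ge0//.
rewrite /half_dom indicE mem_set/= ?in_itv//= mul1r lerDl.
by rewrite mulr_ge0 ?powR_ge0.
Qed.

Lemma le_dom1_large x : 1 < `|x| -> `|x| `^ (- beta) <= dom1 x.
Proof.
wlog x0 : x / 0 <= x.
  move=> h; have [x0|x0] := leP 0 x; first exact: h.
  rewrite -normrN => nx; rewrite /dom1 addrC -[X in _ + half_dom X]opprK.
  by apply: h => //; rewrite oppr_ge0 ltW.
rewrite ger0_norm// => xI; rewrite /dom1 ler_wpDr ?half_dom_ge0//.
rewrite /half_dom addrC indicE mem_set/= ?in_itv/= ?xI// mul1r lerDl.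
by rewrite mulr_ge0 ?powR_ge0.
Qed.

Lemma integral_indicM (A : set (measurableTypeR R)) (f : R -> R) :
  (\int[leb]_x (\1_A x * f x)%:E = \int[leb]_(x in A) (f x)%:E)%E.
Proof.
rewrite [RHS]integral_mkcond; apply: eq_integral => x _; rewrite patchE indicE.
by case: ifP => _; rewrite ?mul1r ?mul0r.
Qed.

Hypotheses (alpha1 : alpha < 1) (beta1 : 1 < beta).

Lemma half_dom_lty : (\int[leb]_x (half_dom x)%:E < +oo)%E.
Proof.
under eq_integral do rewrite EFinD.
rewrite ge0_integralD//.
- apply: lte_add_pinfty.
    by rewrite integral_indicM; apply: integral_powR_01; rewrite ltrN2.
  rewrite (integral_indicM `]1%R, +oo[%classic (fun x => x `^ (- beta))).
  rewrite integral_itv_obnd_cbnd.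
    by rewrite integral_powR_tail ?ltry// ltrN2.
  by apply/measurable_funTS/measurable_EFinP; exact: measurable_powR_fun.
- by move=> x _; rewrite lee_fin mulr_ge0 ?powR_ge0.
- apply/measurable_EFinP; apply: measurable_funM; first exact: measurable_indic.
  exact: measurable_powR_fun.
- by move=> x _; rewrite lee_fin mulr_ge0 ?powR_ge0.
- apply/measurable_EFinP; apply: measurable_funM; first exact: measurable_indic.
  exact: measurable_powR_fun.
Qed.

Lemma dom1_lty : (\int[leb]_x (dom1 x)%:E < +oo)%E.
Proof.
under eq_integral do rewrite EFinD.
have mh : measurable_fun setT (fun x : R => (half_dom x)%:E).
  by apply/measurable_EFinP; exact: measurable_half_dom.
have h0 x : (0 <= (half_dom x)%:E)%E by rewrite lee_fin half_dom_ge0.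
rewrite ge0_integralD//; last first.
  by apply/measurable_EFinP; exact: (measurableT_comp measurable_half_dom (@oppr_measurable R setT)).
rewrite -(ge0_integral_opp mh h0).
by apply: lte_add_pinfty; exact: half_dom_lty.
Qed.

End dominating_function.

Section radial_domination.
Context {R : realType}.
Variables (n : nat) (a : R).
Hypotheses (n_gt0 : (0 < n)%N) (a0 : 0 < a) (an : a < n%:R) (an1 : n%:R < a + 1).

(* A product of functions of one variable that dominates |v|^-a for |v| <= 1 and
   |v|^-(a+1) for |v| > 1, and is integrable as a < n < a + 1. *)
Definition radial_dom (v : 'rV[R]_n) : R :=
  \prod_i dom1 (a / n%:R) ((a + 1) / n%:R) (v 0 i).

Let n0 : 0 < n%:R :> R. Proof. by rewrite ltr0n. Qed.

Lemma radial_dom_ge0 v : 0 <= radial_dom v.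
Proof. by apply: prodr_ge0 => i _; exact: dom1_ge0. Qed.

Lemma powR_prod (x b : R) : 0 <= x -> x `^ (- b) = \prod_(i < n) x `^ (- (b / n%:R)).
Proof.
move=> x0; rewrite prodr_const card_ord -powR_mulrn ?powR_ge0// -powRrM.
by rewrite mulNr divfK// gt_eqF.
Qed.

Lemma powRN_anti (x y b : R) : 0 < x -> x <= y -> 0 <= b -> y `^ (- b) <= x `^ (- b).
Proof.
move=> x0 xy b0; rewrite !powRN lef_pV2 ?posrE ?powR_gt0//.
  by rewrite ge0_ler_powR// nnegrE ltW// (lt_le_trans x0).
exact: lt_le_trans xy.
Qed.

(** The exponent is split into n equal parts, and |v|^(-a/n) <= |v_i|^(-a/n) because |v_i| <=
    |v|. *)
Lemma le_radial_dom_small (v : 'rV[R]_n) : (forall i, v 0 i != 0) -> enorm v <= 1 ->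
  enorm v `^ (- a) <= radial_dom v.
Proof.
move=> v0 v1; rewrite powR_prod ?enorm_ge0//; apply: ler_prod => i _.
rewrite powR_ge0/=; have vi := coord_le_enorm v i.
have vi0 : 0 < `|v 0 i| by rewrite normr_gt0.
apply: (le_trans (powRN_anti vi0 vi _)); first by rewrite divr_ge0 ?ltW.
by apply: le_dom1_small; rewrite vi0 (le_trans vi).
Qed.

(** Same splitting of the exponent. For a coordinate with |v_i| <= 1 the factor |v|^(-(a+1)/n) is at
    most 1, and |v_i|^(-a/n) is at least 1. *)
Lemma le_radial_dom_large (v : 'rV[R]_n) : (forall i, v 0 i != 0) -> 1 < enorm v ->
  enorm v `^ (- (a + 1)) <= radial_dom v.
Proof.
move=> v0 v1; rewrite powR_prod ?enorm_ge0//; apply: ler_prod => i _.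
rewrite powR_ge0/=; have vi := coord_le_enorm v i.
have vi0 : 0 < `|v 0 i| by rewrite normr_gt0.
have b0 : 0 <= (a + 1) / n%:R by rewrite divr_ge0 ?addr_ge0 ?ltW.
have [vi1|vi1] := leP `|v 0 i| 1; last first.
  by apply: le_trans (le_dom1_large _ _ vi1); apply: powRN_anti.
have one b : 1 `^ b = 1 :> R by rewrite powR1.
apply: le_trans (le_dom1_small _ _ _); last by rewrite vi0.
apply: (@le_trans _ _ 1).
  by rewrite -[leRHS](one (- ((a + 1) / n%:R))); apply: powRN_anti => //; exact: ltW.
rewrite -[leLHS](one (- (a / n%:R))); apply: powRN_anti => //.
by rewrite divr_ge0 ?ltW.
Qed.

Lemma measurable_radial_dom : measurable_fun setT radial_dom.
Proof.
apply: measurable_prod => i _.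
exact: (measurableT_comp (measurable_dom1 _ _) (@measurable_mx_coord R 1 n 0 i)).
Qed.

Lemma radial_dom_lty : (\int[@lebesgue_rV R n]_v (radial_dom v)%:E < +oo)%E.
Proof.
apply: ge0_integral_rV_prod; first exact: measurable_dom1.
  by move=> x; exact: dom1_ge0.
by apply: dom1_lty; rewrite ?ltr_pdivrMr ?ltr_pdivlMr ?mul1r.
Qed.

Lemma powR_gap_small (s m : R) : 0 < s -> s <= m -> s `^ (- a) - m `^ (- a) <= s `^ (- a).
Proof. by move=> s0 sm; rewrite gerBl powR_ge0. Qed.

(* (1 + 1/s)^(-a) >= 1 - a/s *)
Lemma powR_gap_large (s m : R) : 0 < s -> s <= m -> m <= s + 1 ->
  s `^ (- a) - m `^ (- a) <= a * s `^ (- (a + 1)).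
Proof.
move=> s0 sm ms1; have m0 : 0 < m by exact: lt_le_trans sm.
have mE : m `^ (- a) = s `^ (- a) * (m / s) `^ (- a).
  rewrite -powRM ?divr_ge0 ?(ltW s0) ?(ltW m0)//.
  by congr (_ `^ _); rewrite mulrC divfK// gt_eqF.
have -> : s `^ (- (a + 1)) = s `^ (- a) * s^-1.
  rewrite opprD powRD; last by rewrite (gt_eqF s0) implybT.
  by rewrite powR_inv1// ltW.
rewrite mE mulrCA -[X in X - _]mulr1 -mulrBr ler_wpM2l ?powR_ge0//.
have ms0 : 0 < m / s by rewrite divr_gt0.
(* With t = m / s: t^-a = exp(- a ln t) >= 1 - a ln t >= 1 - a (t - 1), and t - 1 <= 1 / s. *)
rewrite /powR (gt_eqF ms0) mulNr.
have := expR_ge1Dx (- (a * ln (m / s))).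
have : a * ln (m / s) <= a * (m / s - 1).
  rewrite ler_wpM2l ?(ltW a0)//.
  have := @le_ln1Dx R (m / s - 1).
  have -> : 1 + (m / s - 1) = m / s by ring.
  by apply; rewrite ltrBrDr addNr.
have : a * (m / s - 1) <= a / s.
  rewrite ler_wpM2l ?(ltW a0)// lerBlDr ler_pdivrMr// mulrDl mulVf ?gt_eqF// mul1r.
  by rewrite addrC.
lra.
Qed.

End radial_domination.

(** * Bounds on K_H(0) - K_H(u) *)

Section kernel_gap.
Context {R : realType}.
Variables (n : nat) (H : R).
Hypothesis n_gt0 : (0 < n)%N.
Hypotheses (H_gt0 : 0 < H) (H_lt : H < 2^-1).
Local Notation lebn := (@lebesgue_rV R n.+1).
Local Notation PB := (@punctured_ball R n.+1).
Local Notation a := (n%:R - 2 * H).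
Local Notation kd := (@kernel_density R n H).
Implicit Types (u : R) (y : 'rV[R]_n.+1).

Let n1 : 1 <= n%:R :> R. Proof. by rewrite ler1n. Qed.
Let a0 : 0 < a. Proof. by move: n1 H_lt; lra. Qed.
Let an : a < n%:R. Proof. by move: H_gt0; lra. Qed.
Let an1 : n%:R < a + 1. Proof. by move: H_lt; lra. Qed.

Lemma meridian0 : meridian n 0 = pole n :> @sphere R n.
Proof.
by apply: val_inj; rewrite val_meridian// cos0 sin0 scale1r scale0r addr0.
Qed.

Lemma farther0 y : farther 0 y = gdist (radial y) (pole n).
Proof. by rewrite /farther meridian0 maxxx. Qed.

Lemma farther_ge0E u y : farther 0 y <= farther u y.
Proof. by rewrite farther0 le_max lexx. Qed.

Lemma farther_le u y : 0 <= u -> farther u y <= farther 0 y + u.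
Proof.
move=> u0; rewrite farther0 ge_max lerDl u0/=.
apply: (le_trans (gdist_triangle _ (pole n) _)); rewrite lerD2l.
(* Past pi the meridian point is no longer at distance u, but no distance exceeds pi. *)
have [upi|upi] := leP u pi; first by rewrite gdist_pole_meridian// u0.
by rewrite (le_trans (gdist_le_pi _ _))// ltW.
Qed.

(** The factor 1 + a covers the bounds with constant 1 (the kernel itself, and the gap near the
    axis) and with constant a (the gap far from it). Shrinking leaves [y 0 0] unchanged, so it stays
    in [-1, 1] for every u. *)
Definition gap_dom y : R := \1_(`[(-1)%R, 1%R]%classic) (y 0 0) *
  (a^-1 * (1 + a) * radial_dom a (tail y)).

Lemma gap_dom_ge0 y : 0 <= gap_dom y.
Proof.
rewrite mulr_ge0// mulr_ge0 ?radial_dom_ge0//.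
by apply: mulr_ge0; [rewrite invr_ge0 ltW|rewrite (addr_ge0 ler01 (ltW a0))].
Qed.

Lemma measurable_gap_dom : measurable_fun setT gap_dom.
Proof.
apply: measurable_funM.
  by apply: (measurableT_comp _ (@measurable_mx_coord R 1 n.+1 0 0)); exact: measurable_indic.
apply: measurable_funM => //.
exact: (measurableT_comp (@measurable_radial_dom R n a) measurable_tail).
Qed.

Lemma gap_dom_integrable : lebn.-integrable setT (EFin \o gap_dom).
Proof.
have mE : measurable_fun setT (EFin \o gap_dom).
  by apply/measurable_EFinP; exact: measurable_gap_dom.
apply/integrableP; split => //.
under eq_integral do rewrite /= ger0_norm ?gap_dom_ge0//.
rewrite ge0_integral_rVS//; last by move=> y; rewrite lee_fin gap_dom_ge0.
have C0 : 0 <= a^-1 * (1 + a).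
  by apply: mulr_ge0; [rewrite invr_ge0 ltW|rewrite (addr_ge0 ler01 (ltW a0))].
pose I := (\int[@lebesgue_rV R n]_v (radial_dom a v)%:E)%E.
have I0 : (0 <= I)%E by apply: integral_ge0 => v _; rewrite lee_fin radial_dom_ge0.
have Iy : (I < +oo)%E by exact: radial_dom_lty.
rewrite (eq_integral (fun t : measurableTypeR R =>
    (\1_(`[(-1)%R, 1%R]%classic) t)%:E * ((a^-1 * (1 + a))%:E * I)))%E; last first.
  move=> t _; rewrite muleA -EFinM -ge0_integralZl//; last 3 first.
  - by apply/measurable_EFinP; exact: measurable_radial_dom.
  - by move=> v _; rewrite lee_fin radial_dom_ge0.
  - by rewrite lee_fin mulr_ge0.
  apply: eq_integral => v _.
  by rewrite /gap_dom head_rV_cons tail_rV_cons -EFinM mulrA.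
rewrite ge0_integralZr//; last 2 first.
- by apply/measurable_EFinP; exact: measurable_indic.
- by rewrite mule_ge0.
rewrite [X in (X * _)%E](@integral_indic _ (measurableTypeR R) R lebesgue_measure
  setT measurableT `[(-1)%R, 1%R]%classic (measurable_itv _)) setIT.
have leb1 : (@lebesgue_measure R `[(-1)%R, 1%R]%classic < +oo)%E.
  by rewrite lebesgue_measure_itv/=; case: ifP => _; rewrite ?ltry// -EFinB ltry.
apply: lte_mul_pinfty; [exact: measure_ge0| |exact: lte_mul_pinfty].
by rewrite ge0_fin_numE.
Qed.

Lemma kd_le_dom u y : (forall i, y 0 i != 0) -> `|kd u y| <= gap_dom y.
Proof.
move=> y0; rewrite ger0_norm ?kernel_density_ge0//.
rewrite /kernel_density /gap_dom (indicE _ PB).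
case: (boolP (y \in PB)) => [/set_mem yPB|_]; last by rewrite mul0r; exact: gap_dom_ge0.
have t0 i : tail y 0 i != 0 by rewrite mxE.
have ty : 0 < enorm (tail y).
  by rewrite enorm_gt0; apply/eqP => /rowP/(_ (Ordinal n_gt0))/eqP; rewrite [X in _ == X]mxE (negbTE (t0 _)).
have /andP[_ y1] := yPB.
rewrite mul1r indicE mem_set/= ?mul1r; last first.
  by rewrite in_itv/= -ler_norml (le_trans (coord_le_enorm _ _)).
rewrite -mulrA ler_wpM2l ?invr_ge0 ?(ltW a0)//.
apply: (@le_trans _ _ (radial_dom a (tail y))).
  apply: le_trans (le_radial_dom_small n_gt0 a0 t0 (le_trans (enorm_tail_le y) y1)).
  by apply: powRN_anti => //; [exact: enorm_tail_le_farther|exact: ltW].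
by rewrite ler_peMl ?radial_dom_ge0// lerDl ltW.
Qed.

Lemma measurable_kd u : measurable_fun setT (kd u).
Proof. exact: measurable_kernel_density. Qed.

Lemma kd_integrable u : lebn.-integrable setT (EFin \o kd u).
Proof.
apply/integrableP; split; first by apply/measurable_EFinP; exact: measurable_kd.
have /integrableP[_] := gap_dom_integrable; apply: le_lt_trans.
apply: ae_ge0_le_integral => //.
- by apply: measurableT_comp => //; apply/measurable_EFinP; exact: measurable_kd.
- by apply: measurableT_comp => //; apply/measurable_EFinP; exact: measurable_gap_dom.
apply: filterS (@ae_coord_neq0 R n.+1) => y y0 _.
by rewrite lee_fin (le_trans (kd_le_dom _ y0))// ler_norm.
Qed.

Lemma KH_kd u : KH n H u = n.+1%:R * \int[lebn]_y kd u y.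
Proof.
rewrite /KH /Rintegral KH_density// fineM//.
by apply: integrable_fin_num => //; exact: kd_integrable.
Qed.

(** The factor u^a is u^(-2H) times the Jacobian u^n of [shrink u]. *)
Definition gap u y : R := u `^ a * (kd 0 (shrink u y) - kd u (shrink u y)).

Lemma measurable_gap u : measurable_fun setT (gap u).
Proof.
apply: measurable_funM => //; apply: measurable_funB;
  apply: measurableT_comp (measurable_shrink u); exact: measurable_kd.
Qed.

Lemma kd_shrink u v : 0 < u ->
  \int[lebn]_y kd v y = u ^+ n * \int[lebn]_y kd v (shrink u y) /\
  lebn.-integrable setT (EFin \o (fun y => kd v (shrink u y))).
Proof.
move=> u0.
have mk : measurable_fun setT (EFin \o kd v) by apply/measurable_EFinP; exact: measurable_kd.
have k0 y : (0 <= (EFin \o kd v) y)%E by rewrite lee_fin kernel_density_ge0.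
have E : (\int[lebn]_y (kd v y)%:E = (u ^+ n)%:E * \int[lebn]_y (kd v (shrink u y))%:E)%E.
  exact: ge0_integral_shrink u0 mk k0.
have un0 : (0 < (u ^+ n)%:E)%E by rewrite lte_fin exprn_gt0.
have fin1 : (\int[lebn]_y (kd v y)%:E)%E \is a fin_num.
  by apply: integrable_fin_num => //; exact: kd_integrable.
have ge1 : (0 <= \int[lebn]_y (kd v (shrink u y))%:E)%E.
  by apply: integral_ge0 => y _; exact: k0.
have lt1 : (\int[lebn]_y (kd v (shrink u y))%:E < +oo)%E.
  rewrite ltNge leye_eq; apply/eqP => Ey; move: fin1; rewrite E Ey.
  by rewrite gt0_muley.
split.
  have fin2 : (\int[lebn]_y (kd v (shrink u y))%:E)%E \is a fin_num by rewrite (ge0_fin_numE ge1).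
  exact: (etrans (congr1 fine E) (fineM (isT : (u ^+ n)%:E \is a fin_num) fin2)).
apply/integrableP; split.
  exact: measurableT_comp mk (measurable_shrink u).
rewrite (eq_integral (fun y => (kd v (shrink u y))%:E)) => [//|y _].
by rewrite /= ger0_norm// kernel_density_ge0.
Qed.

Lemma KH_gapE u : 0 < u ->
  KH n H 0 - KH n H u = u `^ (2 * H) * (n.+1%:R * \int[lebn]_y gap u y).
Proof.
move=> u0; have [E0 i0] := kd_shrink 0 u0; have [E1 i1] := kd_shrink u u0.
have i2 : lebn.-integrable setT (EFin \o (fun y => kd 0 (shrink u y) - kd u (shrink u y))).
  exact: (integrableB measurableT i0 i1).
have EG : \int[lebn]_y gap u y =
    u `^ a * (\int[lebn]_y kd 0 (shrink u y) - \int[lebn]_y kd u (shrink u y)).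
  apply: (etrans (RintegralZl _ measurableT i2)).
  exact: (congr1 _ (RintegralB measurableT i0 i1)).
have Eu : u ^+ n = u `^ (2 * H) * u `^ a.
  rewrite -powRD; last by rewrite (gt_eqF u0) implybT.
  by rewrite addrC subrK powR_mulrn// ltW.
have alg (N I0 I1 G p q s x0 x1 : R) : x0 = N * (p * I0) -> x1 = N * (p * I1) ->
    G = q * (I0 - I1) -> p = s * q -> x0 - x1 = s * (N * G).
  by move=> -> -> -> ->; ring.
exact: (alg _ _ _ _ _ _ _ _ _ (etrans (KH_kd 0) (congr1 _ E0))
  (etrans (KH_kd u) (congr1 _ E1)) EG Eu).
Qed.

(** By homogeneity u^a turns distances into s / u and m / u, where |tail y| <= s / u <= m / u <= s /
    u + 1. The first power alone is a good bound for |tail y| <= 1; beyond, the difference of powers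
    gains one exponent. *)
Lemma gap_le_dom u y : 0 < u -> (forall i, y 0 i != 0) -> `|gap u y| <= gap_dom y.
Proof.
move=> u0 y0; rewrite /gap /kernel_density -mulrBr (indicE _ PB).
case: (boolP (shrink u y \in PB)) => [/set_mem zPB|_]; last first.
  by rewrite mul0r mulr0 normr0 gap_dom_ge0.
have t0 i : tail y 0 i != 0 by rewrite mxE.
have ty : 0 < enorm (tail y).
  by rewrite enorm_gt0; apply/eqP => /rowP/(_ (Ordinal n_gt0))/eqP; rewrite [X in _ == X]mxE (negbTE (t0 _)).
have /andP[_ z1] := zPB.
rewrite /gap_dom [in leRHS]indicE mem_set/= ?mul1r; last first.
  rewrite in_itv/= -ler_norml; apply: le_trans z1.
  by rewrite -[y 0 0](head_rV_cons _ (u *: tail y)); exact: coord_le_enorm.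
set s := farther 0 (shrink u y); set m := farther u (shrink u y).
have sm : s <= m by exact: farther_ge0E.
have msu : m <= s + u by apply: farther_le; exact: ltW.
have us : u * enorm (tail y) <= s.
  have := enorm_tail_le_farther 0 zPB.
  by rewrite tail_rV_cons enormZ gtr0_norm.
have s0 : 0 < s by apply: lt_le_trans us; rewrite mulr_gt0.
clearbody s m.
have scale x : 0 <= x -> u `^ a * x `^ (- a) = (x / u) `^ (- a).
  move=> x0; rewrite powRM ?invr_ge0 ?(ltW u0)// mulrC -[u^-1]powR_inv1 ?(ltW u0)//.
  by rewrite -powRrM mulN1r opprK.
have -> : u `^ a * (a^-1 * s `^ (- a) - a^-1 * m `^ (- a)) =
    a^-1 * ((s / u) `^ (- a) - (m / u) `^ (- a)).
  rewrite -mulrBr mulrCA mulrBr !scale ?(ltW s0) ?(le_trans (ltW s0) sm)//.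
have su0 : 0 < s / u by rewrite divr_gt0.
have smu : s / u <= m / u by rewrite ler_pM2r ?invr_gt0.
have msu1 : m / u <= s / u + 1.
  by rewrite -[X in _ + X](divff (lt0r_neq0 u0)) -mulrDl ler_pM2r ?invr_gt0.
have tsu : enorm (tail y) <= s / u by rewrite ler_pdivlMr// mulrC.
rewrite ger0_norm; last first.
  rewrite mulr_ge0 ?invr_ge0 ?(ltW a0)// subr_ge0; apply: powRN_anti => //; exact: ltW.
rewrite -mulrA ler_wpM2l ?invr_ge0 ?(ltW a0)//.
have rd0 := radial_dom_ge0 a (tail y).
have [t1|t1] := leP (enorm (tail y)) 1.
  apply: (@le_trans _ _ (radial_dom a (tail y))); last by rewrite ler_peMl// lerDl ltW.
  apply: (le_trans (powR_gap_small _ su0 smu)).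
  apply: le_trans (le_radial_dom_small n_gt0 a0 t0 t1).
  by apply: powRN_anti => //; exact: ltW.
apply: (@le_trans _ _ (a * radial_dom a (tail y))); last by rewrite ler_wpM2r// lerDr.
apply: (le_trans (powR_gap_large a0 su0 smu msu1)); rewrite ler_wpM2l ?(ltW a0)//.
apply: le_trans (le_radial_dom_large n_gt0 a0 t0 t1).
by apply: powRN_anti => //; exact: (addr_ge0 (ltW a0) ler01).
Qed.

Lemma KH_gap_le : exists2 C : R, 0 <= C &
  forall u, 0 <= u -> `|KH n H 0 - KH n H u| <= C * u `^ (2 * H).
Proof.
exists (n.+1%:R * \int[lebn]_y gap_dom y).
  by rewrite mulr_ge0// Rintegral_ge0// => y _; exact: gap_dom_ge0.
move=> u; rewrite le_eqVlt => /orP[/eqP <-|u0].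
  by rewrite subrr normr0 mulr_ge0 ?powR_ge0// mulr_ge0// Rintegral_ge0// => y _; exact: gap_dom_ge0.
rewrite KH_gapE// mulrC normrM (ger0_norm (powR_ge0 _ _)) ler_wpM2r ?powR_ge0//.
rewrite normrM ger0_norm// ler_wpM2l//.
have mg := measurable_gap u.
have ig : lebn.-integrable setT (EFin \o gap u).
  apply/integrableP; split; first exact/measurable_EFinP.
  have /integrableP[_] := gap_dom_integrable; apply: le_lt_trans.
  apply: ae_ge0_le_integral => //.
  - by apply: measurableT_comp => //; exact/measurable_EFinP.
  - by apply: measurableT_comp => //; apply/measurable_EFinP; exact: measurable_gap_dom.
  apply: filterS (@ae_coord_neq0 R n.+1) => y y0 _.
  by rewrite lee_fin (le_trans (gap_le_dom u0 y0))// ler_norm.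
apply: (le_trans (le_normr_Rintegral _ ig)) => //.
apply: fine_le.
- by apply: integrable_fin_num => //; exact: integrable_norm.
- by apply: integrable_fin_num => //; exact: gap_dom_integrable.
apply: ae_ge0_le_integral => //.
- by apply/measurable_EFinP; exact: measurableT_comp.
- by move=> y _; rewrite lee_fin gap_dom_ge0.
- by apply/measurable_EFinP; exact: measurable_gap_dom.
apply: filterS (@ae_coord_neq0 R n.+1) => y y0 _.
by rewrite lee_fin gap_le_dom.
Qed.

Lemma measurable_KH : measurable_fun setT (KH n H).
Proof.
rewrite (_ : KH n H = fun u => n.+1%:R * \int[lebn]_y kd u y); last first.
  by apply/funext => u; exact: KH_kd.
apply: measurable_funM => //.
apply: (@measurableT_comp _ _ _ _ _ _ fine).
  exact: fine_measurable.
apply: (measurable_fun_fubini_tonelli_F (m2 := lebn)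
  (fun p : measurableTypeR R * 'rV[R]_n.+1 => (kd p.1 p.2)%:E)).
  by apply/measurable_EFinP; exact: measurable_kernel_density2.
by move=> p; rewrite lee_fin kernel_density_ge0.
Qed.

End kernel_gap.

(** * Limits in the rescaled chart *)

Section chart_limits.
Context {R : realType}.

(** Limits are taken along sequences, as dominated convergence takes them; [cvg_at_rightP] leads
    back to the one-sided limit. *)
Lemma is_derive_seq (f : R -> R) (df : R) (u : nat -> R) :
  is_derive (0 : R) 1 f df -> (forall k, u k != 0) -> u k @[k --> \oo] --> 0 ->
  (f (u k) - f 0) / u k @[k --> \oo] --> df.
Proof.
move=> [dervf valf] u0 ucvg.
have /cvgr_dnbhsP/(_ u) : (f h - f 0) / h @[h --> 0^'] --> df.
  rewrite -valf; apply: cvg_trans dervf; apply: near_eq_cvg; near=> h.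
  by rewrite /= addr0 [_%:A]mulr1 mulrC.
by apply; split.
Unshelve. all: by end_near. Qed.

Lemma sin_div_cvg (u : nat -> R) : (forall k, u k != 0) -> u k @[k --> \oo] --> 0 ->
  sin (u k) / u k @[k --> \oo] --> (1 : R).
Proof.
move=> u0 uc; have := is_derive_seq (is_derive_sin 0) u0 uc.
by rewrite sin0 cos0; under eq_fun do rewrite subr0.
Qed.

Lemma cos_div_cvg (u : nat -> R) : (forall k, u k != 0) -> u k @[k --> \oo] --> 0 ->
  (cos (u k) - 1) / u k @[k --> \oo] --> (0 : R).
Proof.
by move=> u0 uc; have := is_derive_seq (is_derive_cos 0) u0 uc; rewrite sin0 cos0 oppr0.
Qed.

Variable n : nat.
Hypothesis n_gt0 : (0 < n)%N.
Variables (u : nat -> R) (y : 'rV[R]_n.+1).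
Hypotheses (u0 : forall k, 0 < u k) (uc : u k @[k --> \oo] --> 0).
Let un0 k : u k != 0. Proof. by rewrite gt_eqF. Qed.

Lemma meridian_sub_div_cvg j :
  (val (meridian n (u k)) 0 j - val (pole n : @sphere R n) 0 j) / u k @[k --> \oo] -->
  (delta_mx 0 ord_max : 'rV[R]_n.+1) 0 j.
Proof.
have n0max : ((ord0 : 'I_n.+1) == ord_max) = false by rewrite -val_eqE/= ltn_eqF.
rewrite (_ : (fun k => _) = fun k => (cos (u k) - 1) / u k * (j == ord0)%:R +
    sin (u k) / u k * (j == ord_max)%:R); last first.
  apply/funext => k; rewrite val_meridian// !mxE !eqxx/=.
  by field.
rewrite mxE eqxx/=.
have ck : (cos (u k) - 1) / u k * (j == ord0)%:R @[k --> \oo] --> (0 * (j == ord0)%:R : R).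
  by apply: cvgMr_tmp; exact: cos_div_cvg.
have sk : sin (u k) / u k * (j == ord_max)%:R @[k --> \oo] --> (1 * (j == ord_max)%:R : R).
  by apply: cvgMr_tmp; exact: sin_div_cvg.
have := cvgD ck sk; rewrite mul0r mul1r add0r; exact.
Qed.

Hypothesis t0 : 0 < y 0 0.
Local Notation z k := (shrink (u k) y).

Lemma enorm_shrink_cvg : enorm (z k) @[k --> \oo] --> y 0 0.
Proof.
have -> : y 0 0 = enorm (rV_cons (y 0 0, 0 : 'rV[R]_n)).
  rewrite /enorm dot_rV_cons [X in _ + X](_ : _ = 0) ?addr0.
    by rewrite -expr2 sqrtr_sqr gtr0_norm.
  by rewrite -enormE enorm0 expr0n.
apply: cvg_enorm => j; rewrite !mxE.
rewrite (_ : (fun k => _) = fun k => if unlift ord0 j is Some i then u k * tail y 0 i else y 0 0).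
  case: (unlift ord0 j) => [i|]; last exact: cvg_cst.
  have -> : (0 : 'rV[R]_n) 0 i = 0 * tail y 0 i by rewrite mul0r mxE.
  by apply: cvgMr_tmp; exact: uc.
by apply/funext => k; rewrite mxE; case: unlift => // i; rewrite mxE.
Qed.

Lemma enorm_shrink_ge k : y 0 0 <= enorm (z k).
Proof.
apply: le_trans (ler_norm _) _.
by rewrite -{1}[y 0 0](head_rV_cons _ (u k *: tail y)); exact: coord_le_enorm.
Qed.

Let N_gt0 k : 0 < enorm (z k). Proof. exact: lt_le_trans t0 (enorm_shrink_ge k). Qed.

Lemma radial_sub_div_cvg j :
  (val (radial (z k)) 0 j - val (pole n : @sphere R n) 0 j) / u k @[k --> \oo] -->
  (rV_cons (0, (y 0 0)^-1 *: tail y) : 'rV[R]_n.+1) 0 j.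
Proof.
have Nc := enorm_shrink_cvg.
have NV : (enorm (z k))^-1 @[k --> \oo] --> (y 0 0)^-1 by apply: cvgV => //; exact: lt0r_neq0.
(* In a tangential coordinate the factor u cancels exactly. Along the pole the deviation is y00 /
   |z| - 1, rationalised through y00^2 - |z|^2 = - u^2 |tail y|^2; it is of second order in u. *)
rewrite (_ : (fun k => _) = fun k => if unlift ord0 j is Some i then
    (enorm (z k))^-1 * tail y 0 i
  else - (u k * enorm (tail y) ^+ 2 * ((y 0 0 + enorm (z k)) * enorm (z k))^-1)); last first.
  apply/funext => k; rewrite val_radial -?enorm_gt0// !mxE eqxx/=.
  case: (unliftP ord0 j) => [i ->|->]; rewrite ?liftK ?unlift_none /=.
    by rewrite subr0 mxE; field; rewrite un0 gt_eqF.
  have N0 := N_gt0 k; have E := enorm_shrink (u k) y.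
  have N1 : enorm (z k) != 0 by rewrite gt_eqF.
  have N2 : y 0 0 + enorm (z k) != 0 by rewrite gt_eqF// addr_gt0.
  have -> : (enorm (z k))^-1 * y 0 0 - 1 =
      (y 0 0 ^+ 2 - enorm (z k) ^+ 2) / ((y 0 0 + enorm (z k)) * enorm (z k)).
    by field; rewrite N1 N2.
  by rewrite E; field; rewrite -/(shrink (u k) y) N1 N2 un0.
rewrite mxE; case: (unlift ord0 j) => [i|].
  have -> : ((y 0 0)^-1 *: tail y) 0 i = (y 0 0)^-1 * tail y 0 i by rewrite mxE.
  by apply: cvgMr_tmp; exact: NV.
have -> : (0 : measurableTypeR R) =
    - (0 * enorm (tail y) ^+ 2 * ((y 0 0 + y 0 0) * y 0 0)^-1) by rewrite !mul0r oppr0.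
have c1 : u k * enorm (tail y) ^+ 2 @[k --> \oo] --> (0 * enorm (tail y) ^+ 2 : R).
  by apply: cvgMr_tmp; exact: uc.
have c2 : y 0 0 + enorm (z k) @[k --> \oo] --> (y 0 0 + y 0 0 : R).
  by apply: (@cvgD _ R^o) => //; exact: cvg_cst.
have c3 : (y 0 0 + enorm (z k)) * enorm (z k) @[k --> \oo] --> ((y 0 0 + y 0 0) * y 0 0 : R) by exact: cvgM c2 Nc.
have c4 : ((y 0 0 + enorm (z k)) * enorm (z k))^-1 @[k --> \oo] --> (((y 0 0 + y 0 0) * y 0 0)^-1 : R).
  by apply: cvgV c3; rewrite mulf_neq0 ?gt_eqF ?addr_gt0.
have c5 : u k * enorm (tail y) ^+ 2 * ((y 0 0 + enorm (z k)) * enorm (z k))^-1 @[k --> \oo] -->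
   (0 * enorm (tail y) ^+ 2 * ((y 0 0 + y 0 0) * y 0 0)^-1 : R) by exact: cvgM c1 c4.
exact: (@cvgN _ R^o).
Qed.

Lemma gdist_pole_cvg : gdist (radial (z k)) (pole n) / u k @[k --> \oo] -->
  enorm (rV_cons (0, (y 0 0)^-1 *: tail y) : 'rV[R]_n.+1).
Proof.
by apply: gdist_cvg; [exact: nearW|exact: uc|exact: radial_sub_div_cvg].
Qed.

Lemma gdist_meridian_cvg : gdist (radial (z k)) (meridian n (u k)) / u k @[k --> \oo] -->
  enorm (rV_cons (0, (y 0 0)^-1 *: tail y) - delta_mx 0 ord_max : 'rV[R]_n.+1).
Proof.
apply: gdist_cvg; [exact: nearW|exact: uc|] => j.
have -> : (rV_cons (0, (y 0 0)^-1 *: tail y) - delta_mx 0 ord_max : 'rV[R]_n.+1) 0 j =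
    (rV_cons (0, (y 0 0)^-1 *: tail y) : 'rV[R]_n.+1) 0 j - (delta_mx 0 ord_max : 'rV[R]_n.+1) 0 j.
  by rewrite mxE [X in _ + X]mxE.
rewrite (_ : (fun k => _) = fun k =>
    (val (radial (z k)) 0 j - val (pole n : @sphere R n) 0 j) / u k -
    (val (meridian n (u k)) 0 j - val (pole n : @sphere R n) 0 j) / u k); last first.
  by apply/funext => k; ring.
exact: cvgB (@radial_sub_div_cvg j) (@meridian_sub_div_cvg j).
Qed.

End chart_limits.

Lemma Rintegral_dominated_cvg {R : realType} d (T : measurableType d)
    (mu : {measure set T -> \bar R}) (f_ : nat -> T -> R) (f g : T -> R) :
  (forall k, measurable_fun setT (f_ k)) -> measurable_fun setT f ->
  mu.-integrable setT (EFin \o g) ->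
  {ae mu, forall x, f_ k x @[k --> \oo] --> f x} ->
  {ae mu, forall x k, `|f_ k x| <= g x} ->
  \int[mu]_x f_ k x @[k --> \oo] --> \int[mu]_x f x.
Proof.
move=> mf_ mf ig cf fg.
have ae_lim : {ae mu, forall x, setT x -> (fun k => (EFin \o f_ k) x) @ \oo --> (EFin \o f) x}.
  by apply: filterS cf => x cx _; apply: cvg_EFin; [exact: nearW|exact: cx].
have ae_dom : {ae mu, forall x k, setT x -> (`|(EFin \o f_ k) x| <= (EFin \o g) x)%E}.
  by apply: filterS fg => x h k _; rewrite /= lee_fin.
have [fi _ fc] := @dominated_convergence _ _ _ mu setT measurableT
  (fun k => EFin \o f_ k) (EFin \o f) (EFin \o g)
  (fun k => proj2 (measurable_EFinP _ _) (mf_ k)) (proj2 (measurable_EFinP _ _) mf)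
  ae_lim ig ae_dom.
apply: fine_cvg; rewrite fineK; first exact: fc.
exact: integrable_fin_num.
Qed.

Lemma cvg_maxr {R : realType} I (F : set_system I) {FF : Filter F} (f g : I -> R) (a b : R) :
  f i @[i --> F] --> a -> g i @[i --> F] --> b ->
  Num.max (f i) (g i) @[i --> F] --> Num.max a b.
Proof.
move=> fa gb.
exact: (@continuous2_cvg I R R R F FF f g Num.max a b (@max_continuous _ R (a, b)) fa gb).
Qed.

Lemma pihalf_le_gdist {R : realType} n (x y : @sphere R n) :
  dot (val x) (val y) <= 0 -> pi / 2 <= gdist x y.
Proof.
move=> d0; rewrite leNgt; apply/negP => dlt.
have : 0 < cos (gdist x y).
  apply: cos_gt0_pihalf; rewrite dlt andbT; apply: lt_le_trans (gdist_ge0 x y).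
  by rewrite oppr_lt0 divr_gt0// pi_gt0.
by rewrite cos_gdist ltNge d0.
Qed.

(** * Existence of K_2 *)

Section gap_limit.
Context {R : realType}.
Variables (n : nat) (H : R).
Hypothesis n_gt0 : (0 < n)%N.
Hypotheses (H_gt0 : 0 < H) (H_lt : H < 2^-1).
Local Notation lebn := (@lebesgue_rV R n.+1).
Local Notation PB := (@punctured_ball R n.+1).
Local Notation a := (n%:R - 2 * H).
Implicit Types (y : 'rV[R]_n.+1).

Let n1 : 1 <= n%:R :> R. Proof. by rewrite ler1n. Qed.
Let a0 : 0 < a. Proof. by move: n1 H_lt; lra. Qed.

(* On 0 < y 0 0, [y 0 0 `^ (-1)] is the inverse, in a form known to be measurable. *)
Definition slope y : 'rV[R]_n.+1 := rV_cons (0, y 0 0 `^ (-1) *: tail y).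

(** In the tangent space at the pole the rescaled points become [slope y], the origin and a unit
    vector. The shrunk ball fills a slab, whose lower half contributes nothing. *)
Definition gap_lim y : R := \1_(`]0%R, 1%R[%classic) (y 0 0) *
  (a^-1 * (enorm (slope y) `^ (- a) -
    Num.max (enorm (slope y)) (enorm (slope y - delta_mx 0 ord_max)) `^ (- a))).

Lemma measurable_slope : measurable_fun setT slope.
Proof.
have m00 : measurable_fun setT (fun y => y 0 0 `^ (-1)).
  exact: (measurableT_comp (@measurable_powR_fun R _) (@measurable_mx_coord R 1 n.+1 0 0)).
apply: (measurableT_comp (@measurable_rV_cons R n)).
apply: measurable_fun_pair; first exact: measurable_cst.
apply: measurable_fun_mx => i j; under eq_fun do rewrite mxE.
apply: measurable_funM => //.
exact: (measurableT_comp (@measurable_mx_coord R 1 n i j) measurable_tail).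
Qed.

Lemma measurable_gap_lim : measurable_fun setT gap_lim.
Proof.
have ms := measurableT_comp (@measurable_enorm R n.+1) measurable_slope.
have msd : measurable_fun setT (fun y => enorm (slope y - delta_mx 0 ord_max)).
  apply: (measurableT_comp (@measurable_enorm R n.+1)).
  apply: measurable_fun_mx => i j; under eq_fun do rewrite mxE.
  apply: measurable_funD; last exact: measurable_cst.
  exact: (measurableT_comp (@measurable_mx_coord R 1 n.+1 i j) measurable_slope).
apply: measurable_funM.
  by apply: (measurableT_comp _ (@measurable_mx_coord R 1 n.+1 0 0)); exact: measurable_indic.
apply: measurable_funM => //; apply: measurable_funB.
  exact: (measurableT_comp (@measurable_powR_fun R _) ms).
exact: (measurableT_comp (@measurable_powR_fun R _) (measurable_maxr ms msd)).
Qed.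

Lemma mulr_powRN_div (u x : R) : 0 < u -> 0 <= x -> u `^ a * x `^ (- a) = (x / u) `^ (- a).
Proof.
move=> u0 x0; rewrite powRM ?invr_ge0 ?(ltW u0)// mulrC -[u^-1]powR_inv1 ?(ltW u0)//.
by rewrite -powRrM mulN1r opprK.
Qed.

Lemma kernel_density_out v y : ~ PB y -> kernel_density H v y = 0.
Proof. by move=> yPB; rewrite /kernel_density (indicE _ PB) memNset// mul0r. Qed.

Lemma kernel_density_in v y : PB y -> kernel_density H v y = a^-1 * farther v y `^ (- a).
Proof. by move=> yPB; rewrite /kernel_density (indicE _ PB) mem_set// mul1r. Qed.

Lemma gap_out u y : ~ PB (shrink u y) -> gap H u y = 0.
Proof.
move=> yPB.
by rewrite /gap (kernel_density_out 0 yPB) (kernel_density_out u yPB) subr0 mulr0.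
Qed.

Lemma gap_in u y : 0 < u -> PB (shrink u y) -> gap H u y =
  a^-1 * ((farther 0 (shrink u y) / u) `^ (- a) - (farther u (shrink u y) / u) `^ (- a)).
Proof.
move=> u0 yPB; rewrite /gap (kernel_density_in 0 yPB) (kernel_density_in u yPB).
have := farther_ge0 0 (shrink u y); have := farther_ge0 u (shrink u y).
move: (farther _ _) (farther _ _) => s m s0 m0.
by rewrite -mulrBr mulrCA mulrBr !mulr_powRN_div.
Qed.

(** In the half-space opposite to the pole all distances to it are at least pi / 2 >= 1, away from
    the singularity. *)
Lemma kernel_density_le_opposite v y : y 0 0 <= 0 -> kernel_density H v y <= a^-1.
Proof.
move=> y00; have [yPB|yPB] := pselect (PB y); last first.
  by rewrite (kernel_density_out v yPB) invr_ge0 ltW.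
rewrite (kernel_density_in v yPB) ler_piMr ?invr_ge0 ?(ltW a0)//.
apply: (@le_trans _ _ (1 `^ (- a))); last by rewrite powR1.
apply: (powRN_anti ltr01 _ (ltW a0)).
apply: (@le_trans _ _ (pi / 2)); first by rewrite ler_pdivlMr// mul1r pi_ge2.
rewrite le_max; apply/orP; left; apply: pihalf_le_gdist.
have /andP[N0 _] := yPB.
rewrite val_radial -?enorm_gt0// dotZl pmulr_rle0 ?invr_gt0//.
rewrite /dot big_ord_recl big1 => [|j _]; first by rewrite addr0 mxE !eqxx mulr1.
by rewrite [X in _ * X]mxE /= mulr0.
Qed.

Lemma gap_cvg (u : nat -> R) y : (forall k, 0 < u k) -> u k @[k --> \oo] --> 0 ->
  (forall i, y 0 i != 0) -> gap H (u k) y @[k --> \oo] --> gap_lim y.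
Proof.
move=> u0 uc y0.
have t0 : 0 < enorm (tail y).
  rewrite enorm_gt0; apply/eqP => /rowP/(_ (Ordinal n_gt0))/eqP.
  by rewrite [X in _ == X]mxE mxE (negbTE (y0 _)).
rewrite /gap_lim indicE.
(* For y00 < 0 both kernels lie between 0 and 1 / a, so the gap is at most u^a / a, which tends to
   0. *)
have [y00|y00] := ltP (y 0 0) 0.
  rewrite memNset ?mul0r; last by rewrite /= in_itv/= ltNge (ltW y00).
  apply/norm_cvg0P.
  have ua : u k `^ a @[k --> \oo] --> 0.
    by have /cvg_at_rightP/(_ u) := powR_cvg0 a0; apply; split.
  have uaa : a^-1 * u k `^ a @[k --> \oo] --> (0 : R).
    by rewrite -(mulr0 a^-1); exact: cvgMl_tmp.
  apply: (@squeeze_cvgr _ _ _ _ (cst 0) (fun k => a^-1 * u k `^ a)) => //; last exact: cvg_cst.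
  apply: nearW => k; rewrite normr_ge0/= /gap normrM ger0_norm ?powR_ge0// mulrC.
  rewrite ler_wpM2r ?powR_ge0//.
  have z0 : shrink (u k) y 0 0 <= 0 by rewrite head_rV_cons ltW.
  have h0 := kernel_density_le_opposite 0 z0; have h1 := kernel_density_le_opposite (u k) z0.
  have g0 := kernel_density_ge0 0 (shrink (u k) y) a0.
  have g1 := kernel_density_ge0 (u k) (shrink (u k) y) a0.
  rewrite ler_norml; apply/andP; split.
    by rewrite lerBrDr (le_trans _ g0)// addrC subr_le0.
  by rewrite lerBlDr (le_trans h0)// lerDl.
have {y00} y00 : 0 < y 0 0 by rewrite lt_neqAle eq_sym y0.
have zN k : 0 < enorm (shrink (u k) y) by exact: lt_le_trans y00 (enorm_shrink_ge u y k).
(* For y00 >= 1 the nonzero tail pushes the shrunk point outside the unit ball for every u. *)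
have [y1|y1] := leP 1 (y 0 0).
  rewrite memNset ?mul0r; last by rewrite /= in_itv/= y00/= ltNge y1.
  rewrite (_ : (fun k => _) = cst 0); first exact: cvg_cst.
  apply/funext => k; apply: gap_out.
  move=> /andP[_]; apply/negP; rewrite -ltNge -(@ltr_pXn2r _ 2) ?nnegrE ?enorm_ge0// enorm_shrink.
  rewrite expr1n; apply: (@lt_le_trans _ _ (1 + u k ^+ 2 * enorm (tail y) ^+ 2)).
    by rewrite ltrDl mulr_gt0// exprn_gt0.
  by rewrite lerD2r exprn_ege1.
rewrite mem_set ?mul1r; last by rewrite /= in_itv/= y00.
have Pc := gdist_pole_cvg u0 uc y00.
have Mc := gdist_meridian_cvg n_gt0 u0 uc y00.
have sE : slope y = rV_cons (0, (y 0 0)^-1 *: tail y) by rewrite /slope powR_inv1// ltW.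
rewrite -sE in Pc Mc.
have s0 : 0 < enorm (slope y).
  apply: lt_le_trans (enorm_tail_le _).
  by rewrite sE tail_rV_cons enormZ mulr_gt0// normr_gt0 invr_eq0 gt_eqF.
have PBz : \forall k \near \oo, PB (shrink (u k) y).
  near=> k; have zk : enorm (shrink (u k) y) < 1.
    by near: k; exact: (cvgr_lt _ (enorm_shrink_cvg uc y00) _ y1).
  by rewrite /punctured_ball/= zN ltW.
have c0 : farther 0 (shrink (u k) y) / u k @[k --> \oo] --> enorm (slope y).
  by under eq_fun do rewrite (farther0 n_gt0).
have c1 : farther (u k) (shrink (u k) y) / u k @[k --> \oo] -->
    Num.max (enorm (slope y)) (enorm (slope y - delta_mx 0 ord_max)).
  under eq_fun do rewrite /farther maxr_pMl ?invr_ge0 ?(ltW (u0 _))//.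
  exact: cvg_maxr.
set M := Num.max _ _ in c1 *.
have M0 : 0 < M by rewrite lt_max s0.
have d0 := cvg_comp _ _ c0 (continuous_powR (p := - a) s0).
have d1 := cvg_comp _ _ c1 (continuous_powR (p := - a) M0).
have d2 : (farther 0 (shrink (u k) y) / u k) `^ (- a) -
    (farther (u k) (shrink (u k) y) / u k) `^ (- a) @[k --> \oo] -->
    (enorm (slope y) `^ (- a) - M `^ (- a) : R) by apply: cvgB; [exact: d0|exact: d1].
have d := cvgMl_tmp (a := a^-1) d2.
apply: cvg_trans (d _); apply: near_eq_cvg; apply: filterS PBz => k zk.
by rewrite (gap_in (u0 k) zk).
Unshelve. all: by end_near. Qed.

Lemma KH_gap_cvg : (fun u => u `^ (- (2 * H)) * (KH n H 0 - KH n H u)) u @[u --> 0^'+] -->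
  n.+1%:R * \int[lebn]_y gap_lim y.
Proof.
apply/cvg_at_rightP => u [u0 uc].
have -> : (fun k => u k `^ (- (2 * H)) * (KH n H 0 - KH n H (u k))) =
    (fun k => n.+1%:R * \int[lebn]_y gap H (u k) y).
  apply/funext => k; rewrite (KH_gapE n_gt0 H_gt0 H_lt (u0 k)) mulrA -powRD.
    by rewrite addNr powRr0 mul1r.
  by rewrite (gt_eqF (u0 k)) implybT.
apply: cvgMl_tmp.
apply: (@Rintegral_dominated_cvg _ _ _ lebn (fun k => gap H (u k)) gap_lim (gap_dom H)).
- by move=> k; exact: measurable_gap.
- exact: measurable_gap_lim.
- exact: gap_dom_integrable.
- by apply: filterS (@ae_coord_neq0 R n.+1) => y y0; exact: gap_cvg.
- by apply: filterS (@ae_coord_neq0 R n.+1) => y y0 k; exact: gap_le_dom.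
Qed.

Lemma K2_cvg : (fun u => u `^ (- (2 * H)) * (KH n H 0 - KH n H u)) u @[u --> 0^'+] --> K2 n H.
Proof. by have c := KH_gap_cvg; rewrite /K2 (cvg_lim _ c). Qed.

End gap_limit.

(** * Signed measures *)

Section signed_product.
Context {R : realType} d1 d2 (T1 : measurableType d1) (T2 : measurableType d2).
Local Open Scope ereal_scope.

(** Equality of two differences of measures, written additively so that it makes sense for
    nonnegative integrals that may be infinite. *)
Lemma ge0_integral_measure_eqD d (T : measurableType d)
    (m1 m2 m3 m4 : {measure set T -> \bar R}) (f : T -> \bar R) :
  (forall A, measurable A -> m1 A + m2 A = m3 A + m4 A) ->
  measurable_fun setT f -> (forall x, 0 <= f x) ->
  \int[m1]_x f x + \int[m2]_x f x = \int[m3]_x f x + \int[m4]_x f x.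
Proof.
move=> mE mf f0; rewrite -!ge0_integral_measure_add//.
apply: eq_measure_integral => A mA _.
exact: etrans (measure_addE m1 m2 A) (etrans (mE A mA) (esym (measure_addE m3 m4 A))).
Qed.

Lemma ge0_integral_productl (m1 m2 m3 m4 : {finite_measure set T1 -> \bar R})
    (n : {finite_measure set T2 -> \bar R}) (f : T1 * T2 -> \bar R) :
  (forall A, measurable A -> m1 A + m2 A = m3 A + m4 A) ->
  measurable_fun setT f -> (forall x, 0 <= f x) ->
  \int[m1 \x n]_x f x + \int[m2 \x n]_x f x = \int[m3 \x n]_x f x + \int[m4 \x n]_x f x.
Proof.
move=> mE mf f0; rewrite !fubini_tonelli1//; apply: ge0_integral_measure_eqD => //.
- exact: (measurable_fun_fubini_tonelli_F (m2 := n) f mf f0).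
- by move=> x; apply: integral_ge0 => y _; exact: f0.
Qed.

Lemma ge0_integral_productr (m : {finite_measure set T1 -> \bar R})
    (n1 n2 n3 n4 : {finite_measure set T2 -> \bar R}) (f : T1 * T2 -> \bar R) :
  (forall A, measurable A -> n1 A + n2 A = n3 A + n4 A) ->
  measurable_fun setT f -> (forall x, 0 <= f x) ->
  \int[m \x n1]_x f x + \int[m \x n2]_x f x = \int[m \x n3]_x f x + \int[m \x n4]_x f x.
Proof.
move=> mE mf f0; rewrite !fubini_tonelli1// !fubini_tonelli//.
apply: ge0_integral_measure_eqD => //.
- exact: (measurable_fun_fubini_tonelli_G (m1 := m) f mf f0).
- by move=> x; apply: integral_ge0 => y _; exact: f0.
Qed.

(* Any decomposition, not only the Jordan one: image measures of the Jordan parts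
   need not be mutually singular. *)
Definition charge_diff d (T : measurableType d) (mu : {charge set T -> \bar R})
    (m1 m2 : {finite_measure set T -> \bar R}) : Prop :=
  forall A, measurable A -> mu A = m1 A - m2 A.

Lemma charge_diff_jordan d (T : measurableType d) (mu : {charge set T -> \bar R}) :
  charge_diff mu (charge_pos mu) (charge_neg mu).
Proof.
move=> A mA; rewrite [LHS](jordan_decomp (svalP (cid (svalP (cid (Hahn_decomposition mu))))) mA).
by rewrite /cadd/= cscaleN1.
Qed.

Lemma charge_diff_eqD d (T : measurableType d) (mu : {charge set T -> \bar R})
    (m1 m2 n1 n2 : {finite_measure set T -> \bar R}) :
  charge_diff mu m1 m2 -> charge_diff mu n1 n2 ->
  forall A, measurable A -> m1 A + n2 A = n1 A + m2 A.
Proof.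
move=> d1' d2' A mA.
have := d1' A mA; rewrite (d2' A mA).
have [] : [/\ m1 A \is a fin_num, m2 A \is a fin_num, n1 A \is a fin_num & n2 A \is a fin_num].
  by split; exact: fin_num_measure.
move: (m1 A) (m2 A) (n1 A) (n2 A) => [a| |] [b| |] [c| |] [e| |]//= _ _ _ _ [h].
by congr EFin; lra.
Qed.

Local Close Scope ereal_scope.

Lemma Rintegral_fineE d (T : measurableType d) (m : {measure set T -> \bar R}) (f : T -> R) :
  m.-integrable setT (EFin \o f) -> (\int[m]_x f x)%:E = (\int[m]_x (f x)%:E)%E.
Proof. by move=> fi; rewrite /Rintegral fineK// integrable_fin_num. Qed.

Lemma bounded_product_integrable (m : {finite_measure set T1 -> \bar R})
    (n : {finite_measure set T2 -> \bar R}) (f : T1 * T2 -> R) (M : R) :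
  measurable_fun setT f -> (forall x, `|f x| <= M) ->
  (m \x n)%E.-integrable setT (EFin \o f).
Proof.
move=> mf fM; apply: measurable_bounded_integrable => //.
  apply: (@le_lt_trans _ _ (m setT * n setT)%E).
    by rewrite -(product_measure1E m n measurableT measurableT) setXTT.
  by rewrite lte_mul_pinfty// ?ltey_eq fin_num_measure.
by exists M; split; [exact: num_real|move=> N MN w _ /=; exact: le_trans (fM w) (ltW MN)].
Qed.

(** Two decompositions of a charge satisfy an additive identity, so the Jordan parts can be
    exchanged for the given ones in one factor at a time. Boundedness of f makes the four integrals
    finite, hence subtractable. *)
Lemma charge_integral2_diff (mu : {charge set T1 -> \bar R}) (nu : {charge set T2 -> \bar R})
    (m1 m2 : {finite_measure set T1 -> \bar R}) (n1 n2 : {finite_measure set T2 -> \bar R})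
    (f : T1 * T2 -> R) (M : R) :
  charge_diff mu m1 m2 -> charge_diff nu n1 n2 ->
  measurable_fun setT f -> (forall x, 0 <= f x <= M) ->
  charge_integral2 mu nu f =
    \int[(m1 \x n1)%E]_x f x - \int[(m1 \x n2)%E]_x f x
    - \int[(m2 \x n1)%E]_x f x + \int[(m2 \x n2)%E]_x f x.
Proof.
move=> dmu dnu mf fM.
have mE := charge_diff_eqD dmu (@charge_diff_jordan _ _ mu).
have nE := charge_diff_eqD dnu (@charge_diff_jordan _ _ nu).
have mf' : measurable_fun setT (EFin \o f) by exact/measurable_EFinP.
have f0 x : (0 <= (EFin \o f) x)%E by rewrite lee_fin; have /andP[] := fM x.
have fi (m : {finite_measure set T1 -> \bar R}) (n : {finite_measure set T2 -> \bar R}) :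
    (m \x n)%E.-integrable setT (EFin \o f).
  apply: (@bounded_product_integrable _ _ _ M) => // x.
  by have /andP[a b] := fM x; rewrite ger0_norm.
have L (n : {finite_measure set T2 -> \bar R}) : \int[(m1 \x n)%E]_x f x + \int[(charge_neg mu \x n)%E]_x f x =
    \int[(charge_pos mu \x n)%E]_x f x + \int[(m2 \x n)%E]_x f x.
  apply: EFin_inj; rewrite !EFinD !(Rintegral_fineE (fi _ _)).
  exact: ge0_integral_productl.
have Rr (m : {finite_measure set T1 -> \bar R}) : \int[(m \x n1)%E]_x f x + \int[(m \x charge_neg nu)%E]_x f x =
    \int[(m \x charge_pos nu)%E]_x f x + \int[(m \x n2)%E]_x f x.
  apply: EFin_inj; rewrite !EFinD !(Rintegral_fineE (fi _ _)).
  exact: ge0_integral_productr.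
have alg (a b c e a' b' c' e' s1 s2 s3 s4 : R) : a' + c = a + c' -> b' + e = b + e' ->
    s1 + b' = a' + s2 -> s3 + e' = c' + s4 -> a - b - c + e = s1 - s2 - s3 + s4.
  by lra.
exact: (alg _ _ _ _ _ _ _ _ _ _ _ _ (L _) (L _) (Rr m1) (Rr m2)).
Qed.

End signed_product.

Section restricted_pushforward.
Context {R : realType} d d' (T : measurableType d) (T' : measurableType d').
Variables (D : set T) (mD : measurable D) (phi : T -> T') (mphi : measurable_fun setT phi).

(* The measurability proof is an argument so that the measure structure can be
   inferred. *)
Definition restr_pushforward (_ : measurable_fun setT phi)
    (m : {finite_measure set T -> \bar R}) : set T' -> \bar R :=
  pushforward (mrestr m mD) phi.

Local Notation restr_push := (restr_pushforward mphi).

Section instances.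
Variable m : {finite_measure set T -> \bar R}.

HB.instance Definition _ := Measure.copy (restr_push m)
  (measure_function_pushforward__canonical__measure_function_Measure (mrestr m mD) mphi).

Let restr_push_fin : fin_num_fun (restr_push m).
Proof.
move=> C mC; rewrite /restr_pushforward /pushforward /mrestr fin_num_measure//.
by apply: measurableI => //; rewrite -[X in measurable X]setTI; exact: mphi.
Qed.

HB.instance Definition _ := @Measure_isFinite.Build _ _ _ (restr_push m) restr_push_fin.

End instances.

Lemma ge0_integral_restr_push (m : {finite_measure set T -> \bar R}) (f : T' -> \bar R) :
  measurable_fun setT f -> (forall x, 0 <= f x)%E ->
  (\int[restr_push m]_y f y = \int[m]_x ((\1_D x)%:E * f (phi x)))%E.
Proof.
move=> mf f0.
have mfp : measurable_fun setT (f \o phi) by exact: measurableT_comp.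
transitivity (\int[mrestr m mD]_x (f \o phi) x)%E.
  exact: (@ge0_integral_pushforward _ _ _ _ _ _ mphi _ setT f measurableT mf (fun y _ => f0 y)).
rewrite ge0_integral_mrestr//; last by move=> x; exact: f0.
rewrite integral_mkcond; apply: eq_integral => x _.
by rewrite patchE indicE; case: ifP => _; rewrite ?mul1e ?mul0e.
Qed.

Lemma ge0_integral_restr_push2 (m m' : {finite_measure set T -> \bar R}) (f : T' * T' -> R) :
  measurable_fun setT f -> (forall x, 0 <= f x) ->
  (\int[restr_push m \x restr_push m']_y (f y)%:E =
   \int[m \x m']_x (\1_D x.1 * \1_D x.2 * f (phi x.1, phi x.2))%:E)%E.
Proof.
move=> mf f0.
have mf' : measurable_fun setT (EFin \o f) by exact/measurable_EFinP.
have f0' x : (0 <= (EFin \o f) x)%E by rewrite lee_fin.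
pose g (x : T * T) := \1_D x.1 * \1_D x.2 * f (phi x.1, phi x.2).
have mg : measurable_fun setT (EFin \o g).
  apply/measurable_EFinP; apply: measurable_funM.
    by apply: measurable_funM; apply: (measurableT_comp (measurable_indic mD)).
  apply: (measurableT_comp mf).
  by apply: measurable_fun_pair; apply: (measurableT_comp mphi).
have g0 x : (0 <= (EFin \o g) x)%E by rewrite lee_fin mulr_ge0 ?f0// mulr_ge0.
rewrite (fubini_tonelli1 (EFin \o f) mf' f0') (fubini_tonelli1 (EFin \o g) mg g0).
have mF := measurable_fun_fubini_tonelli_F (m2 := restr_push m') _ mf' f0'.
have F0 x : (0 <= \int[restr_push m']_y (EFin \o f) (x, y))%E.
  by apply: integral_ge0 => y _; exact: f0'.
apply: (etrans (ge0_integral_restr_push m mF F0)).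
apply: eq_integral => x _.
have mfx : measurable_fun setT (fun y => (f (phi x, y))%:E).
  exact: (measurableT_comp mf' (measurable_pair1 _)).
apply: (etrans (congr1 (mule _) (ge0_integral_restr_push m' mfx (fun y => f0' _)))).
rewrite -ge0_integralZl//.
- by apply: eq_integral => y _; rewrite /g/= -!EFinM; congr EFin; ring.
- apply: emeasurable_funM.
    by apply/measurable_EFinP; exact: measurable_indic.
  exact: (measurableT_comp mfx mphi).
- by move=> y _; rewrite mule_ge0// lee_fin.
Qed.

End restricted_pushforward.

Section exponential_chart.
Context {R : realType} (n : nat) (A : @sphere R n) (J : tangent_frame A) (delta e : R).

Definition dilated_exp (x : 'rV[R]_n) : @sphere R n := sphere_exp J (e *: x).

Definition dilated_ball : set 'rV[R]_n := [set x | enorm (e *: x) < delta].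

Lemma measurable_dilated_exp : measurable_fun setT dilated_exp.
Proof. exact: (measurableT_comp (measurable_sphere_exp J) (measurable_scale e)). Qed.

Lemma measurable_dilated_ball : measurable dilated_ball.
Proof.
have := measurable_scale e measurableT (measurable_eball (n := n) delta).
by rewrite setTI.
Qed.

Lemma charge_diff_exp_pushforward (tau : {charge set 'rV[R]_n -> \bar R}) :
  charge_diff (exp_pushforward J delta (dilate tau e))
    (restr_pushforward measurable_dilated_ball measurable_dilated_exp (charge_pos tau))
    (restr_pushforward measurable_dilated_ball measurable_dilated_exp (charge_neg tau)).
Proof.
move=> C mC; apply: (charge_diff_jordan tau).
apply: measurableI; last exact: measurable_dilated_ball.
by rewrite -[X in measurable X]setTI; exact: measurable_dilated_exp.
Qed.

End exponential_chart.

(** x + y is at most twice the larger of the two. *)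
Lemma powRD_le {R : realType} (p x y : R) : 0 <= p -> 0 <= x -> 0 <= y ->
  (x + y) `^ p <= 2 `^ p * (x `^ p + y `^ p).
Proof.
move=> p0; wlog xy : x y / x <= y => [h x0 y0|x0 y0].
  by have [xy|/ltW yx] := leP x y; [exact: h|rewrite addrC [X in _ * X]addrC; exact: h].
apply: (@le_trans _ _ ((2 * y) `^ p)).
  apply: ge0_ler_powR => //; rewrite ?nnegrE ?addr_ge0 ?mulr_ge0//.
  by rewrite mulr_natl mulr2n lerD2r.
by rewrite powRM// ler_wpM2l ?powR_ge0// lerDr powR_ge0.
Qed.

(** * Moments of order 2H *)

Section moments.
Context {R : realType} (n : nat) (H : R).
Hypothesis H_gt0 : 0 < H.
Local Notation p := (2 * H).
Implicit Types tau : {charge set 'rV[R]_n -> \bar R}.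

Let p0 : 0 <= p. Proof. by rewrite mulr_ge0// ltW. Qed.

Lemma measurable_enorm_powR : measurable_fun setT (fun x : 'rV[R]_n => enorm x `^ p).
Proof. exact: (measurableT_comp (@measurable_powR_fun R p) (@measurable_enorm R n)). Qed.

Lemma measurable_enormB :
  measurable_fun setT (fun x : 'rV[R]_n * 'rV[R]_n => enorm (x.1 - x.2)).
Proof.
apply: (measurableT_comp (@measurable_enorm R n)).
apply: measurable_fun_mx => i j; under eq_fun do rewrite mxE [X in _ + X]mxE.
apply: measurable_funB.
  exact: (measurableT_comp (@measurable_mx_coord R 1 n i j) measurable_fst).
exact: (measurableT_comp (@measurable_mx_coord R 1 n i j) measurable_snd).
Qed.

Lemma measurable_enormB_powR :
  measurable_fun setT (fun x : 'rV[R]_n * 'rV[R]_n => enorm (x.1 - x.2) `^ p).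
Proof. exact: (measurableT_comp (@measurable_powR_fun R p) measurable_enormB). Qed.

(* By Tonelli, some x has a finite integral of |x - y|^(2H) in d|tau|(y), and
   |y| <= |x - y| + |x|. *)
Lemma in_MH_moment tau : in_MH H tau ->
  (\int[charge_var tau]_y (enorm y `^ p)%:E < +oo)%E.
Proof.
move=> [_]; set F := fun x : 'rV[R]_n * 'rV[R]_n => (enorm (x.1 - x.2) `^ p)%:E.
have mF : measurable_fun setT F by apply/measurable_EFinP; exact: measurable_enormB_powR.
have F0 x : (0 <= F x)%E by rewrite lee_fin powR_ge0.
have mE : measurable_fun setT (fun y : 'rV[R]_n => (enorm y `^ p)%:E).
  by apply/measurable_EFinP; exact: measurable_enorm_powR.
have fV : (charge_var tau setT < +oo)%E by rewrite ltey_eq fin_num_measure.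
rewrite (fubini_tonelli1 F mF F0) /fubini_F => Ifin.
(* For a null variation measure the choice of x below would fail: an infinite inner integral would
   contradict nothing. *)
have [V0|V0] := eqVneq (charge_var tau setT) 0%E.
  by rewrite null_set_integral// ltry.
have [x Ix] : exists x, (\int[charge_var tau]_y F (x, y) < +oo)%E.
  apply: contrapT => /forallNP nI; move: Ifin; apply/negP; rewrite -leNgt leye_eq.
  rewrite (eq_integral (cst +oo%E)) => [|x _]; last first.
    by apply/eqP; rewrite -leye_eq leNgt; apply/negP; exact: nI.
  by rewrite integral_cst// gt0_mulye// lt0e V0 measure_ge0.
have mFx : measurable_fun setT (fun y => F (x, y)).
  exact: (measurableT_comp mF (measurable_pair1 x)).
apply: (@le_lt_trans _ _ (\int[charge_var tau]_y
    ((2 `^ p)%:E * (F (x, y) + (enorm x `^ p)%:E)))%E).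
  apply: ge0_le_integral => //.
  - by move=> y _; rewrite lee_fin powR_ge0.
  - by apply: emeasurable_funM => //; exact: (emeasurable_funD mFx (measurable_cst _)).
  move=> y _; rewrite /F/= -EFinD -EFinM lee_fin.
  apply: le_trans (powRD_le p0 (enorm_ge0 _) (enorm_ge0 _)).
  apply: ge0_ler_powR; rewrite ?nnegrE ?addr_ge0 ?enorm_ge0//.
  by rewrite -(enormN (x - y)) (le_trans _ (ler_enormD _ _))// opprB subrK.
rewrite ge0_integralZl//; last 2 first.
- exact: (emeasurable_funD mFx (measurable_cst _)).
- by move=> y _; rewrite adde_ge0// lee_fin powR_ge0.
have c0 : (0 <= (enorm x `^ p)%:E)%E by rewrite lee_fin powR_ge0.
have E2 := ge0_integralD (charge_var tau) measurableT (fun y _ => F0 (x, y)) mFx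
  (fun _ _ => c0) (measurable_cst _).
have Ic : (\int[charge_var tau]_y F (x, y) +
    \int[charge_var tau]_(y in setT) cst (enorm x `^ p)%:E y < +oo)%E.
  apply: (lte_add_pinfty Ix); rewrite (integral_cst (charge_var tau) measurableT).
  by apply: lte_mul_pinfty.
apply: lte_mul_pinfty; [by rewrite lee_fin powR_ge0|by []|].
exact: (eq_ind_r (fun z => (z < +oo)%E) Ic E2).
Qed.

Lemma charge_var_integralE tau (f : 'rV[R]_n -> \bar R) :
  measurable_fun setT f -> (forall x, 0 <= f x)%E ->
  (\int[charge_var tau]_x f x = \int[charge_pos tau]_x f x + \int[charge_neg tau]_x f x)%E.
Proof.
move=> mf f0; rewrite -ge0_integral_measure_add//.
apply: eq_measure_integral => C mC _.
exact: esym (measure_addE (charge_pos tau) (charge_neg tau) C).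
Qed.

Lemma in_MH_integrable tau : in_MH H tau ->
  (charge_pos tau).-integrable setT (fun x => (enorm x `^ p)%:E) /\
  (charge_neg tau).-integrable setT (fun x => (enorm x `^ p)%:E).
Proof.
move=> /in_MH_moment.
have mE : measurable_fun setT (fun y : 'rV[R]_n => (enorm y `^ p)%:E).
  by apply/measurable_EFinP; exact: measurable_enorm_powR.
have E0 (y : 'rV[R]_n) : (0 <= (enorm y `^ p)%:E)%E by rewrite lee_fin powR_ge0.
rewrite (charge_var_integralE _ mE E0) => Ifin.
have I0 (m : {measure set 'rV[R]_n -> \bar R}) : (0 <= \int[m]_x (enorm x `^ p)%:E)%E.
  by apply: integral_ge0 => x _; exact: E0.
split; apply/integrableP; split => //; under eq_integral do rewrite gee0_abs ?E0//.
  by apply: le_lt_trans Ifin; rewrite leeDl.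
by apply: le_lt_trans Ifin; rewrite leeDr.
Qed.

End moments.

(** * Asymptotics of the covariance *)

Section exponential_asymptotics.
Context {R : realType} (n : nat) (A : @sphere R n) (J : tangent_frame A).
Implicit Types x y : 'rV[R]_n.

Lemma enorm_frame y : enorm (y *m J) = enorm y.
Proof.
by rewrite /enorm dotE trmx_mul -mulmxA [X in _ *m X]mulmxA frame_orthonormal mul1mx -dotE.
Qed.

Lemma val_sphere_exp y : val (sphere_exp J y) =
  cos (enorm y) *: val A + (sin (enorm y) / enorm y) *: (y *m J).
Proof. by []. Qed.

Lemma sphere_exp_coord y j : val (sphere_exp J y) 0 j =
  cos (enorm y) * val A 0 j + sin (enorm y) / enorm y * (y *m J) 0 j.
Proof. by rewrite val_sphere_exp mxE [X in X + _]mxE [X in _ + X]mxE. Qed.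

(** Equality holds up to norm pi; past it the geodesic is no longer minimal, but distances are at
    most pi. *)
Lemma gdist_sphere_exp_base y : gdist (sphere_exp J y) A <= enorm y.
Proof.
have [y0|y0] := leP (enorm y) pi; last exact: le_trans (gdist_le_pi _ _) (ltW y0).
rewrite /gdist val_sphere_exp dotDl !dotZl.
have -> : dot (y *m J) (val A) = 0 by rewrite dotE -mulmxA frame_tangent mulmx0 mxE.
have -> : dot (val A) (val A) = 1 by exact/eqP/(valP A).
by rewrite mulr1 mulr0 addr0 cosK// in_itv/= enorm_ge0.
Qed.

Lemma gdist_sphere_exp_le x y :
  gdist (sphere_exp J x) (sphere_exp J y) <= enorm x + enorm y.
Proof.
apply: (le_trans (gdist_triangle _ A _)); apply: lerD; first exact: gdist_sphere_exp_base.
by rewrite gdistC; exact: gdist_sphere_exp_base.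
Qed.

Variable e : nat -> R.
Hypotheses (e0 : forall k, 0 < e k) (ec : e k @[k --> \oo] --> 0).

(** The differential of the exponential map at the origin is J. The vector x = 0 is apart, since the
    quotients by |x| lose their meaning. *)
Lemma sphere_exp_sub_div_cvg x j :
  (val (sphere_exp J (e k *: x)) 0 j - val A 0 j) / e k @[k --> \oo] --> (x *m J) 0 j.
Proof.
have [->|x0] := eqVneq x 0.
  rewrite mul0mx mxE (_ : (fun k => _) = cst 0); first exact: cvg_cst.
  apply/funext => k; rewrite val_sphere_exp scaler0 enorm0 mul0mx scaler0 addr0 cos0.
  by rewrite scale1r subrr mul0r.
have N0 : enorm x != 0 by rewrite gt_eqF// enorm_gt0.
have u0 k : e k * enorm x != 0 by rewrite mulf_neq0// gt_eqF.
have uc : e k * enorm x @[k --> \oo] --> 0.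
  have -> : (0 : measurableTypeR R) = 0 * enorm x by rewrite mul0r.
  by apply: cvgMr_tmp; exact: ec.
rewrite (_ : (fun k => _) = fun k =>
    (cos (e k * enorm x) - 1) / (e k * enorm x) * (enorm x * val A 0 j) +
    sin (e k * enorm x) / (e k * enorm x) * (x *m J) 0 j); last first.
  apply/funext => k; rewrite sphere_exp_coord enormZ (gtr0_norm (e0 k)) -scalemxAl.
  have -> : (e k *: (x *m J)) 0 j = e k * (x *m J) 0 j by rewrite mxE.
  by field; rewrite N0 gt_eqF.
have c1 : (cos (e k * enorm x) - 1) / (e k * enorm x) * (enorm x * val A 0 j) @[k --> \oo] -->
    (0 * (enorm x * val A 0 j) : R).
  by apply: cvgMr_tmp; exact: (cos_div_cvg u0 uc).
have c2 : sin (e k * enorm x) / (e k * enorm x) * (x *m J) 0 j @[k --> \oo] -->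
    (1 * (x *m J) 0 j : R).
  by apply: cvgMr_tmp; exact: (sin_div_cvg u0 uc).
by have := cvgD c1 c2; rewrite mul0r mul1r add0r; exact.
Qed.

Lemma gdist_sphere_exp_cvg x y :
  gdist (sphere_exp J (e k *: x)) (sphere_exp J (e k *: y)) / e k @[k --> \oo] -->
  enorm (x - y).
Proof.
rewrite -enorm_frame mulmxBl; apply: gdist_cvg; [exact: nearW|exact: ec|] => j.
rewrite mxE [X in _ + X]mxE.
rewrite (_ : (fun k => _) = fun k =>
    (val (sphere_exp J (e k *: x)) 0 j - val A 0 j) / e k -
    (val (sphere_exp J (e k *: y)) 0 j - val A 0 j) / e k); last first.
  by apply/funext => k; ring.
exact: cvgB (@sphere_exp_sub_div_cvg x j) (@sphere_exp_sub_div_cvg y j).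
Qed.

End exponential_asymptotics.

Section rescaled_gap.
Context {R : realType} (n : nat) (H delta : R) (A : @sphere R n) (J : tangent_frame A).
Hypothesis n_gt0 : (0 < n)%N.
Hypotheses (H_gt0 : 0 < H) (H_lt : H < 2^-1) (delta_gt0 : 0 < delta).
Local Notation p := (2 * H).
Local Notation vec := ('rV[R]_n).
Local Notation gap_at u := (KH n H 0 - KH n H u).
Variable e : nat -> R.
Hypotheses (e0 : forall k, 0 < e k) (ec : e k @[k --> \oo] --> 0).

Local Notation D k := (@dilated_ball R n delta (e k)).
Local Notation dist k x := (gdist (dilated_exp J (e k) x.1) (dilated_exp J (e k) x.2)).

Let p_gt0 : 0 < p. Proof. by rewrite mulr_gt0. Qed.
Let p_ge0 : 0 <= p. Proof. exact: ltW. Qed.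
Let mKH := measurable_KH n_gt0 H_gt0 H_lt.

Lemma measurable_dist k : measurable_fun setT (fun x : vec * vec => dist k x).
Proof.
apply: measurable_gdist_fun.
  exact: (measurableT_comp (measurable_dilated_exp J (e k)) measurable_fst).
exact: (measurableT_comp (measurable_dilated_exp J (e k)) measurable_snd).
Qed.

Lemma dist_le k (x : vec * vec) : dist k x <= e k * (enorm x.1 + enorm x.2).
Proof.
apply: (le_trans (gdist_sphere_exp_le _ _ _)).
by rewrite !enormZ (gtr0_norm (e0 k)) mulrDr.
Qed.

Definition scaled_gap k (x : vec * vec) : R :=
  e k `^ (- p) * (\1_(D k) x.1 * \1_(D k) x.2 * gap_at (dist k x)).

Lemma measurable_scaled_gap k : measurable_fun setT (scaled_gap k).
Proof.
have mD := @measurable_dilated_ball R n delta (e k).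
apply: measurable_funM => //; apply: measurable_funM.
  by apply: measurable_funM; apply: (measurableT_comp (measurable_indic mD)).
apply: measurable_funB; first exact: measurable_cst.
exact: (measurableT_comp mKH (measurable_dist k)).
Qed.

Lemma powRN_mul_powR (x y : R) : 0 < x -> 0 <= y -> x `^ (- p) * y `^ p = (y / x) `^ p.
Proof.
move=> x0 y0; rewrite mulrC powRM ?invr_ge0 ?(ltW x0)//; congr (_ * _).
by rewrite -powR_inv1 ?(ltW x0)// -powRrM mulN1r.
Qed.

(** The powers of e cancel in e^(-2H) C d^(2H), because d <= e (|x| + |y|). *)
Lemma scaled_gap_dom : exists2 C : R, 0 <= C & forall k x,
  `|scaled_gap k x| <= C * (enorm x.1 `^ p + enorm x.2 `^ p).
Proof.
have [C C0 gC] := KH_gap_le n_gt0 H_gt0 H_lt.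
exists (C * 2 `^ p) => [|k x]; first by rewrite mulr_ge0// powR_ge0.
have d0 := gdist_ge0 (dilated_exp J (e k) x.1) (dilated_exp J (e k) x.2).
have := gC _ d0; have := dist_le k x; rewrite /scaled_gap.
move: (KH n H 0 - _) => g; move: (gdist _ _) d0 => d d0 dle gle.
have n0 : 0 <= enorm x.1 + enorm x.2 by rewrite addr_ge0 ?enorm_ge0.
rewrite normrM (ger0_norm (powR_ge0 _ _)) normrM.
apply: (@le_trans _ _ (e k `^ (- p) * (C * d `^ p))).
  rewrite ler_wpM2l ?powR_ge0//; apply: le_trans gle; rewrite ler_piMl//.
  rewrite ger0_norm ?mulr_ge0//; rewrite !indicE; case: (_ \in _); case: (_ \in _);
    by rewrite ?mul1r ?mul0r.
rewrite mulrCA -mulrA ler_wpM2l// powRN_mul_powR//.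
apply: (@le_trans _ _ ((enorm x.1 + enorm x.2) `^ p)); last first.
  by apply: powRD_le => //; exact: enorm_ge0.
apply: ge0_ler_powR => //; rewrite ?nnegrE ?divr_ge0 ?(ltW (e0 k))//.
by rewrite ler_pdivrMr// mulrC.
Qed.

Lemma scaled_gap_cvg (x : vec * vec) :
  scaled_gap k x @[k --> \oo] --> K2 n H * enorm (x.1 - x.2) `^ p.
Proof.
have inD (y : vec) : \forall k \near \oo, \1_(D k) y = 1 :> R.
  have c : e k * enorm y @[k --> \oo] --> (0 * enorm y : R).
    by apply: cvgMr_tmp; exact: ec.
  rewrite mul0r in c.
  near=> k; rewrite indicE mem_set//= /dilated_ball/= enormZ (gtr0_norm (e0 k)).
  by near: k; exact: (cvgr_lt _ c _ delta_gt0).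
have dc : dist k x / e k @[k --> \oo] --> enorm (x.1 - x.2).
  exact: gdist_sphere_exp_cvg.
(* On the diagonal the distance is constantly 0, so it does not approach 0 from the right and the
   limit defining [K2] does not apply. *)
have [xx|xx] := eqVneq x.1 x.2.
  rewrite xx subrr enorm0 powR0 ?gt_eqF// mulr0.
  rewrite (_ : (fun k => _) = cst 0); first exact: cvg_cst.
  by apply/funext => k; rewrite /scaled_gap xx gdistxx subrr !mulr0.
have l0 : 0 < enorm (x.1 - x.2) by rewrite enorm_gt0 subr_eq0.
have d0 : dist k x @[k --> \oo] --> (0 : R).
  have -> : (0 : measurableTypeR R) = enorm (x.1 - x.2) * 0 by rewrite mulr0.
  have c := cvgM dc ec; apply: cvg_trans (c _); apply: near_eq_cvg; near=> k.
  by rewrite /= divfK// gt_eqF.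
have dpos : \forall k \near \oo, 0 < dist k x.
  near=> k; have : 0 < dist k x / e k by near: k; exact: (cvgr_gt _ dc _ l0).
  by rewrite pmulr_lgt0// invr_gt0.
have dr : dist k x @[k --> \oo] --> (0 : R)^'+.
  move=> P /= hP; have := d0 _ hP; rewrite /nbhs/= => hd.
  change (\forall k \near \oo, P (dist k x)).
  have hd' : \forall k \near \oo, 0 < dist k x -> P (dist k x) by exact: hd.
  near=> k; have : 0 < dist k x by near: k; exact: dpos.
  by near: k.
have c1 := cvg_comp _ _ dr (K2_cvg n_gt0 H_gt0 H_lt).
have c2 := cvg_comp _ _ dc (continuous_powR (p := p) l0).
(* The rescaled gap is split as d^(-2H) (K_H(0) - K_H(d)), which tends to [K2], times (d /
   e)^(2H). *)
have c3 : (dist k x `^ (- p) * gap_at (dist k x)) * ((dist k x / e k) `^ p) @[k --> \oo] -->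
   (K2 n H * enorm (x.1 - x.2) `^ p : R) by apply: cvgM; [exact: c1|exact: c2].
apply: cvg_trans c3; apply: near_eq_cvg; near=> k.
have i1 : \1_(D k) x.1 = 1 :> R by near: k; exact: inD.
have i2 : \1_(D k) x.2 = 1 :> R by near: k; exact: inD.
have dk : 0 < dist k x by near: k; exact: dpos.
rewrite /scaled_gap i1 i2; move: (KH n H 0 - _) => g; move: (gdist _ _) dk => d d'.
rewrite !mul1r -powRN_mul_powR ?(ltW d')//.
have -> : d `^ (- p) * g * (e k `^ (- p) * d `^ p) =
    (d `^ (- p) * d `^ p) * (e k `^ (- p) * g) by ring.
rewrite -powRD; last by rewrite (gt_eqF d') implybT.
by rewrite addNr powRr0 mul1r.
Unshelve. all: by end_near. Qed.

End rescaled_gap.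

Section product_integrable.
Context {R : realType} d1 d2 (T1 : measurableType d1) (T2 : measurableType d2).
Variables (m1 : {finite_measure set T1 -> \bar R}) (m2 : {finite_measure set T2 -> \bar R}).

Lemma integrable_product_fst (f : T1 -> R) : (forall x, 0 <= f x) ->
  m1.-integrable setT (EFin \o f) ->
  (m1 \x m2)%E.-integrable setT (EFin \o (fun x => f x.1)).
Proof.
move=> f0 /integrableP[mf fi]; have mf1 := measurableT_comp mf (@measurable_fst _ _ T1 T2).
have F0 (x : T1 * T2) : (0 <= ((EFin \o f) \o fst) x :> \bar R)%E by rewrite lee_fin.
apply/integrableP; split => //.
rewrite (eq_integral ((EFin \o f) \o fst)) => [|x _]; last by rewrite /= ger0_norm.
rewrite (fubini_tonelli1 _ mf1 F0) /fubini_F.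
rewrite (eq_integral (fun x => (EFin \o f) x * m2 setT)%E) => [|x _]; last first.
  exact: (integral_cst m2 measurableT (f x)%:E).
rewrite ge0_integralZr//; last by move=> x _; rewrite lee_fin.
rewrite muleC lte_mul_pinfty// ?fin_num_measure//.
by move: fi; rewrite (eq_integral (EFin \o f)) => // x _; rewrite /= ger0_norm.
Qed.

Lemma integrable_product_snd (f : T2 -> R) : (forall x, 0 <= f x) ->
  m2.-integrable setT (EFin \o f) ->
  (m1 \x m2)%E.-integrable setT (EFin \o (fun x => f x.2)).
Proof.
move=> f0 /integrableP[mf fi]; have mf1 := measurableT_comp mf (@measurable_snd _ _ T1 T2).
have F0 (x : T1 * T2) : (0 <= ((EFin \o f) \o snd) x :> \bar R)%E by rewrite lee_fin.
apply/integrableP; split => //.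
rewrite (eq_integral ((EFin \o f) \o snd)) => [|x _]; last by rewrite /= ger0_norm.
rewrite (fubini_tonelli1 _ mf1 F0) /fubini_F.
apply: (@le_lt_trans _ _ ((\int[m2]_y (EFin \o f) y) * m1 setT)%E).
  by rewrite -(integral_cst m1 measurableT).
have If : (\int[m2]_y (EFin \o f) y < +oo)%E.
  by move: fi; rewrite (eq_integral (EFin \o f)) => // x _; rewrite /= ger0_norm.
have I0 : (0 <= \int[m2]_y (EFin \o f) y)%E by apply: integral_ge0 => y _; rewrite lee_fin.
by rewrite lte_mul_pinfty// ?ge0_fin_numE// ltey_eq fin_num_measure.
Qed.

End product_integrable.

Section mass.
Context {R : realType} (n : nat) (H delta e : R).
Hypotheses (H_gt0 : 0 < H) (delta_gt0 : 0 < delta) (e_gt0 : 0 < e).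
Local Notation p := (2 * H).
Local Notation D := (@dilated_ball R n delta e).

(* Markov: e |x| >= delta outside the dilated ball. *)
Lemma dilated_ballC_le (m : {finite_measure set 'rV[R]_n -> \bar R}) :
  m.-integrable setT (fun x => (enorm x `^ p)%:E) ->
  fine (m (~` D)) <= e `^ p * (delta `^ (- p) * \int[m]_x enorm x `^ p).
Proof.
move=> im.
have mDC : measurable (~` D) by apply: measurableC; exact: measurable_dilated_ball.
have K0 : 0 <= e `^ p * delta `^ (- p) by rewrite mulr_ge0 ?powR_ge0.
have iK : m.-integrable setT (EFin \o (fun x => e `^ p * delta `^ (- p) * enorm x `^ p)).
  exact: (integrableZl measurableT (e `^ p * delta `^ (- p)) im).
rewrite mulrA -(RintegralZl _ measurableT im) -lee_fin (Rintegral_fineE iK).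
rewrite fineK ?fin_num_measure// -[in leLHS](setIT (~` D)) -integral_indic//.
apply: ge0_le_integral => //.
- by apply/measurable_EFinP; exact: measurable_indic.
- by have /integrableP[] := iK.
move=> x _; rewrite lee_fin indicE; case: (boolP (x \in ~` D)) => [/set_mem xD|_]; last first.
  by rewrite mulr_ge0// powR_ge0.
rewrite -mulrA [X in _ * X]mulrC mulrA -powRM ?enorm_ge0 ?(ltW e_gt0)//.
rewrite powRN -ler_pdivrMr ?invr_gt0 ?powR_gt0// invrK mul1r.
apply: ge0_ler_powR; rewrite ?nnegrE ?mulr_ge0 ?enorm_ge0 ?(ltW e_gt0) ?(ltW H_gt0) ?(ltW delta_gt0)//.
by move/negP: xD; rewrite -leNgt enormZ gtr0_norm.
Qed.

(** As tau has total mass zero, its mass in the dilated ball is minus its mass outside, which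
    Markov's inequality bounds for each Jordan part. *)
Lemma mass_dilated_ball_le (tau : {charge set 'rV[R]_n -> \bar R}) : in_MH H tau ->
  `|fine (charge_pos tau D) - fine (charge_neg tau D)| <=
  e `^ p * (delta `^ (- p) * (\int[charge_pos tau]_x enorm x `^ p +
                              \int[charge_neg tau]_x enorm x `^ p)).
Proof.
move=> tauMH; have [ip iN] := in_MH_integrable H_gt0 tauMH.
have mD := @measurable_dilated_ball R n delta e.
have mDC := measurableC mD.
have split_mass (m : {finite_measure set 'rV[R]_n -> \bar R}) :
    fine (m setT) = fine (m D) + fine (m (~` D)).
  by rewrite -fineD ?fin_num_measure// -measureU// ?setICr// setUv.
have E : fine (charge_pos tau setT) = fine (charge_neg tau setT).
  have := charge_diff_jordan tau measurableT; case: tauMH => -> _.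
  have := fin_num_measure (charge_pos tau) _ measurableT.
  have := fin_num_measure (charge_neg tau) _ measurableT.
  move: (charge_pos tau setT) (charge_neg tau setT) => [a| |] [b| |]//= _ _ [h].
  by apply/eqP; rewrite -subr_eq0 h.
have := dilated_ballC_le ip; have := dilated_ballC_le iN.
move: E; rewrite !split_mass mulrDr mulrDr.
have := fine_ge0 (measure_ge0 (charge_pos tau) (~` D)).
have := fine_ge0 (measure_ge0 (charge_neg tau) (~` D)).
move: (fine _) (fine _) (fine _) (fine _) => a b c d' a0 b0 E h1 h2.
rewrite ler_norml; lra.
Qed.

End mass.

(** * Limit of the rescaled covariance *)

Section covariance_limit.
Context {R : realType} (n : nat) (H delta : R) (A : @sphere R n) (J : tangent_frame A).
Hypothesis n_gt0 : (0 < n)%N.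
Hypotheses (H_gt0 : 0 < H) (H_lt : H < 2^-1) (delta_gt0 : 0 < delta).
Local Notation p := (2 * H).
Local Notation vec := ('rV[R]_n).

Let p_gt0 : 0 < p. Proof. by rewrite mulr_gt0. Qed.
Let mKH := measurable_KH n_gt0 H_gt0 H_lt.

Lemma KH_ge0 u : 0 <= KH n H u.
Proof.
rewrite (KH_kd n_gt0 H_gt0 H_lt); apply: mulr_ge0 => //; apply: Rintegral_ge0 => y _.
apply: kernel_density_ge0; have : 1 <= n%:R :> R by rewrite ler1n.
by move: H_lt; lra.
Qed.

Lemma KH_gdist_bounded : exists M : R, forall z : @sphere R n * @sphere R n,
  0 <= KH n H (gdist z.1 z.2) <= M.
Proof.
have [C C0 gC] := KH_gap_le n_gt0 H_gt0 H_lt.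
exists (KH n H 0 + C * pi `^ p) => z; rewrite KH_ge0/=.
have h := gC _ (gdist_ge0 z.1 z.2).
have : C * gdist z.1 z.2 `^ p <= C * pi `^ p.
  rewrite ler_wpM2l//; apply: ge0_ler_powR; rewrite ?nnegrE ?gdist_ge0 ?pi_ge0 ?gdist_le_pi//.
  exact: ltW.
move: h; move: (KH n H 0) (KH n H _) (C * _) (C * _) => a b c d'.
by rewrite ler_norml => /andP[]; lra.
Qed.

Lemma measurable_KH_gdist :
  measurable_fun setT (fun z : @sphere R n * @sphere R n => KH n H (gdist z.1 z.2)).
Proof. exact: (measurableT_comp mKH (@measurable_gdist R n)). Qed.

Variable e : nat -> R.
Hypotheses (e0 : forall k, 0 < e k) (ec : e k @[k --> \oo] --> 0).
Local Notation D k := (@dilated_ball R n delta (e k)).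
Local Notation sgap := (scaled_gap H delta J e).
Local Notation mexp k := (restr_pushforward (@measurable_dilated_ball R n delta (e k))
  (measurable_dilated_exp J (e k))).
Local Notation moment m := ((m).-integrable setT (fun x : vec => (enorm x `^ p)%:E)).

Lemma scaled_gap_dom_integrable (C : R) (m m' : {finite_measure set vec -> \bar R}) :
  moment m -> moment m' ->
  (m \x m')%E.-integrable setT
    (EFin \o (fun x : vec * vec => C * (enorm x.1 `^ p + enorm x.2 `^ p))).
Proof.
move=> im im'; have f0 (x : vec) : 0 <= enorm x `^ p by exact: powR_ge0.
have i1 := integrable_product_fst m' f0 im; have i2 := integrable_product_snd m f0 im'.
exact: (integrableZl measurableT C (integrableD measurableT i1 i2)).
Qed.

Lemma scaled_gap_integrable k (m m' : {finite_measure set vec -> \bar R}) :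
  moment m -> moment m' -> (m \x m')%E.-integrable setT (EFin \o sgap k).
Proof.
move=> im im'; have [C C0 dC] := scaled_gap_dom delta J n_gt0 H_gt0 H_lt e0.
apply: (le_integrable measurableT _ _ (scaled_gap_dom_integrable C im im')).
  by apply/measurable_EFinP; exact: measurable_scaled_gap.
move=> x _; rewrite /= lee_fin; apply: (le_trans (dC k x)); exact: ler_norm.
Qed.

Lemma Rintegral_scaled_gap_cvg (m m' : {finite_measure set vec -> \bar R}) :
  moment m -> moment m' ->
  \int[(m \x m')%E]_x sgap k x @[k --> \oo] -->
  K2 n H * \int[(m \x m')%E]_x enorm (x.1 - x.2) `^ p.
Proof.
move=> im im'; have [C C0 dC] := scaled_gap_dom delta J n_gt0 H_gt0 H_lt e0.
have f0 (x : vec) : 0 <= enorm x `^ p by exact: powR_ge0.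
have ip : (m \x m')%E.-integrable setT (EFin \o (fun x : vec * vec => enorm (x.1 - x.2) `^ p)).
  apply: (le_integrable measurableT _ _ (scaled_gap_dom_integrable (2 `^ p) im im')).
    by apply/measurable_EFinP; exact: measurable_enormB_powR.
  move=> x _; rewrite /= lee_fin (ger0_norm (powR_ge0 _ _)); apply: le_trans (ler_norm _).
  apply: le_trans (powRD_le (ltW p_gt0) (enorm_ge0 _) (enorm_ge0 _)).
  apply: ge0_ler_powR; rewrite ?nnegrE ?addr_ge0 ?enorm_ge0 ?(ltW p_gt0)//.
  by rewrite -(enormN x.2) ler_enormD.
rewrite -(RintegralZl _ measurableT ip).
apply: (@Rintegral_dominated_cvg _ _ _ (m \x m')%E sgap
  (fun x => K2 n H * enorm (x.1 - x.2) `^ p)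
  (fun x => C * (enorm x.1 `^ p + enorm x.2 `^ p))).
- by move=> k; exact: measurable_scaled_gap.
- by apply: measurable_funM; [exact: measurable_cst|exact: measurable_enormB_powR].
- exact: scaled_gap_dom_integrable.
- by apply: aeW => x; exact: scaled_gap_cvg.
- by apply: aeW => x k; exact: dC.
Qed.

(** On pairs inside the ball K_H(d) is K_H(0) minus the gap. The constant integrates to a product of
    masses, which is small only once the Jordan parts are recombined. *)
Lemma Rintegral_KH_split k (m m' : {finite_measure set vec -> \bar R}) :
  moment m -> moment m' ->
  e k `^ (- p) * \int[(mexp k m \x mexp k m')%E]_z KH n H (gdist z.1 z.2) =
  e k `^ (- p) * KH n H 0 * (fine (m (D k)) * fine (m' (D k))) -
  \int[(m \x m')%E]_x sgap k x.
Proof.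
move=> im im'; have mD := @measurable_dilated_ball R n delta (e k).
pose b (x : vec * vec) : R := \1_(D k) x.1 * \1_(D k) x.2.
have mb : measurable_fun setT b.
  by apply: measurable_funM; apply: (measurableT_comp (measurable_indic mD)).
have ib : (m \x m')%E.-integrable setT (EFin \o b).
  apply: (@bounded_product_integrable _ _ _ _ _ _ _ _ 1) => // x.
  by rewrite /b !indicE; case: (_ \in _); case: (_ \in _); rewrite ?mul0r ?mul1r ?normr0 ?normr1 ?ler01 ?lexx.
have Ib : \int[(m \x m')%E]_x b x = fine (m (D k)) * fine (m' (D k)).
  rewrite /Rintegral -fineM ?fin_num_measure//; congr fine.
  rewrite -(product_measure1E m m' mD mD) -[X in (m \x m')%E X]setIT -integral_indic//.
    apply: eq_integral => x _; rewrite /b !indicE in_setX.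
    by case: (_ \in _); case: (_ \in _); rewrite ?mul0r ?mul1r.
  exact: measurableX.
pose c := e k `^ (- p) * KH n H 0.
have ibc : (m \x m')%E.-integrable setT (EFin \o (fun x => c * b x)).
  exact: (integrableZl measurableT c ib).
have isg := scaled_gap_integrable k im im'.
rewrite -Ib -(RintegralZl c measurableT ib) -(RintegralB measurableT ibc isg).
have E2 := ge0_integral_restr_push2 mD (measurable_dilated_exp J (e k)) m m'
  measurable_KH_gdist (fun z => KH_ge0 _).
pose h (x : vec * vec) : R :=
  b x * KH n H (gdist (dilated_exp J (e k) x.1) (dilated_exp J (e k) x.2)).
have I1 : \int[(mexp k m \x mexp k m')%E]_z KH n H (gdist z.1 z.2) = \int[(m \x m')%E]_x h x.
  exact: (congr1 fine E2).
have ih : (m \x m')%E.-integrable setT (EFin \o h).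
  have [M KM] := KH_gdist_bounded.
  apply: (@bounded_product_integrable _ _ _ _ _ _ _ _ M).
    exact: (measurable_funM mb (measurableT_comp mKH (measurable_dist J e k))).
  move=> x; have /andP[] := KM (dilated_exp J (e k) x.1, dilated_exp J (e k) x.2).
  rewrite /h /=; move: (KH _ _ _) => v v0 vM; rewrite /b !indicE.
  by case: (_ \in _); case: (_ \in _);
    rewrite ?mul0r ?mul1r ?mul0r ?normr0 ?(le_trans v0 vM)// ger0_norm.
apply: (etrans (congr1 _ I1)); apply: (etrans (esym (RintegralZl _ measurableT ih))).
apply: eq_Rintegral => x _; rewrite /c /h /scaled_gap -/(b x).
by move: (KH n H 0) (KH n H _) (b x) => u v w; ring.
Qed.

(** Each net mass is O(e^(2H)), so the product is O(e^(4H)) against the factor e^(-2H). *)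
Lemma mass_product_cvg (tau tau' : {charge set vec -> \bar R}) : in_MH H tau -> in_MH H tau' ->
  e k `^ (- p) * KH n H 0 *
    ((fine (charge_pos tau (D k)) - fine (charge_neg tau (D k))) *
     (fine (charge_pos tau' (D k)) - fine (charge_neg tau' (D k)))) @[k --> \oo] --> (0 : R).
Proof.
move=> tauMH tauMH'; apply/norm_cvg0P.
have := KH_ge0 0; move: (KH n H 0) => v v0.
have B k := mass_dilated_ball_le H_gt0 delta_gt0 (e0 k) tauMH.
have B' k := mass_dilated_ball_le H_gt0 delta_gt0 (e0 k) tauMH'.
move: (delta `^ _ * _) B (delta `^ _ * _) B' => M1 B M2 B'.
have ep : e k `^ p @[k --> \oo] --> 0.
  by have /cvg_at_rightP/(_ e) := powR_cvg0 p_gt0; apply; split.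
have lim0 : v * M1 * M2 * e k `^ p @[k --> \oo] --> (0 : R).
  have -> : (0 : measurableTypeR R) = v * M1 * M2 * 0 by rewrite mulr0.
  by apply: cvgMl_tmp; exact: ep.
apply: (@squeeze_cvgr _ _ _ _ (cst 0) (fun k => v * M1 * M2 * e k `^ p)) => //;
  last exact: cvg_cst.
apply: nearW => k; rewrite normr_ge0/=.
rewrite !normrM (ger0_norm (powR_ge0 _ _)) (ger0_norm v0).
have := ler_pM (normr_ge0 _) (normr_ge0 _) (B k) (B' k).
move: (`|_| * `|_|) => q qle.
apply: (@le_trans _ _ (e k `^ (- p) * v * (e k `^ p * M1 * (e k `^ p * M2)))).
  by rewrite ler_wpM2l// mulr_ge0// powR_ge0.
have -> : e k `^ (- p) * v * (e k `^ p * M1 * (e k `^ p * M2)) =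
    (e k `^ (- p) * e k `^ p) * (v * M1 * M2 * e k `^ p) by ring.
rewrite -powRD; last by rewrite (gt_eqF (e0 k)) implybT.
by rewrite addNr powRr0 mul1r.
Qed.

Lemma WH_cov_cvg (tau tau' : {charge set vec -> \bar R}) : in_MH H tau -> in_MH H tau' ->
  e k `^ (- p) * WH_cov H (exp_pushforward J delta (dilate tau (e k)))
    (exp_pushforward J delta (dilate tau' (e k))) @[k --> \oo] --> TH_cov H tau tau'.
Proof.
move=> tauMH tauMH'.
have [ip iN] := in_MH_integrable H_gt0 tauMH; have [ip' iN'] := in_MH_integrable H_gt0 tauMH'.
have [M KM] := KH_gdist_bounded.
pose S (m m' : {finite_measure set vec -> \bar R}) k := \int[(m \x m')%E]_x sgap k x.
rewrite (_ : (fun k => _) = fun k => e k `^ (- p) * KH n H 0 *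
    ((fine (charge_pos tau (D k)) - fine (charge_neg tau (D k))) *
     (fine (charge_pos tau' (D k)) - fine (charge_neg tau' (D k)))) -
    (S (charge_pos tau) (charge_pos tau') k - S (charge_pos tau) (charge_neg tau') k -
     S (charge_neg tau) (charge_pos tau') k + S (charge_neg tau) (charge_neg tau') k));
    last first.
  apply/funext => k.
  rewrite /WH_cov (charge_integral2_diff (charge_diff_exp_pushforward J delta (e k) tau)
    (charge_diff_exp_pushforward J delta (e k) tau') measurable_KH_gdist KM).
  have alg (c v w1 w2 w3 w4 a1 a2 b1 b2 s1 s2 s3 s4 : R) :
      c * w1 = v * (a1 * b1) - s1 -> c * w2 = v * (a1 * b2) - s2 ->
      c * w3 = v * (a2 * b1) - s3 -> c * w4 = v * (a2 * b2) - s4 ->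
      c * (w1 - w2 - w3 + w4) = v * ((a1 - a2) * (b1 - b2)) - (s1 - s2 - s3 + s4).
    by move=> h1 h2 h3 h4; rewrite mulrDr !mulrBr h1 h2 h3 h4; ring.
  exact: (alg _ _ _ _ _ _ _ _ _ _ _ _ _ _ (Rintegral_KH_split k ip ip')
    (Rintegral_KH_split k ip iN') (Rintegral_KH_split k iN ip') (Rintegral_KH_split k iN iN')).
pose I (m m' : {finite_measure set vec -> \bar R}) :=
  \int[(m \x m')%E]_x enorm (x.1 - x.2) `^ p.
have -> : TH_cov H tau tau' = 0 -
    (K2 n H * I (charge_pos tau) (charge_pos tau') - K2 n H * I (charge_pos tau) (charge_neg tau') -
     K2 n H * I (charge_neg tau) (charge_pos tau') + K2 n H * I (charge_neg tau) (charge_neg tau')).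
  by rewrite /TH_cov /charge_integral2 /I sub0r mulNr mulrDr !mulrBr.
have c1 := Rintegral_scaled_gap_cvg ip ip'; have c2 := Rintegral_scaled_gap_cvg ip iN'.
have c3 := Rintegral_scaled_gap_cvg iN ip'; have c4 := Rintegral_scaled_gap_cvg iN iN'.
have c0 := mass_product_cvg tauMH tauMH'.
exact: (cvgB c0 (cvgD (cvgB (cvgB c1 c2) c3) c4)).
Qed.

End covariance_limit.

(** * From Gaussian functionals to Gaussian vectors *)

Section gaussian_functionals.
Context {R : realType} d (T : measurableType d) (P : probability T R).

Lemma gaussian_vectorZ k (X : 'I_k -> T -> R) (S : 'I_k -> 'I_k -> R) (a : R) :
  gaussian_vector P X S ->
  gaussian_vector P (fun i w => X i w * a) (fun i j => a ^+ 2 * S i j).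
Proof.
move=> [mX gX XS]; split => [i|c|i j].
- exact: measurable_funM.
- rewrite (_ : (fun w => _) = fun w => \sum_i (c i * a) * X i w); first exact: gX.
  by apply/funext => w; apply: eq_bigr => i _; rewrite mulrCA mulrC [_ * X i w]mulrC mulrA mulrAC.
have XXi := second_moment_integrable mX XS i j.
have := XS i j; rewrite unlock => E.
rewrite EFinM -E -(integralZl measurableT XXi).
by apply: eq_integral => w _; rewrite !fctE /= -EFinM; congr EFin; ring.
Qed.

(** Each coordinate is centered, by the Gaussian clause for a one-term combination, so the
    prescribed covariances are second moments. *)
Lemma gaussian_functional_vector d' (E : measurableType d')
    (S : {charge set E -> \bar R} -> Prop) (X : {charge set E -> \bar R} -> {RV P >-> R})
    (C : {charge set E -> \bar R} -> {charge set E -> \bar R} -> R) k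
    (mu : 'I_k -> {charge set E -> \bar R}) :
  gaussian_functional S X C -> (forall i, S (mu i)) ->
  gaussian_vector P (fun i => X (mu i)) (fun i j => C (mu i) (mu j)).
Proof.
move=> [_ gX cX] Smu; split => [i|c|i j]; [exact: measurable_funPT|exact: gX|].
have mean0 i' : fine 'E_P[X (mu i')] = 0.
  apply: centered_gaussian_mean; first exact: measurable_funPT.
  have := gX 1%N (fun=> 1) (fun=> mu i') (fun=> Smu i').
  by under eq_fun do rewrite big_ord1 mul1r.
rewrite -(cX _ _ (Smu i) (Smu j)) covariance.unlock !mean0.
by congr ('E_P[_])%E; apply/funext => w; rewrite /= !fctE /= !subr0.
Qed.

End gaussian_functionals.

Section covariance_at_right.
Context {R : realType} (n : nat) (H delta : R) (A : @sphere R n) (J : tangent_frame A).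

Lemma WH_cov_scaled_cvg (tau tau' : {charge set 'rV[R]_n -> \bar R}) :
  (0 < n)%N -> 0 < H -> H < 2^-1 -> 0 < delta -> in_MH H tau -> in_MH H tau' ->
  (e `^ H)^-1 ^+ 2 * WH_cov H (exp_pushforward J delta (dilate tau e))
    (exp_pushforward J delta (dilate tau' e)) @[e --> 0^'+] --> TH_cov H tau tau'.
Proof.
move=> n0 H0 H1 d0 tauMH tauMH'; apply/cvg_at_rightP => e [e0 ec].
have c := WH_cov_cvg J n0 H0 H1 d0 e0 ec tauMH tauMH'.
apply: cvg_trans c; apply: near_eq_cvg; near=> k; congr (_ * _).
rewrite exprVn -powR_mulrn ?powR_ge0// -powRrM mulrC.
by rewrite -powR_inv1 ?powR_ge0// -powRrM mulrN1 mulrC.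
Unshelve. all: by end_near. Qed.

End covariance_at_right.

Theorem theorem3p2 (R : realType) (n : nat) (H delta : R)
    (A : sphere n) (J : tangent_frame A)
    (d : measure_display) (T : measurableType d) (P : probability T R)
    (W : {charge set (sphere n) -> \bar R} -> {RV P >-> R}) :
  (1 <= n)%N -> 0 < H < 2^-1 -> 1 < delta < pi ->
  gaussian_functional (fun _ => True) W (WH_cov H) ->
  (* TH_cov is positive semidefinite: the law of T_H is well defined *)
  (forall tau : {charge set 'rV[R]_n -> \bar R},
    in_MH H tau -> 0 <= TH_cov H tau tau) /\
  (forall (d' : measure_display) (T' : measurableType d')
      (P' : probability T' R)
      (TH : {charge set 'rV[R]_n -> \bar R} -> {RV P' >-> R}),
    gaussian_functional (in_MH H) TH (TH_cov H) ->
    forall (k : nat) (tau : 'I_k -> {charge set 'rV[R]_n -> \bar R}),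
      (1 <= k)%N -> (forall i, in_MH H (tau i)) ->
      cvg_in_distribution (0^'+) P
        (fun e w => \row_i (W (exp_pushforward J delta (dilate (tau i) e)) w
                            / e `^ H))
        P' (fun w => \row_i TH (tau i) w)).
Proof.
move=> n0 /andP[H0 H1] /andP[d1 _] gW; have d0 : 0 < delta := lt_trans ltr01 d1.
have gWe k (tau : 'I_k -> {charge set 'rV[R]_n -> \bar R}) (e : R) :
    gaussian_vector P
      (fun i w => W (exp_pushforward J delta (dilate (tau i) e)) w / e `^ H)
      (fun i j => (e `^ H)^-1 ^+ 2 * WH_cov H (exp_pushforward J delta (dilate (tau i) e))
        (exp_pushforward J delta (dilate (tau j) e))).
  apply: gaussian_vectorZ.
  exact: (gaussian_functional_vector (mu := fun i => exp_pushforward J delta (dilate (tau i) e)) gW).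
split=> [tau tauMH|d' T' P' TH gTH k tau _ tauMH].
  (* [TH_cov H tau tau] is a limit of second moments of rescaled values of W, hence nonnegative; no
     functional [TH] has to be given for this. *)
  have c := WH_cov_scaled_cvg J n0 H0 H1 d0 tauMH tauMH.
  rewrite -(cvg_lim _ c)//; apply: limr_ge; first by apply/cvg_ex; eexists; exact: c.
  apply: nearW => e; have [_ _ /(_ ord0 ord0)] := gWe 1%N (fun=> tau) e.
  rewrite unlock => E; rewrite -lee_fin -E; apply: integral_ge0 => w _.
  by rewrite fctE lee_fin -expr2 sqr_ge0.
apply: (gaussian_vector_cvg (S := fun e i j => (e `^ H)^-1 ^+ 2 *
  WH_cov H (exp_pushforward J delta (dilate (tau i) e)) (exp_pushforward J delta (dilate (tau j) e)))
  (S' := fun i j => TH_cov H (tau i) (tau j))).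
- by apply: nearW => e; exact: gWe.
- exact: (gaussian_functional_vector gTH tauMH).
- by move=> i j; exact: WH_cov_scaled_cvg.
Qed.
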